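(* Let $D\subset\mathbb{R}^n$ be a simply connected open set containing $0$, and let $\{\phi_1,\dots,\phi_n\}$ be a Combescure sequence of Guichard$_k$ orthogonal co-ordinate systems on $D$ with $\phi_i(0)=0$ for all $i$. Then there exist a solution $F$ of the $\frac{\mathrm{O}(2n-k,k)}{\mathrm{O}(n)\times\mathrm{O}(n-k,k)}$-system on $D$, an extended frame $E$ for $F$, and a null basis $\{{\vec{c}}_1,\dots,{\vec{c}}_n\}$ of $\mathbb{R}^{n-k,k}$ such that, writing $\frac{\partial E}{\partial\lambda}E^{-1}\big|_{\lambda=0}=\begin{pmatrix}0&Y\\-JY^T&0\end{pmatrix}$ with $Y$ an $n\times n$-matrix-valued map, one has $\phi_\ell=Y{\vec{c}}_\ell$ for all $1\le\ell\le n$.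
   Context: Fix integers $n\ge2$ and $1\le k\le n-1$. Let $\epsilon_i=1$ for $1\le i\le n-k$ and $\epsilon_i=-1$ for $n-k<i\le n$, $J=\operatorname{diag}(\epsilon_1,\dots,\epsilon_n)$, and $(\vec x,\vec y)_k=\vec x^TJ\vec y$ on $\mathbb{R}^n$ (denoted $\mathbb{R}^{n-k,k}$). A null basis of $\mathbb{R}^{n-k,k}$ is a basis of vectors ${\vec{c}}$ with $({\vec{c}},{\vec{c}})_k=0$. $\delta=\operatorname{diag}(\mathrm{d} x_1,\dots,\mathrm{d} x_n)$. Let $G=\operatorname{diag}(\mathrm{I}_n,J)$; $\mathrm{O}(2n-k,k)^{\mathbb{C}}$ is the group of complex $2n\times2n$ matrices $A$ with $A^TGA=G$; $\mathrm{I}_{n,n}=\operatorname{diag}(\mathrm{I}_n,-\mathrm{I}_n)$. The $\frac{\mathrm{O}(2n-k,k)}{\mathrm{O}(n)\times\mathrm{O}(n-k,k)}$-system is the PDE for a smooth map $F=(f_{ij})$ into real $n\times n$ matrices with $f_{ii}=0$, requiring that $\omega=-\delta JF+F^TJ\delta$ and $\tau=-\delta F^TJ+F\delta J$ are both flat; equivalently $\theta_\lambda=\begin{pmatrix}\omega&-\lambda\delta J\\ \lambda\delta&\tau\end{pmatrix}$ is flat for all $\lambda\in\mathbb{C}$. An extended frame for $F$ is a smooth map $E:D\times\mathbb{C}\to\mathrm{O}(2n-k,k)^{\mathbb{C}}$, holomorphic in $\lambda$, with $E(\cdot,\lambda)^{-1}\mathrm{d} E(\cdot,\lambda)=\theta_\lambda$,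 $\overline{E(x,\bar\lambda)}=E(x,\lambda)$ and $\mathrm{I}_{n,n}E(x,-\lambda)\mathrm{I}_{n,n}^{-1}=E(x,\lambda)$. An orthogonal co-ordinate system on an open $U\subset\mathbb{R}^n$ is a smooth $\phi:U\to\mathbb{R}^n$ with nonzero mutually orthogonal partials; a metric field is $\vec u$ with $\phi^*(\mathrm{d} s_0^2)=\sum u_i^2\mathrm{d} x_i^2$. $\phi$ is Guichard$_k$ if $\sum_{i\le n-k}u_i^2=\sum_{i>n-k}u_i^2$. $\phi\mapsto\psi$ is a Combescure transform if $\phi_{x_i}(x)\parallel\psi_{x_i}(x)$ for all $i,x$. A sequence $\{\phi_1,\dots,\phi_n\}$ of Guichard$_k$ orthogonal co-ordinate systems is a Combescure sequence if each $\phi_i\mapsto\phi_{i+1}$ is a Combescure transform and the metric fields $\vec u_i=(u_{i1},\dots,u_{in})^T$ of $\phi_i$, chosen so that $(\phi_i)_{x_j}/u_{ij}=(\phi_1)_{x_j}/u_{1j}$ for all $i,j$, are linearly independent at every point. *)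

(* Defs.v *)
From HB Require Import structures.
From mathcomp Require Import all_boot all_order all_algebra.
From mathcomp Require Import all_classical all_reals all_analysis.
From mathcomp Require Import complex.
Set Implicit Arguments. Unset Strict Implicit. Unset Printing Implicit Defensive.
Import Order.TTheory GRing.Theory Num.Theory.
Import numFieldNormedType.Exports.
Local Open Scope classical_set_scope.
Local Open Scope ring_scope.

Section Defs.
Variable R : realType.

(* ---------- real calculus on R^n (points are row vectors 'rV[R]_n) ---------- *)

(* i-th standard basis direction of R^n *)
Definition ev {n} (i : 'I_n) : 'rV[R]_n := delta_mx 0 i.

(* partial derivative d/dx_i *)
Definition partial {n} {V : normedModType R} (i : 'I_n) (f : 'rV[R]_n -> V)
  : 'rV[R]_n -> V := fun x => 'D_(ev i) f x.

(* iterated partial derivative along the sequence of directions s *)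
Fixpoint iter_partial {n} {V : normedModType R} (s : seq 'I_n)
  (f : 'rV[R]_n -> V) : 'rV[R]_n -> V :=
  match s with
  | [::] => f
  | i :: s' => partial i (iter_partial s' f)
  end.

(* C^infinity on D: all iterated partial derivatives exist and are continuous
   at every point of D *)
Definition smooth_on {n} {V : normedModType R} (D : set 'rV[R]_n)
  (f : 'rV[R]_n -> V) : Prop :=
  forall (s : seq 'I_n) (x : 'rV[R]_n), D x ->
    {for x, continuous (iter_partial s f)} /\
    (forall i, derivable (iter_partial s f) x (ev i)).

(* simply connected: nonempty, path connected, every loop null-homotopic
   (as based loops) inside D *)
Definition unitI : set R := [set t | 0 <= t <= 1].

Definition simply_connected {n} (D : set 'rV[R]_n) : Prop :=
  (exists x, D x) /\
  (forall x y, D x -> D y ->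
     exists g : R -> 'rV[R]_n, {within unitI, continuous g} /\
       g @` unitI `<=` D /\ g 0 = x /\ g 1 = y) /\
  (forall g : R -> 'rV[R]_n, {within unitI, continuous g} ->
     g @` unitI `<=` D -> g 0 = g 1 ->
     exists H : R * R -> 'rV[R]_n,
       {within unitI `*` unitI, continuous H} /\
       H @` (unitI `*` unitI) `<=` D /\
       (forall t, unitI t -> H (0, t) = g t /\ H (1, t) = g 0) /\
       (forall s, unitI s -> H (s, 0) = g 0 /\ H (s, 1) = g 0)).

(* ---------- linear algebra ---------- *)

(* Euclidean inner product on column vectors *)
Definition edot {n} (v w : 'cV[R]_n) : R := (v^T *m w) 0 0.

(* J = diag(eps_1..eps_n), eps_i = 1 for i <= n-k, -1 otherwise (1-based);
   with 0-based ordinals: 1 if i < n-k *)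
Definition Jmat (n k : nat) : 'M[R]_n :=
  diag_mx (\row_(i < n) (if (i < n - k)%N then 1 else -1)).

(* (x,y)_k = x^T J y *)
Definition kdot (n k : nat) (v w : 'cV[R]_n) : R := (v^T *m Jmat n k *m w) 0 0.

Definition parallel {n} (v w : 'cV[R]_n) : Prop :=
  (exists a : R, v = a *: w) \/ (exists a : R, w = a *: v).

(* null basis of R^{n-k,k}, indexed 1..n *)
Definition null_basis (n k : nat) (c : nat -> 'cV[R]_n) : Prop :=
  (forall l, (1 <= l <= n)%N -> kdot k (c l) (c l) = 0) /\
  row_free (\matrix_(l < n) (c l.+1)^T).

(* ---------- orthogonal co-ordinate systems ---------- *)

Definition orth_coord_sys {n} (U : set 'rV[R]_n) (phi : 'rV[R]_n -> 'cV[R]_n)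
  : Prop :=
  smooth_on U phi /\
  forall x, U x ->
    (forall i, partial i phi x != 0) /\
    (forall i j, i != j -> edot (partial i phi x) (partial j phi x) = 0).

(* phi^*(ds_0^2) = sum u_i^2 dx_i^2 *)
Definition metric_field {n} (U : set 'rV[R]_n) (phi : 'rV[R]_n -> 'cV[R]_n)
  (u : 'rV[R]_n -> 'cV[R]_n) : Prop :=
  forall x, U x -> forall i j,
    edot (partial i phi x) (partial j phi x) =
    (if i == j then (u x i 0) ^+ 2 else 0).

Definition guichard {n} (k : nat) (U : set 'rV[R]_n)
  (phi : 'rV[R]_n -> 'cV[R]_n) : Prop :=
  orth_coord_sys U phi /\
  exists u, metric_field U phi u /\
    forall x, U x ->
      \sum_(i < n | (i < n - k)%N) (u x i 0) ^+ 2 =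
      \sum_(i < n | (n - k <= i)%N) (u x i 0) ^+ 2.

Definition combescure {n} (U : set 'rV[R]_n) (phi psi : 'rV[R]_n -> 'cV[R]_n)
  : Prop :=
  forall i x, U x -> parallel (partial i phi x) (partial i psi x).

(* Combescure sequence {phi_1,..,phi_n} (indices 1..n) of Guichard_k
   orthogonal co-ordinate systems on U *)
Definition combescure_seq {n} (k : nat) (U : set 'rV[R]_n)
  (phi : nat -> 'rV[R]_n -> 'cV[R]_n) : Prop :=
  (forall i, (1 <= i <= n)%N -> guichard k U (phi i)) /\
  (forall i, (1 <= i < n)%N -> combescure U (phi i) (phi i.+1)) /\
  exists u : nat -> 'rV[R]_n -> 'cV[R]_n,
    (forall i, (1 <= i <= n)%N -> metric_field U (phi i) (u i)) /\
    (forall i j x, (1 <= i <= n)%N -> U x ->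
        (u i x j 0)^-1 *: partial j (phi i) x =
        (u 1%N x j 0)^-1 *: partial j (phi 1%N) x) /\
    (forall x, U x -> row_free (\matrix_(i < n) (u i.+1 x)^T)).

(* ---------- the O(2n-k,k)/(O(n) x O(n-k,k)) system ---------- *)

(* the matrix coefficient of dx_i in delta = diag(dx_1,..,dx_n) *)
Definition Emat {n} (i : 'I_n) : 'M[R]_n := delta_mx i i.

(* omega = -delta J F + F^T J delta, coefficient of dx_i *)
Definition omega_form {n} (k : nat) (F : 'rV[R]_n -> 'M[R]_n) (i : 'I_n)
  : 'rV[R]_n -> 'M[R]_n :=
  fun x => - (Emat i *m Jmat n k *m F x) + (F x)^T *m Jmat n k *m Emat i.

(* tau = -delta F^T J + F delta J, coefficient of dx_i *)
Definition tau_form {n} (k : nat) (F : 'rV[R]_n -> 'M[R]_n) (i : 'I_n)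
  : 'rV[R]_n -> 'M[R]_n :=
  fun x => - (Emat i *m (F x)^T *m Jmat n k) + F x *m Emat i *m Jmat n k.

(* flatness of the matrix 1-form sum_i A_i dx_i : d theta + theta /\ theta = 0 *)
Definition flat_on {n m} (D : set 'rV[R]_n) (A : 'I_n -> 'rV[R]_n -> 'M[R]_m)
  : Prop :=
  forall x, D x -> forall i j,
    partial i (A j) x - partial j (A i) x + (A i x *m A j x - A j x *m A i x) = 0.

Definition system_solution {n} (k : nat) (D : set 'rV[R]_n)
  (F : 'rV[R]_n -> 'M[R]_n) : Prop :=
  smooth_on D F /\
  (forall x i, D x -> F x i i = 0) /\
  flat_on D (omega_form k F) /\ flat_on D (tau_form k F).

(* ---------- complex matrices, extended frames ---------- *)

Definition rc (r : R) : R[i] := (r +i* 0)%C.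
Definition cmx {m p} (A : 'M[R]_(m, p)) : 'M[R[i]]_(m, p) := map_mx rc A.

(* G = diag(I_n, J), I_{n,n} = diag(I_n, -I_n) *)
Definition Gmat (n k : nat) : 'M[R[i]]_(n + n) := block_mx 1 0 0 (cmx (Jmat n k)).
Definition Inn (n : nat) : 'M[R[i]]_(n + n) := block_mx 1 0 0 (- 1).

(* theta_lambda, coefficient of dx_i *)
Definition theta {n} (k : nat) (F : 'rV[R]_n -> 'M[R]_n) (l : R[i])
  (i : 'I_n) (x : 'rV[R]_n) : 'M[R[i]]_(n + n) :=
  block_mx (cmx (omega_form k F i x)) (- (l *: cmx (Emat i *m Jmat n k)))
           (l *: cmx (Emat i)) (cmx (tau_form k F i x)).

(* partial derivative in x_i of a complex-matrix valued map, entrywise on the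
   real and imaginary parts *)
Definition cpartial {n m p} (i : 'I_n) (G : 'rV[R]_n -> 'M[R[i]]_(m, p))
  (x : 'rV[R]_n) : 'M[R[i]]_(m, p) :=
  \matrix_(a, b) (partial i (fun y => (complex.Re (G y a b) : R^o)) x
                  +i* partial i (fun y => (complex.Im (G y a b) : R^o)) x)%C.

(* identification R^n x C = R^(n+2) *)
Definition xpart {n} (p : 'rV[R]_(n + 2)) : 'rV[R]_n :=
  \row_(j < n) p 0 (lshift 2 j).
Definition lpart {n} (p : 'rV[R]_(n + 2)) : R[i] :=
  (p 0 (rshift n (0 : 'I_2)) +i* p 0 (rshift n (1 : 'I_2)))%C.

Definition extended_frame {n} (k : nat) (D : set 'rV[R]_n)
  (F : 'rV[R]_n -> 'M[R]_n) (E : 'rV[R]_n -> (R[i])^o -> 'M[R[i]]_(n + n))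
  : Prop :=
  (* smooth on D x C (as a map of the n+2 real variables x, Re l, Im l) *)
  smooth_on [set p | D (xpart p)]
    (fun p => \matrix_(a, b) complex.Re (E (xpart p) (lpart p) a b)) /\
  smooth_on [set p | D (xpart p)]
    (fun p => \matrix_(a, b) complex.Im (E (xpart p) (lpart p) a b)) /\
  (* holomorphic in lambda *)
  (forall x (l : (R[i])^o), D x -> derivable (E x) l 1) /\
  (* values in O(2n-k,k)^C *)
  (forall x l, D x -> (E x l)^T *m Gmat n k *m E x l = Gmat n k) /\
  (* E^{-1} dE = theta_lambda *)
  (forall x l i, D x -> invmx (E x l) *m cpartial i (fun y => E y l) x = theta k F l i x) /\
  (* reality condition *)
  (forall x (l : R[i]), D x -> map_mx (fun z : R[i] => z^*) (E x (l^*)) = E x l) /\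
  (* twisting condition *)
  (forall x (l : R[i]), D x -> Inn n *m E x (- l) *m invmx (Inn n) = E x l).

End Defs.

(* Main.v *)
(**
Combescure equivalence makes the [phi_l] share one orthonormal frame [A], so
[d_j phi_l = u_lj A e_j]: the matrix with columns [phi_l] has partial
derivatives [A E_j U], where row [j] of [U] collects the [u_lj].  Equality of
mixed second derivatives forces [A^T d_i A] to be the form [omega] of some [F]
and [V = - J U] to satisfy [d_i V = - tau_i V].  The Guichard condition says
that the columns of [V] are null; then [V^T J V] is constant (its derivative
vanishes by skewness of [J tau], its diagonal is zero at every point), so that
[B = V(0) V^-1] is [J]-orthogonal with [d_i B = B tau_i].  Hence [omega] and
[tau] are pure gauge, and [Y = Phi V(0)^-1] has derivative [- A E_i B^T J].

No integration of a differential equation is needed for the frame.  With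
[K] the block matrix with off-diagonal blocks [Y] and [- J Y^T], the 1-form
[dK] satisfies [dK /\ dK = 0] in the strong sense that its coefficients
commute.  The Poincare lemma on the simply connected domain then gives
matrices with [G_0 = 1], [d G_(m+1) = G_m dK], [G_(m+1)(0) = 0].  These are
bounded by [C^m / m!] locally uniformly, and
[E = (sum_m lambda^m G_m) diag(A, B)] is the extended frame; [G_1 = K] gives
the logarithmic derivative at [lambda = 0].
*)
Require Import Defs.
From HB Require Import structures.
From mathcomp Require Import all_boot all_order all_algebra.
From mathcomp Require Import all_classical all_reals all_analysis.
From mathcomp Require Import complex.
From mathcomp Require Import ring lra zify.
Set Implicit Arguments. Unset Strict Implicit. Unset Printing Implicit Defensive.
Import Order.TTheory GRing.Theory Num.Theory.
Import numFieldNormedType.Exports.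
Local Open Scope classical_set_scope.
Local Open Scope ring_scope.

(** The vectors [c_l] are the columns of V(0): then Y = Phi V(0)^-1 gives Y c_l = phi_l at once, and
    nullity of [c_l] is the Guichard condition at 0. Equality of mixed derivatives determines d_i
    U_jl only for j different from i; differentiating the Guichard condition supplies the missing
    d_i U_il, and only then does V satisfy the tau equation. Conjugation by E_0 = diag(A, B) turns
    the coefficients of dK into the constant matrices that multiply lambda in theta_lambda, and
    products of two different ones vanish because E_i E_j = 0. This makes each form G_m dK closed
    and yields dE = E theta_lambda coefficient by coefficient in lambda. Orthogonality and twisting
    are then settled by uniqueness from the values at x = 0, where every G_m with m > 0 vanishes;
    reality holds because all coefficients are real. The analytic obstacle is that E has to be
    smooth in the n + 2 real variables x, Re lambda, Im lambda. It is met by a class of coefficient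
    families that is stable under derivatives in x and in lambda. *)

(** * Directional derivatives read along lines *)

Lemma is_derive_line_at {R : realType} (V W : normedModType R) (f : V -> W) (a v : V) (t : R) (df : W) :
  is_derive (t *: v + a) v f df <-> is_derive t (1 : R) (fun h : R => f (h *: v + a)) df.
Proof.
have E : (fun h : R => h^-1 *: ((f \o shift (t *: v + a)) (h *: v) - f (t *: v + a))) =
  (fun h : R => h^-1 *: (((fun h : R => f (h *: v + a)) \o shift t) (h *: 1) - f (t *: v + a))).
  by apply/funext => h /=; rewrite [_%:A]mulr1 scalerDl addrA.
by split=> -[H1 H2]; split; rewrite /derivable /derive ?E// -?E//.
Qed.

Lemma is_derive_line {R : realType} (V W : normedModType R) (f : V -> W) (x v : V) (df : W) :
  is_derive x v f df <-> is_derive (0 : R) (1 : R) (fun h : R => f (h *: v + x)) df.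
Proof. by rewrite -is_derive_line_at scale0r add0r. Qed.

Lemma is_deriveP {R : numFieldType} (V W : normedModType R) (f : V -> W) (x v : V) (df : W) :
  is_derive x v f df -> 'D_v f x = df.
Proof. by case. Qed.

(** * Functions of class C^k on an open set, described by partial derivatives *)

Section Ck.
Context {R : realType} {n : nat} (D : set 'rV[R]_n).
Implicit Types (f g : 'rV[R]_n -> R^o) (m : nat).

(** The recursion peels off the innermost derivative, whereas [iter_partial] peels off the outermost
    one. In this form sum and product rules go through by induction on [m]. *)
Fixpoint Ck m f : Prop :=
  match m with
  | 0 => forall x, D x -> {for x, continuous f}
  | m'.+1 => (forall x, D x -> {for x, continuous f} /\
                (forall i, derivable f x (ev R i))) /\
             forall i, Ck m' (partial i f)
  end.

Definition sm f := forall m, Ck m f.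

Hypothesis oD : open D.

Lemma near_open x : D x -> \forall y \near x, D y.
Proof. by move=> Dx; apply: open_nbhs_nbhs. Qed.

Lemma near_openW (P : 'rV[R]_n -> Prop) x : D x -> (forall y, D y -> P y) ->
  \forall y \near x, P y.
Proof. by move=> Dx H; apply: filterS (near_open Dx). Qed.

Lemma continuous_eq_open (V : topologicalType) (f g : 'rV[R]_n -> V) x :
  D x -> (forall y, D y -> f y = g y) ->
  {for x, continuous f} -> {for x, continuous g}.
Proof.
move=> Dx fg cf A /=; rewrite -(fg x Dx) => /cf.
have := near_open Dx; apply: filterS2 => y Dy /=.
by rewrite -(fg y Dy).
Qed.

Lemma eq_partial (V : normedModType R) (f g : 'rV[R]_n -> V) i x :
  D x -> (forall y, D y -> f y = g y) -> partial i f x = partial i g x.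
Proof.
move=> Dx fg; apply: near_eq_derive.
exact: near_openW Dx _.
Qed.

Lemma eq_derivable (V : normedModType R) (f g : 'rV[R]_n -> V) v x :
  D x -> (forall y, D y -> f y = g y) -> derivable f x v -> derivable g x v.
Proof.
move=> Dx fg; apply: near_eq_derivable.
exact: near_openW Dx _.
Qed.

Lemma eq_Ck m f g : (forall y, D y -> f y = g y) -> Ck m f -> Ck m g.
Proof.
elim: m f g => [|m IH] f g fg /=.
  by move=> cf x Dx; apply: continuous_eq_open (cf _ Dx).
case=> cf df; split=> [x Dx|i].
  split; first by apply: continuous_eq_open (cf _ Dx).1.
  by move=> i; apply: eq_derivable ((cf _ Dx).2 i).
by apply: IH (df i) => y Dy; apply: eq_partial.
Qed.

Lemma Ck_cont m f x : Ck m f -> D x -> {for x, continuous f}.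
Proof. by case: m => [|m] /=; [exact|case=> H _ Dx; case: (H _ Dx)]. Qed.

(** Lets an explicit formula for the partials, valid on [D] only, stand in for [partial i f]; as [D]
    is open, agreement on [D] passes to all further derivatives. *)
Lemma CkSI m f (df : 'I_n -> 'rV[R]_n -> R^o) :
  (forall x, D x -> {for x, continuous f}) ->
  (forall i x, D x -> is_derive x (ev R i) f (df i x)) ->
  (forall i, Ck m (df i)) -> Ck m.+1 f.
Proof.
move=> cf Hf Cf; split=> [x Dx|i]; first by split; [exact: cf|move=> i; case: (Hf i x Dx)].
by apply: eq_Ck (Cf i) => y Dy; rewrite /partial (is_deriveP (Hf i y Dy)).
Qed.

Lemma CkW m f : Ck m.+1 f -> Ck m f.
Proof.
elim: m f => [|m IH] f [cf df]; first by move=> x Dx; case: (cf x Dx).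
by split=> // i; apply: IH.
Qed.

Lemma Ck_derive m f x i : Ck m.+1 f -> D x -> is_derive x (ev R i) f (partial i f x).
Proof. by case=> H _ Dx; case: (H x Dx) => _ dH; apply: derivableP. Qed.

Lemma sm_derive f x i : sm f -> D x -> is_derive x (ev R i) f (partial i f x).
Proof. by move=> /(_ 1%N); apply: Ck_derive. Qed.

Lemma sm_cont f x : sm f -> D x -> {for x, continuous f}.
Proof. by move=> /(_ 0%N); apply: Ck_cont. Qed.

Lemma sm_partial f i : sm f -> sm (partial i f).
Proof. by move=> sf m; case: (sf m.+1) => _; apply. Qed.

Lemma smI f (df : 'I_n -> 'rV[R]_n -> R^o) :
  (forall x, D x -> {for x, continuous f}) ->
  (forall i x, D x -> is_derive x (ev R i) f (df i x)) ->
  (forall i, sm (df i)) -> sm f.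
Proof.
move=> cf Hf Cf [|m]; first exact: cf.
by apply: CkSI Hf _ => // i; apply: Cf.
Qed.

Lemma eq_sm f g : (forall y, D y -> f y = g y) -> sm f -> sm g.
Proof. by move=> fg sf m; apply: eq_Ck (sf m). Qed.

Lemma Ck_cst m (a : R) : Ck m (fun _ => a).
Proof.
elim: m a => [|m IH] a; first by move=> x _; apply: cst_continuous.
apply: (@CkSI m _ (fun _ _ => 0)).
- by move=> x _; apply: cst_continuous.
- by move=> i; exact: (IH 0).
Qed.

Lemma CkD m f g : Ck m f -> Ck m g -> Ck m (f \+ g).
Proof.
elim: m f g => [|m IH] f g Cf Cg.
  by move=> x Dx; apply: continuousD; [apply: Cf|apply: Cg].
apply: (@CkSI m _ (fun i => partial i f \+ partial i g)).
- by move=> x Dx; apply: continuousD; [apply: Ck_cont Cf _|apply: Ck_cont Cg _].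
- by move=> i x Dx; apply: is_deriveD; [apply: Ck_derive Cf _|apply: Ck_derive Cg _].
- by move=> i; apply: IH; [apply Cf.2|apply Cg.2].
Qed.

Lemma CkM m f g : Ck m f -> Ck m g -> Ck m (fun x => f x * g x).
Proof.
elim: m f g => [|m IH] f g Cf Cg.
  by move=> x Dx; apply: continuousM; [apply: Cf|apply: Cg].
apply: (@CkSI m _ (fun i x => f x * partial i g x + g x * partial i f x)).
- by move=> x Dx; apply: continuousM; [apply: Ck_cont Cf _|apply: Ck_cont Cg _].
- move=> i x Dx.
  by apply: is_deriveM; [apply: Ck_derive Cf _|apply: Ck_derive Cg _].
- move=> i; apply: CkD; apply: IH.
  + exact: CkW.
  + exact: Cg.2.
  + exact: CkW.
  + exact: Cf.2.
Qed.

Lemma CkZ m (a : R) f : Ck m f -> Ck m (fun x => a * f x).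
Proof. by move=> Cf; apply: CkM => //; apply: Ck_cst. Qed.

Lemma CkN m f : Ck m f -> Ck m (fun x => - f x).
Proof.
move=> Cf; apply: (@eq_Ck _ (fun x => (-1) * f x)); last exact: CkZ.
by move=> y _; rewrite mulN1r.
Qed.

Lemma Ck_sum m (I : Type) (r : seq I) (P : pred I) (f : I -> 'rV[R]_n -> R^o) :
  (forall i, P i -> Ck m (f i)) -> Ck m (fun x => \sum_(i <- r | P i) f i x).
Proof.
move=> Cf; elim: r => [|i r IH].
  apply: eq_Ck (Ck_cst m 0); by move=> y _; rewrite big_nil.
case Pi: (P i); last first.
  by apply: eq_Ck IH => y _; rewrite big_cons Pi.
have := CkD (Cf _ Pi) IH.
by apply: eq_Ck => y _; rewrite big_cons Pi.
Qed.

Lemma sm_cst (a : R) : sm (fun _ => a). Proof. by move=> m; apply: Ck_cst. Qed.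
Lemma smM f g : sm f -> sm g -> sm (fun x => f x * g x).
Proof. by move=> sf sg m; apply: CkM. Qed.
Lemma smZ (a : R) f : sm f -> sm (fun x => a * f x).
Proof. by move=> sf m; apply: CkZ. Qed.
Lemma smN f : sm f -> sm (fun x => - f x).
Proof. by move=> sf m; apply: CkN. Qed.
Lemma sm_sum (I : Type) (r : seq I) (P : pred I) (f : I -> 'rV[R]_n -> R^o) :
  (forall i, P i -> sm (f i)) -> sm (fun x => \sum_(i <- r | P i) f i x).
Proof. by move=> sf m; apply: Ck_sum => i Pi; apply: sf. Qed.

(* [(g^-1/2)' = -1/2 (g^-1/2)^3 g'], which bootstraps *)
Lemma sm_invsqrt g : sm g -> (forall x, D x -> 0 < g x) ->
  sm (fun x => (Num.sqrt (g x))^-1).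
Proof.
move=> sg g0; set r := fun x => _.
have cr x : D x -> {for x, continuous r}.
  move=> Dx; apply: (@continuousV _ _ (fun x => Num.sqrt (g x) : R)).
    by rewrite gt_eqF// sqrtr_gt0 g0.
  apply: (@continuous_comp _ _ _ g (fun y : R => Num.sqrt y)).
    exact: sm_cont.
  exact: sqrt_continuous.
have dr i x : D x -> is_derive x (ev R i) r
    (- 2^-1 * (r x * (r x * (r x * partial i g x)))).
  move=> Dx.
  have s0 : 0 < Num.sqrt (g x) by rewrite sqrtr_gt0 g0.
  have dl : is_derive (0 : R) (1 : R) (fun h : R => (Num.sqrt (g (h *: ev R i + x)))^-1)
      (- 2^-1 * (r x * (r x * (r x * partial i g x)))).
    have dgl := (is_derive_line _ _ _ _).1 (sm_derive i sg Dx).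
    have e0 : g (0 *: ev R i + x) = g x by rewrite scale0r add0r.
    have ds : is_derive (g (0 *: ev R i + x)) 1 (fun y : R => Num.sqrt y) (2 * Num.sqrt (g x))^-1.
      by rewrite e0; apply: is_derive1_sqrt; exact: g0.
    have dc := @is_derive1_comp R _ _ _ _ _ ds dgl.
    have dv : derivable (fun h : R => Num.sqrt (g (h *: ev R i + x))) 0 1 by case: dc.
    split; first by apply: derivableV => //; rewrite e0 gt_eqF.
    rewrite deriveV//=; last by rewrite e0 gt_eqF.
    rewrite e0 (@derive_val _ _ _ _ _ _ _ dc) /r /GRing.scale/=.
    by field; rewrite gt_eqF.
  exact/is_derive_line.
elim=> [|m IH]; first exact: cr.
apply: (CkSI cr dr) => i; apply: CkZ; do 3 apply: CkM => //.
exact: (sm_partial i sg m).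
Qed.

End Ck.

(** * Elementary estimates and mean value inequalities in one variable *)

Lemma ler_dist_half {R : realFieldType} (a b c e : R) :
  `|c - a| <= e / 2 -> `|c - b| <= e / 2 -> `|a - b| <= e.
Proof. by rewrite !ler_norml => /andP[? ?] /andP[? ?]; apply/andP; split; lra. Qed.

(** Both hypotheses evaluate the second difference over a square of side [k], paired along one side
    or along the other. *)
Lemma second_difference_eq {R : fieldType} (a b c d P Q k : R) : k != 0 ->
  a - b - (c - d) = P * k * k -> a - c - (b - d) = Q * k * k -> P = Q.
Proof.
move=> k0 e1 e2; apply: (mulIf k0); apply: (mulIf k0).
by rewrite -e1 -e2; ring.
Qed.

(** The main way derivatives of integrals and series are obtained below: a quadratic error bound.
    The scalar field is left open because it serves for real directions and for the complex variable
    lambda. *)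
Lemma is_derive_quad {K : numFieldType} (V W : normedModType K) (f : V -> W)
    (x v : V) (d : W) (C e : K) : 0 < e -> 0 <= C ->
  (forall h : K, `|h| < e -> `|f (h *: v + x) - f x - h *: d| <= C * `|h| ^+ 2) ->
  is_derive x v f d.
Proof.
move=> e0 C0 H.
suff L : (fun h => h^-1 *: ((f \o shift x) (h *: v) - f x)) @ 0^' --> d.
  by split; [apply/cvg_ex; exists d|apply: cvg_lim].
apply/cvgrPdist_le => eps eps0; near=> h.
have h0 : h != 0 by near: h; exact: nbhs_dnbhs_neq.
have he : `|h| < e by near: h; exact: dnbhs0_lt.
(* [C] may be 0, hence the [C + 1]. *)
have hC : `|h| < eps / (C + 1).
  by near: h; apply: dnbhs0_lt; rewrite divr_gt0// ltr_wpDl.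
have -> : d - h^-1 *: ((f \o shift x) (h *: v) - f x) =
  - (h^-1 *: (f (h *: v + x) - f x - h *: d)).
  by rewrite [in RHS]scalerBr scalerA mulVf// scale1r opprB.
rewrite normrN normrZ normfV ler_pdivrMl ?normr_gt0//.
apply: (le_trans (H _ he)).
rewrite expr2 mulrCA ler_wpM2l//.
rewrite ltr_pdivlMr ?ltr_wpDl// in hC.
apply: le_trans (ltW hC); rewrite mulrC ler_wpM2l// lerDl//.
Unshelve. all: by end_near. Qed.

Section OneVar.
Context {R : realType}.
Implicit Types g h : R -> R.

Lemma is_derive_within_cont g (dg : R -> R) (a b : R) :
  (forall s : R, a <= s <= b -> is_derive s 1 g (dg s)) -> {within `[a, b], continuous g}.
Proof.
move=> H; apply: derivable_within_continuous => s; rewrite in_itv/= => /H; by case.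
Qed.

Lemma MVT_any g (dg : R -> R) (a b : R) :
  (forall s : R, Num.min a b <= s <= Num.max a b -> is_derive s 1 g (dg s)) ->
  exists2 s, Num.min a b <= s <= Num.max a b & g b - g a = dg s * (b - a).
Proof.
case: (leP a b) => [ab|/ltW ba] H.
  have [|c] := @MVT_segment R g dg a b ab _ (is_derive_within_cont H).
    by move=> s; rewrite in_itv/= => /andP[/ltW s1 /ltW s2]; apply: H; rewrite s1.
  by rewrite in_itv/= => cab E; exists c.
have [|c] := @MVT_segment R g dg b a ba _ (is_derive_within_cont H).
  by move=> s; rewrite in_itv/= => /andP[/ltW s1 /ltW s2]; apply: H; rewrite s1.
rewrite in_itv/= => cab E; exists c => //.
by rewrite -[LHS]opprB E -mulrN opprB.
Qed.

(** The symmetric condition [|s| <= |c|] avoids splitting on the sign of the increment [c] in every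
    use. *)
Lemma MVT0 g (dg : R -> R) (c : R) :
  (forall s : R, `|s| <= `|c| -> is_derive s 1 g (dg s)) ->
  exists2 s, `|s| <= `|c| & g c - g 0 = dg s * c.
Proof.
have mM s : Num.min 0 c <= s <= Num.max 0 c -> `|s| <= `|c|.
  case: (leP 0 c) => [c0|c0] /andP[s1 s2].
    by rewrite !ger0_norm.
  by rewrite !ler0_norm ?lerN2// ltW.
move=> H; have [|s sc] := @MVT_any g dg 0 c; first by move=> s /mM; apply: H.
by rewrite subr0 => E; exists s => //; apply: mM.
Qed.

(** Comparison of increments by the mean value theorem for h - g, in place of integrating the
    inequality. *)
Lemma le_MVT g h (dg dh : R -> R) :
  (forall s : R, 0 <= s <= 1 -> is_derive s 1 g (dg s)) ->
  (forall s : R, 0 <= s <= 1 -> is_derive s 1 h (dh s)) ->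
  (forall s : R, 0 <= s <= 1 -> dg s <= dh s) ->
  g 1 - g 0 <= h 1 - h 0.
Proof.
move=> Hg Hh gh.
have HB (s : R) : Num.min 0 1 <= s <= Num.max 0 1 ->
    is_derive s 1 (h \- g) (dh s - dg s).
  by rewrite min_l// max_r// => s01; apply: is_deriveB; [exact: Hh|exact: Hg].
have [s] := MVT_any HB; rewrite min_l// max_r// subr0 mulr1 => s01 /= E.
by have := gh _ s01; lra.
Qed.

Lemma ler_norm_MVT g h (dg dh : R -> R) :
  (forall s : R, 0 <= s <= 1 -> is_derive s 1 g (dg s)) ->
  (forall s : R, 0 <= s <= 1 -> is_derive s 1 h (dh s)) ->
  (forall s : R, 0 <= s <= 1 -> `|dg s| <= dh s) ->
  `|g 1 - g 0| <= h 1 - h 0.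
Proof.
move=> Hg Hh gh; rewrite ler_norml; apply/andP; split; last first.
  by apply: le_MVT Hg Hh _ => s s01; apply: le_trans (gh _ s01); exact: ler_norm.
have := @le_MVT (fun s => - g s) h (fun s => - dg s) dh.
have Hg' (s : R) : 0 <= s <= 1 -> is_derive s 1 (fun s => - g s) (- dg s).
  by move=> s01; apply: is_deriveN; apply: Hg.
move=> /(_ Hg' Hh) H.
suff: - g 1 - - g 0 <= h 1 - h 0 by lra.
by apply: H => s s01; apply: le_trans (gh _ s01); rewrite -normrN; exact: ler_norm.
Qed.

Lemma ler_norm_MVT_cst g (dg : R -> R) (K : R) :
  (forall s : R, 0 <= s <= 1 -> is_derive s 1 g (dg s)) ->
  (forall s : R, 0 <= s <= 1 -> `|dg s| <= K) ->
  `|g 1 - g 0| <= K.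
Proof.
move=> Hg gK.
have := @ler_norm_MVT g (fun s => K * s) dg (fun=> K) Hg.
rewrite mulr1 mulr0 subr0; apply => // s s01.
have := @is_deriveZ R R^o R^o id K s 1 1 (is_derive_id _ _).
by rewrite [K *: (1 : R^o)]mulr1.
Qed.

End OneVar.

(** * Balls, segments and continuity for the sup norm on row vectors *)

Section rowvec.
Context {R : realType} {n : nat}.
Implicit Types (v w x y : 'rV[R]_n).

Lemma rV_norm_le v (c : R) : 0 <= c -> (forall j, `|v 0 j| <= c) -> `|v| <= c.
Proof.
move=> c0 H; rewrite /Num.Def.normr/= mx_normrE; apply: bigmax_le => //.
by case=> i j _ /=; rewrite ord1.
Qed.

Lemma rV_coord_le v j : `|v 0 j| <= `|v|.
Proof.
rewrite [leRHS]/Num.Def.normr/= mx_normrE.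
exact: (le_bigmax _ (fun ij : 'I_1 * 'I_n => `|v ij.1 ij.2|) (0, j)).
Qed.

Lemma evE (i j : 'I_n) : ev R i 0 j = (i == j)%:R.
Proof. by rewrite /ev mxE eqxx/= eq_sym. Qed.

Lemma norm_ev (s : R) (i : 'I_n) : `|s *: ev R i| <= `|s|.
Proof.
apply: rV_norm_le => // j; rewrite mxE evE.
by case: eqP => _; rewrite ?mulr1// mulr0 normr0.
Qed.

Lemma open_ball (D : set 'rV[R]_n) x : open D -> D x ->
  exists2 r : R, 0 < r & forall y, `|y - x| < r -> D y.
Proof.
move=> oD Dx; have : nbhs x D by exact: open_nbhs_nbhs.
move=> /nbhs_normP[r /= r0 H]; exists r => // y yx; apply: H => /=.
by rewrite /ball_ /= distrC.
Qed.

Lemma cont_ball (f : 'rV[R]_n -> R) x (e : R) : 0 < e -> {for x, continuous f} ->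
  exists2 r : R, 0 < r & forall y, `|y - x| < r -> `|f y - f x| <= e.
Proof.
move=> e0 /cvgrPdist_le/(_ _ e0)/nbhs_normP[r /= r0 H]; exists r => // y yx.
by rewrite distrC; apply: H => /=; rewrite /ball_ /= distrC.
Qed.

Lemma nbhs_rV x (A : set 'rV[R]_n) (r : R) : 0 < r ->
  (forall y, `|y - x| < r -> A y) -> nbhs x A.
Proof.
move=> r0 H; apply/nbhs_ballP; exists r => // y; rewrite -ball_normE/= distrC.
exact: H.
Qed.

Lemma ball_cont (f : 'rV[R]_n -> R) x :
  (forall e : R, 0 < e ->
     exists2 r : R, 0 < r & forall y, `|y - x| < r -> `|f y - f x| <= e) ->
  {for x, continuous f}.
Proof.
move=> H A /nbhs_normP[e /= e0 eA].
have e20 : 0 < e / 2 by rewrite divr_gt0.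
have [r r0 Hr] := H _ e20.
apply: (nbhs_rV r0) => y yr.
apply: eA; rewrite /ball_/= distrC; apply: (le_lt_trans (Hr _ yr)).
by rewrite ltr_pdivrMr// ltr_pMr// ltr1n.
Qed.

Lemma lipschitz_cont (f : 'rV[R]_n -> R) x (r K : R) : 0 < r -> 0 <= K ->
  (forall y, `|y - x| < r -> `|f y - f x| <= K * `|y - x|) -> {for x, continuous f}.
Proof.
move=> r0 K0 L; apply: ball_cont => e e0.
have C0 : 0 < K + 1 by rewrite ltr_wpDl.
exists (Num.min r (e / (K + 1))); first by rewrite lt_min r0 divr_gt0.
move=> y; rewrite lt_min => /andP[yr ye]; apply: (le_trans (L y yr)).
rewrite ltr_pdivlMr// in ye; apply: le_trans (ltW ye).
by rewrite mulrC ler_wpM2l// lerDl.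
Qed.

Lemma seg_ball x y (a : 'rV[R]_n) (r t : R) :
  `|x - a| < r -> `|y - a| < r -> 0 <= t <= 1 -> `|t *: (y - x) + x - a| < r.
Proof.
move=> xr yr /andP[t0 t1].
have -> : t *: (y - x) + x - a = t *: (y - a) + (1 - t) *: (x - a).
  by apply/rowP => j; rewrite !mxE; ring.
apply: (le_lt_trans (ler_normD _ _)); rewrite !normrZ ger0_norm// ger0_norm ?subr_ge0//.
(* For t > 0 strictness comes from the [y] term; at t = 0 it has to come from the [x] term. *)
have [->|tn0] := eqVneq t 0; first by rewrite mul0r add0r subr0 mul1r.
have tp : 0 < t by rewrite lt_def tn0.
have : t * `|y - a| < t * r by rewrite ltr_pM2l.
have : (1 - t) * `|x - a| <= (1 - t) * r by rewrite ler_wpM2l ?subr_ge0// ltW.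
lra.
Qed.

End rowvec.

(** * From partial derivatives to directional derivatives, Taylor bounds and symmetry of second
    derivatives *)

Section C1.
Context {R : realType} {n : nat} (D : set 'rV[R]_n) (oD : open D).
Implicit Types (f : 'rV[R]_n -> R^o).

Lemma Ck_partial m f i : Ck D m.+1 f -> Ck D m (partial i f).
Proof. by case=> _; apply. Qed.

Lemma Ck_line m f i a (s : R) : Ck D m.+1 f -> D (s *: ev R i + a) ->
  is_derive s (1 : R) (fun s : R => f (s *: ev R i + a)) (partial i f (s *: ev R i + a)).
Proof.
by move=> Cf Ds; apply: (is_derive_line_at f a (ev R i) s _).1; apply: Ck_derive Cf Ds.
Qed.

(** The increment along h v is cut into n axis-parallel steps, each handled by the mean value
    theorem. Continuity is asked of the [df i] at [x] only, and not of [f], so the result is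
    available where continuity of [f] is still to be shown. *)
Lemma dirderiv f (df : 'I_n -> 'rV[R]_n -> R^o) x v :
  (forall i y, D y -> is_derive y (ev R i) f (df i y)) ->
  (forall i, {for x, continuous (df i)}) -> D x ->
  is_derive x v f (\sum_i v 0 i * df i x).
Proof.
move=> Hf cdf Dx.
suff L : (fun h => h^-1 *: ((f \o shift x) (h *: v) - f x)) @ 0^' -->
    (\sum_i v 0 i * df i x : R^o).
  by split; [apply/cvg_ex; eexists; exact: L|apply: cvg_lim].
apply/cvgrPdist_le => eps eps0.
have [r r0 rD] := open_ball oD Dx.
(* The errors of the n steps, weighted by [|v 0 i|], then add up to at most [eps]. *)
pose e1 : R := eps / (1 + \sum_i `|v 0 i|).
have S0 : 0 <= \sum_i `|v 0 i| by apply: sumr_ge0.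
have e10 : 0 < e1 by rewrite divr_gt0// ltr_wpDr.
have [r1 r10 r1H] : exists2 r1 : R, 0 < r1 & forall i y, `|y - x| < r1 ->
    `|df i y - df i x| <= e1.
  have H i : exists r1 : {posnum R}, forall y, `|y - x| < r1%:num ->
      `|df i y - df i x| <= e1.
    have [rr rr0 Hr] := cont_ball e10 (cdf i).
    by exists (PosNum rr0).
  pose F i := sval (cid (H i)).
  exists (\big[Num.min/1]_i (F i)%:num).
    by apply: lt_bigmin.
  move=> i y yx; apply: (svalP (cid (H i))); apply: (lt_le_trans yx).
  exact: bigmin_le.
near=> h.
have h0 : h != 0 by near: h; exact: nbhs_dnbhs_neq.
have hr : `|h| < Num.min r r1 / (1 + `|v|).
  by near: h; apply: dnbhs0_lt; rewrite divr_gt0 ?lt_min ?r0// ltr_wpDr.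
have {hr}[hr hr1] : `|h| * `|v| < r /\ `|h| * `|v| < r1.
  rewrite ltr_pdivlMr ?ltr_wpDr// lt_min in hr; case/andP: hr => a b.
  by split; [apply: le_lt_trans a|apply: le_lt_trans b]; rewrite ler_wpM2l// lerDr.
(* Staircase from 0 to h v: the first [k] coordinates have already been moved. *)
pose w (k : nat) : 'rV[R]_n := \row_j (if (j < k)%N then h * v 0 j else 0).
have wball (i : 'I_n) s : `|s| <= `|h * v 0 i| -> `|s *: ev R i + (w i + x) - x| <= `|h| * `|v|.
  move=> sh; rewrite addrA addrK; apply: rV_norm_le => [|j]; first by rewrite mulr_ge0.
  rewrite !mxE eqxx/=; have [->|ji] := eqVneq j i.
    rewrite ltnn addr0 mulr1; apply: (le_trans sh).
    by rewrite normrM ler_wpM2l// rV_coord_le.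
  rewrite mulr0 add0r; case: ifP => _; last by rewrite normr0 mulr_ge0.
  by rewrite normrM ler_wpM2l// rV_coord_le.
have step (i : 'I_n) : `|f (w i.+1 + x) - f (w i + x) - h * v 0 i * df i x| <=
    `|h| * `|v 0 i| * e1.
  have Hd (s : R) : `|s| <= `|h * v 0 i| -> is_derive s 1 (fun s : R => f (s *: ev R i + (w i + x)))
     (df i (s *: ev R i + (w i + x))).
    move=> sh; apply: (is_derive_line_at f (w i + x) (ev R i) s _).1; apply: Hf.
    by apply: rD; apply: le_lt_trans (wball _ _ sh) _.
  have [s sh] := MVT0 Hd.
  have -> : (h * v 0 i) *: ev R i + (w i + x) = w i.+1 + x.
    rewrite addrA; congr (_ + _); apply/rowP => j; rewrite !mxE eqxx/= ltnS.
    have [->|ji] := eqVneq j i; first by rewrite leqnn ltnn mulr1 addr0.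
    by rewrite mulr0 add0r ltn_neqAle ji.
  rewrite scale0r add0r => ->.
  rewrite [X in X - _]mulrC -mulrBr normrM [`|h * _|]normrM ler_wpM2l ?mulr_ge0//.
  by apply: r1H; apply: le_lt_trans (wball _ _ sh) _.
have tele : f (h *: v + x) - f x = \sum_(i < n) (f (w i.+1 + x) - f (w i + x)).
  have := telescope_sumr (fun k => f (w k + x)) (leq0n n).
  rewrite big_mkord => ->; congr (f _ - f _).
    by congr (_ + _); apply/rowP => j; rewrite !mxE ltn_ord.
  by rewrite -[LHS]add0r; congr (_ + _); apply/rowP => j; rewrite !mxE.
rewrite /= tele distrC -[X in _ - X](mulKf h0) -mulrBr normrM normfV.
rewrite ler_pdivrMl ?normr_gt0// mulr_sumr -sumrB.
apply: (le_trans (ler_norm_sum _ _ _)).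
apply: (@le_trans _ _ (\sum_(i < n) `|h| * `|v 0 i| * e1)).
  by apply: ler_sum => i _; rewrite mulrA; exact: step.
under eq_bigr do rewrite -mulrA.
rewrite -mulr_sumr -mulr_suml ler_wpM2l//.
rewrite /e1 mulrA ler_pdivrMr ?ltr_wpDr// mulrC ler_wpM2l ?ltW//.
by rewrite ltrDr.
Unshelve. all: by end_near. Qed.

Lemma C1_dirderiv f x v : Ck D 1 f -> D x ->
  is_derive x v f (\sum_i v 0 i * partial i f x).
Proof.
move=> Cf Dx.
exact: (@dirderiv f (fun i => partial i f) x v (fun i y Dy => Ck_derive i Cf Dy)
  (fun i => Cf.2 i x Dx) Dx).
Qed.

Lemma C1_seg f x y (t : R) : Ck D 1 f -> D (t *: (y - x) + x) ->
  is_derive t (1 : R) (fun t : R => f (t *: (y - x) + x))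
    (\sum_i (y - x) 0 i * partial i f (t *: (y - x) + x)).
Proof. by move=> Cf Dt; apply: (is_derive_line_at f x (y - x) t _).1; apply: C1_dirderiv. Qed.

(** Convexity of the ball keeps the segment inside; the factor n counts the partials, each paired
    with a coordinate bounded by the sup norm. *)
Lemma C1_lipschitz f a (r K : R) : Ck D 1 f ->
  (forall y, `|y - a| < r -> D y /\ forall i, `|partial i f y| <= K) ->
  forall x y, `|x - a| < r -> `|y - a| < r -> `|f y - f x| <= n%:R * K * `|y - x|.
Proof.
move=> Cf H x y xr yr.
have := @ler_norm_MVT_cst R (fun t : R => f (t *: (y - x) + x))
  (fun t => \sum_i (y - x) 0 i * partial i f (t *: (y - x) + x)) (n%:R * K * `|y - x|).
rewrite scale1r subrK scale0r add0r; apply=> s s01.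
  by apply: C1_seg => //; apply: (H _ _).1; apply: seg_ball.
apply: (le_trans (ler_norm_sum _ _ _)).
have -> : n%:R * K * `|y - x| = \sum_(i < n) (`|y - x| * K).
  by rewrite sumr_const card_ord -mulr_natl; ring.
apply: ler_sum => i _; rewrite normrM ler_pM ?rV_coord_le//.
by apply: (H _ _).2; apply: seg_ball.
Qed.

Lemma partial0_cst f a (r : R) : Ck D 1 f ->
  (forall y, `|y - a| < r -> D y /\ forall i, partial i f y = 0) ->
  forall x y, `|x - a| < r -> `|y - a| < r -> f y = f x.
Proof.
move=> Cf H x y xr yr; apply/eqP; rewrite -subr_eq0 -normr_le0.
rewrite -[leRHS](mul0r `|y - x|) -[X in X * _](mulr0 n%:R).
apply: C1_lipschitz Cf _ _ _ xr yr => z /H[Dz pz]; split=> // i.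
by rewrite pz normr0.
Qed.

(** The mean value theorem is used twice, for [f] and for its partial, which gives [K] in place of
    K/2. *)
Lemma taylor2 f i x (h K : R) : Ck D 2 f ->
  (forall s : R, `|s| <= `|h| ->
      D (s *: ev R i + x) /\ `|partial i (partial i f) (s *: ev R i + x)| <= K) ->
  `|f (h *: ev R i + x) - f x - h * partial i f x| <= K * `|h| ^+ 2.
Proof.
move=> Cf H.
have [s sh] := @MVT0 R (fun s => f (s *: ev R i + x)) (fun s => partial i f (s *: ev R i + x)) h
  (fun s sh => Ck_line (CkW Cf) (H s sh).1).
rewrite scale0r add0r => ->.
rewrite [X in X - _]mulrC -mulrBr normrM expr2 mulrCA ler_wpM2l//.
have H' (t : R) : `|t| <= `|s| -> `|t| <= `|h| by move=> ts; apply: le_trans sh.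
have [t ts] := @MVT0 R (fun s => partial i f (s *: ev R i + x))
  (fun s => partial i (partial i f) (s *: ev R i + x)) s
  (fun t ts => Ck_line (Ck_partial i Cf) (H t (H' t ts)).1).
rewrite scale0r add0r => ->; rewrite normrM ler_pM//.
by apply: (H _ _).2; exact: H'.
Qed.

Lemma lipschitz_line f i x (h K : R) : Ck D 1 f ->
  (forall s : R, `|s| <= `|h| ->
      D (s *: ev R i + x) /\ `|partial i f (s *: ev R i + x)| <= K) ->
  `|f (h *: ev R i + x) - f x| <= K * `|h|.
Proof.
move=> Cf H.
have [s sh] := MVT0 (fun s sh => Ck_line Cf (H s sh).1).
rewrite scale0r add0r => ->; rewrite normrM ler_wpM2r//.
exact: (H _ _).2.
Qed.

(** The second difference over the square spanned by h e_i and h e_j is h^2 times either mixed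
    partial, each at some point within 2|h| of [x]; continuity lets h tend to 0. *)
Lemma schwarz f i j x : Ck D 2 f -> D x ->
  partial i (partial j f) x = partial j (partial i f) x.
Proof.
move=> Cf Dx.
have [r r0 rD] := open_ball oD Dx.
have key a b (h : R) : 2 * `|h| < r -> exists2 p, `|p - x| <= 2 * `|h| &
   f (h *: ev R a + (h *: ev R b + x)) - f (h *: ev R a + x)
   - (f (h *: ev R b + x) - f x) = partial b (partial a f) p * h * h.
  move=> hr.
  have bb (s t : R) : `|s| <= `|h| -> `|t| <= `|h| ->
      `|t *: ev R b + (s *: ev R a + x) - x| <= 2 * `|h|.
    move=> sh th; rewrite addrA addrK; apply: (le_trans (ler_normD _ _)).
    rewrite mulr_natl mulr2n lerD//; apply: le_trans (norm_ev _ _) _ => //.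
  have DD s t : `|s| <= `|h| -> `|t| <= `|h| -> D (t *: ev R b + (s *: ev R a + x)).
    by move=> sh th; apply: rD; apply: le_lt_trans hr; exact: bb.
  have h0 : `|0 : R| <= `|h| by rewrite normr0.
  have Hs (s : R) : `|s| <= `|h| -> is_derive s 1
      (fun s : R => f (s *: ev R a + (h *: ev R b + x)) - f (s *: ev R a + x))
      (partial a f (s *: ev R a + (h *: ev R b + x)) - partial a f (s *: ev R a + x)).
    move=> sh; apply: is_deriveB; apply: Ck_line (CkW Cf) _.
      by rewrite addrCA; apply: DD.
    by have := DD s 0 sh h0; rewrite scale0r add0r.
  have [s sh] := MVT0 Hs.
  rewrite !scale0r !add0r => ->.
  have Ht (t : R) : `|t| <= `|h| -> is_derive t 1
      (fun t : R => partial a f (t *: ev R b + (s *: ev R a + x)))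
      (partial b (partial a f) (t *: ev R b + (s *: ev R a + x))).
    move=> th; apply: Ck_line (Ck_partial a Cf) _; exact: DD.
  have [t th] := MVT0 Ht.
  rewrite scale0r add0r [h *: ev R b + (_ + _)]addrCA => ->.
  by exists (t *: ev R b + (s *: ev R a + x)) => //; exact: bb.
apply/eqP; rewrite -subr_eq0 -normr_le0; apply/ler_addgt0Pr => e e0; rewrite add0r.
have e20 : 0 < e / 2 by rewrite divr_gt0.
have [r1 r10 H1] := cont_ball e20 (Ck_cont (Ck_partial i (Ck_partial j Cf)) Dx).
have [r2 r20 H2] := cont_ball e20 (Ck_cont (Ck_partial j (Ck_partial i Cf)) Dx).
(* Division by 4 makes 2|h| strictly smaller than all three radii. *)
pose h : R := Num.min r (Num.min r1 r2) / 4.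
have m0 : 0 < Num.min r (Num.min r1 r2) by rewrite !lt_min r0 r10 r20.
have h0 : 0 < h by rewrite divr_gt0.
have : 2 * `|h| < Num.min r (Num.min r1 r2).
  by rewrite ger0_norm ?ltW// /h; lra.
rewrite !lt_min => /and3P[hr hr1 hr2].
have [p px E1] := key i j h hr.
have [q qx E2] := key j i h hr.
have := second_difference_eq (lt0r_neq0 h0) E1.
rewrite (addrCA (h *: ev R i)) => /(_ _ E2).
have := H2 p (le_lt_trans px hr2); have := H1 q (le_lt_trans qx hr1).
move=> A B E; rewrite E in B.
exact: ler_dist_half A B.
Qed.

Lemma cont_bounded f x : {for x, continuous f} -> D x ->
  exists r : R, [/\ 0 < r, (forall y, `|y - x| < r -> D y) &
    exists2 K : R, 0 <= K & forall y, `|y - x| < r -> `|f y| <= K].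
Proof.
move=> cf Dx; have [r r0 rD] := open_ball oD Dx.
have [r1 r10 H1] := cont_ball ltr01 cf.
exists (Num.min r r1); split.
- by rewrite lt_min r0 r10.
- by move=> y yr; apply: rD; apply: (lt_le_trans yr); rewrite ge_min lexx.
exists (`|f x| + 1); first by rewrite addr_ge0.
move=> y yr; have {yr}yr : `|y - x| < r1.
  by apply: (lt_le_trans yr); rewrite ge_min lexx orbT.
have := H1 y yr; move: (f y) (f x) => a b ab.
by rewrite -[a](subrK b) addrC (le_trans (ler_normD _ _))// lerD2l.
Qed.

End C1.

(** * The Poincare lemma on a small ball *)

(** Continuity on the larger interval [-1, 2] makes 0 and 1 interior points, so the derivative is
    two-sided on all of [0, 1]. *)
Lemma antiderivative {R : realType} (g : R -> R) :
  (forall t : R, -1 <= t <= 2 -> {for t, continuous g}) ->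
  exists A : R -> R, A 0 = 0 /\
    forall t : R, 0 <= t <= 1 -> is_derive t (1 : R) A (g t).
Proof.
move=> cg.
have cgw : {within `[-1, 2], continuous g}.
  apply: continuous_in_subspaceT => t; rewrite inE/= in_itv/= => ht.
  exact: cg.
have ig : (@lebesgue_measure R).-integrable `[-1, 2]%classic (EFin \o g).
  apply: continuous_compact_integrable cgw; exact: segment_compact.
pose F (x : R) := (\int[@lebesgue_measure R]_(t in [set` `[-1, x]]) (g t))%R.
have HF (t : R) : 0 <= t <= 1 -> is_derive t (1 : R) F (g t).
  move=> /andP[t0 t1].
  have t2 : t < 2 by lra.
  have tm1 : -1 < t by lra.
  have ct : {for t, continuous g} by apply: cg; apply/andP; split; lra.
  have [dF eF] := continuous_FTC1_closed t2 ig tm1 ct.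
  by split => //; rewrite -derive1E.
exists (fun t => F t - F 0); split; first by rewrite subrr.
move=> t t01; have H := HF t t01.
by have := is_deriveB H (@is_derive_cst _ _ _ (F 0) t 1); rewrite subr0.
Qed.

(** Here v = x - a, while [p] and [q] are the coefficients at the displaced and at the original
    point of a ray and [d] the partials of the i-th one. The right side consists of second-order
    Taylor remainders plus h times a first-order increment, so it is O(h^2). *)
Lemma radial_identity {R : comRingType} n (v p q d : 'I_n -> R) (h t : R) (i : 'I_n) :
  \sum_j (v j + h *+ (j == i)) * p j - \sum_j v j * q j
    - (h * t * (\sum_j v j * d j) + q i * h) =
  \sum_j v j * (p j - q j - t * h * d j) + h * (p i - q i).
Proof.
under eq_bigr do rewrite mulrDl.
rewrite big_split/=.
have -> : \sum_j h *+ (j == i) * p j = h * p i.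
  rewrite (bigD1 i)//= eqxx mulr1n big1 ?addr0// => j /negbTE ->.
  by rewrite mulr0n mul0r.
have -> : \sum_j v j * (p j - q j - t * h * d j) =
    \sum_j v j * p j - \sum_j v j * q j - t * h * \sum_j v j * d j.
  rewrite mulr_sumr -!sumrB; apply: eq_bigr => j _; ring.
ring.
Qed.

Section Poincare.
Context {R : realType} {n : nat} (D : set 'rV[R]_n) (oD : open D).

Lemma family_bounded (I : eqType) (s : seq I) (g : I -> 'rV[R]_n -> R^o) (a : 'rV[R]_n) :
  D a -> (forall k, {for a, continuous (g k)}) ->
  exists r : R, [/\ 0 < r, (forall y, `|y - a| < r -> D y) &
    exists2 K : R, 0 <= K & forall k y, k \in s -> `|y - a| < r -> `|g k y| <= K].
Proof.
move=> Da cg; elim: s => [|k s [r [r0 rD [K K0 HK]]]].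
  have [r r0 rD] := open_ball oD Da.
  by exists r; split => //; exists 0.
have [r' [r'0 _ [K' K'0 HK']]] := cont_bounded oD (cg k) Da.
exists (Num.min r r'); split.
- by rewrite lt_min r0 r'0.
- by move=> y yr; apply: rD; apply: (lt_le_trans yr); rewrite ge_min lexx.
exists (Num.max K K'); first by rewrite le_max K0.
move=> l y; rewrite inE => /orP[/eqP ->|ls] yr; rewrite le_max.
  apply/orP; right; apply: HK'; apply: (lt_le_trans yr); by rewrite ge_min lexx orbT.
apply/orP; left; apply: HK => //; apply: (lt_le_trans yr); by rewrite ge_min lexx.
Qed.

(** Continuous partials are locally bounded, so [f] is locally Lipschitz. *)
Lemma cont_of_partials (f : 'rV[R]_n -> R^o) (df : 'I_n -> 'rV[R]_n -> R^o) x :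
  (forall i y, D y -> is_derive y (ev R i) f (df i y)) ->
  (forall i y, D y -> {for y, continuous (df i)}) -> D x -> {for x, continuous f}.
Proof.
move=> Hf cdf Dx.
have [r [r0 rD [K K0 HK]]] := family_bounded (enum 'I_n) Dx (fun i => cdf i x Dx).
have L y : `|y - x| < r -> `|f y - f x| <= n%:R * K * `|y - x|.
  move=> yr.
  have xr : `|x - x| < r by rewrite subrr normr0.
  have Hd (t : R) : 0 <= t <= 1 -> is_derive t (1 : R) (fun t : R => f (t *: (y - x) + x))
      (\sum_i (y - x) 0 i * df i (t *: (y - x) + x)).
    move=> t01; apply: (is_derive_line_at f x (y - x) t _).1.
    have Dt := rD _ (seg_ball xr yr t01).
    exact: dirderiv Hf (fun i => cdf i _ Dt) Dt.
  have := ler_norm_MVT_cst (K := n%:R * K * `|y - x|) Hd.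
  rewrite scale1r subrK scale0r add0r; apply=> t t01.
  apply: (le_trans (ler_norm_sum _ _ _)).
  have -> : n%:R * K * `|y - x| = \sum_(i < n) (`|y - x| * K).
    by rewrite sumr_const card_ord -[RHS]mulr_natl -mulrA [K * _]mulrC.
  apply: ler_sum => i _; rewrite normrM ler_pM ?rV_coord_le//.
  by apply: HK; [rewrite mem_enum|exact: seg_ball].
by apply: lipschitz_cont r0 _ L; rewrite mulr_ge0.
Qed.

Lemma sm_of_partials (f : 'rV[R]_n -> R^o) (df : 'I_n -> 'rV[R]_n -> R^o) :
  (forall i y, D y -> is_derive y (ev R i) f (df i y)) ->
  (forall i, sm D (df i)) -> sm D f.
Proof.
move=> Hf sdf; apply: (smI oD _ Hf sdf) => x Dx.
by apply: cont_of_partials Hf _ Dx => i y Dy; exact: sm_cont (sdf i) Dy.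
Qed.

(** The primitive is the radial integral of sum_j (x - a)_j al_j(a + t (x - a)) over t in [0, 1].
    Differentiation under the integral sign is replaced by an O(h^2) bound on the t-derivative of
    the error, followed by [is_derive_quad]. *)
Lemma local_poincare (al : 'I_n -> 'rV[R]_n -> R^o) (a : 'rV[R]_n) : D a ->
  (forall i, Ck D 2 (al i)) ->
  (forall x i j, D x -> partial i (al j) x = partial j (al i) x) ->
  exists r : R, [/\ 0 < r, (forall y, `|y - a| < r -> D y) &
    exists f : 'rV[R]_n -> R^o,
      forall x i, `|x - a| < r -> is_derive x (ev R i) f (al i x)].
Proof.
move=> Da Cal clo.
pose g (k : ('I_n * 'I_n) + ('I_n * 'I_n)) : 'rV[R]_n -> R^o :=
  match k with inl p => partial p.1 (al p.2) | inr p => partial p.1 (partial p.1 (al p.2)) end.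
have [|r [r0 rD [K K0 HK]]] := @family_bounded _ (enum {: ('I_n * 'I_n) + ('I_n * 'I_n)}) g a Da.
  case=> -[i j] /=; first exact: Ck_cont (Ck_partial i (Cal j)) Da.
  exact: Ck_cont (Ck_partial i (Ck_partial i (Cal j))) Da.
have K1 i j y : `|y - a| < r -> `|partial i (al j) y| <= K.
  by apply: (HK (inl (i, j))); rewrite mem_enum.
have K2 i j y : `|y - a| < r -> `|partial i (partial i (al j)) y| <= K.
  by apply: (HK (inr (i, j))); rewrite mem_enum.
clear HK g.
pose w (x : 'rV[R]_n) (t : R) := \sum_j (x - a) 0 j * al j (t *: (x - a) + a).
(* On [-1, 2] the parameter at most doubles the distance to [a]; hence the radius r / 2. *)
have rayD x (t : R) : `|x - a| < r / 2 -> -1 <= t <= 2 -> `|t *: (x - a) + a - a| < r.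
  move=> xr /andP[t1 t2]; rewrite addrK normrZ.
  have t3 : `|t| <= 2 by rewrite ler_norml; apply/andP; split; lra.
  have := normr_ge0 (x - a); move: xr; move: (`|x - a|) => u ur u0.
  have : `|t| * u <= 2 * u by rewrite ler_wpM2r.
  lra.
(* Outside the half ball any function will do, which makes the choice of [A] total in [x]. *)
have exA x : exists A : R -> R, `|x - a| < r / 2 -> A 0 = 0 /\
    forall t : R, 0 <= t <= 1 -> is_derive t (1 : R) A (w x t).
  have [xr|xr] := ltP `|x - a| (r / 2); last by exists (fun=> 0).
  have [|A HA] := @antiderivative R (w x).
    move=> t t12.
    have -> : w x = \sum_j (fun t : R => (x - a) 0 j * al j (t *: (x - a) + a)).
      by apply/funext => u; rewrite fct_sumE.
    apply: differentiable_continuous; apply/derivable1_diffP; apply: derivable_sum => j.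
    have [dj _] : is_derive t (1 : R) (fun t : R => al j (t *: (x - a) + a))
       (\sum_i (x - a) 0 i * partial i (al j) (t *: (x - a) + a)).
      apply: (is_derive_line_at (al j) a (x - a) t _).1.
      by apply: C1_dirderiv (CkW (Cal j)) _ => //; apply: rD; apply: rayD.
    exact: (derivableM (derivable_cst ((x - a) 0 j : R^o) t (1 : R^o)) dj).
  by exists A.
have [A HA] := choice exA.
exists (r / 2); split.
- by rewrite divr_gt0.
- by move=> y yr; apply: rD; apply: (lt_trans yr); rewrite ltr_pdivrMr// ltr_pMr// ltr1n.
exists (fun x => A x 1) => x i xr.
(* First summand: n Taylor remainders with weights at most r. Second: the Lipschitz bound for
   [al i]. *)
pose C := (n%:R * r * K + K).
have rx : 0 < r / 2 - `|x - a| by rewrite subr_gt0.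
apply: (is_derive_quad (e := r / 2 - `|x - a|) (C := C)) => //.
  by rewrite addr_ge0// !mulr_ge0// ltW.
move=> h hr.
have xr' : `|h *: ev R i + x - a| < r / 2.
  rewrite -addrA; apply: (le_lt_trans (ler_normD _ _)).
  apply: (@le_lt_trans _ _ (`|h| + `|x - a|)); first by rewrite lerD2r norm_ev.
  by rewrite -ltrBrDr.
have [A0 dA] := HA x xr; have [A0' dA'] := HA _ xr'.
have t12 (t : R) : 0 <= t <= 1 -> -1 <= t <= 2.
  by move=> /andP[t0 t1]; apply/andP; split; lra.
have dal (t : R) : 0 <= t <= 1 -> is_derive t (1 : R) (fun t : R => al i (t *: (x - a) + a))
   (\sum_j (x - a) 0 j * partial j (al i) (t *: (x - a) + a)).
  move=> t01; apply: (is_derive_line_at (al i) a (x - a) t _).1.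
  by apply: C1_dirderiv (CkW (Cal i)) _ => //; apply: rD; apply: rayD => //; exact: t12.
(* Error of the first-order expansion with the integral stopped at time t; its value at t = 1 is the
   wanted one. *)
pose k t := A (h *: ev R i + x) t - A x t - h * t * al i (t *: (x - a) + a).
have dk (t : R) : 0 <= t <= 1 -> is_derive t (1 : R) k
    (w (h *: ev R i + x) t - w x t -
     (h * t * (\sum_j (x - a) 0 j * partial j (al i) (t *: (x - a) + a)) + al i (t *: (x - a) + a) * h)).
  move=> t01; apply: is_deriveB.
    by apply: is_deriveB; [exact: dA'|exact: dA].
  have dh : is_derive t (1 : R) (fun t : R => h * t) h.
    have := @is_deriveZ R R^o R^o id h t 1 1 (is_derive_id _ _).
    by rewrite [h *: (1 : R^o)]mulr1.
  exact: is_deriveM dh (dal t t01).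
have := ler_norm_MVT_cst (K := C * `|h| ^+ 2) dk.
rewrite /k A0 A0' !scale1r !subrK mulr0 mul0r !subr0 mulr1; apply.
move=> t t01.
have -> : w (h *: ev R i + x) t = \sum_j ((x - a) 0 j + h *+ (j == i)) *
    al j ((t * h) *: ev R i + (t *: (x - a) + a)).
  apply: eq_bigr => j _; congr (_ * al j _).
    by rewrite !mxE/=; case: (j == i); rewrite ?mulr1n ?mulr0n ?mulr1 ?mulr0; ring.
  by apply/rowP => l; rewrite !mxE; ring.
rewrite (@radial_identity R n (fun j => (x - a) 0 j) (fun j => al j ((t * h) *: ev R i + (t *: (x - a) + a)))
   (fun j => al j (t *: (x - a) + a)) (fun j => partial j (al i) (t *: (x - a) + a))).
set y := t *: (x - a) + a.
have yr : `|y - a| < r by apply: rayD => //; exact: t12.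
have thh : `|t * h| <= `|h|.
  by case/andP: t01 => t0 t1; rewrite normrM ger0_norm// ler_piMl.
have yth (s : R) : `|s| <= `|t * h| -> `|s *: ev R i + y - a| < r.
  move=> sth.
  have -> : s *: ev R i + y - a = t *: (x - a) + s *: ev R i.
    by rewrite /y addrA addrK addrC.
  have yh : `|t *: (x - a)| <= `|x - a|.
    by case/andP: t01 => t0 t1; rewrite normrZ ger0_norm// ler_piMl.
  apply: (le_lt_trans (ler_normD _ _)); apply: (@le_lt_trans _ _ (`|x - a| + `|h|)).
    apply: lerD => //; apply: (le_trans (norm_ev _ _)); exact: (le_trans sth).
  rewrite addrC -ltrBrDr; apply: (lt_le_trans hr); rewrite lerD2r.
  by rewrite ler_pdivrMr// ler_pMr// ler1n.
rewrite /C [X in _ <= X]mulrDl; apply: (le_trans (ler_normD _ _)); apply: lerD; last first.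
  rewrite normrM mulrC expr2 mulrA ler_wpM2r//.
  apply: (@le_trans _ _ (K * `|t * h|)); last by rewrite ler_wpM2l.
  apply: (lipschitz_line (CkW (Cal i))) => s /yth sr; split; [exact: rD|exact: K1].
apply: (le_trans (ler_norm_sum _ _ _)).
have -> : n%:R * r * K * `|h| ^+ 2 = \sum_(j < n) (r * (K * `|h| ^+ 2)).
  by rewrite sumr_const card_ord -[RHS]mulr_natl !mulrA.
apply: ler_sum => j _; rewrite normrM; apply: ler_pM => //.
  apply: (le_trans (rV_coord_le _ _)); apply: (le_trans (ltW xr)).
  by rewrite ler_pdivrMr// ler_pMr// ler1n.
(* Closedness enters here: d_j al_i becomes d_i al_j, which completes the Taylor remainder of [al j]
   in direction i. *)
rewrite (clo y j i); last exact: rD.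
apply: (@le_trans _ _ (K * `|t * h| ^+ 2)); last by rewrite ler_wpM2l// ler_pXn2r// nnegrE.
by apply: (taylor2 (Cal j)) => s /yth sr; split; [exact: rD|exact: K2].
Qed.

End Poincare.

(** * Lebesgue numbers and polygonal paths *)

Section Lebesgue.
Context {R : realType} {n : nat}.

(** The cover is a predicate on centre and radius. The ball chosen for a point still serves all
    nearby points at all fine scales, which is the local form that compactness turns into a uniform
    scale 1/(N+1). *)
Lemma lebesgue_number (V : normedModType R) (K : set V) (h : V -> 'rV[R]_n)
    (Cov : 'rV[R]_n -> R -> Prop) :
  compact K -> {within K, continuous h} ->
  (forall x, K x -> exists2 r : R, 0 < r & Cov (h x) r) ->
  \forall N \near \oo, forall x, K x -> exists a r,
    [/\ 0 < r, Cov a r & forall y, K y -> `|y - x| <= N.+1%:R^-1 -> `|h y - a| < r].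
Proof.
move=> /compact_near_coveringP cK ch HC.
have := cK nat \oo (fun N x => exists a r,
    [/\ 0 < r, Cov a r & forall y, K y -> `|y - x| <= N.+1%:R^-1 -> `|h y - a| < r]) _.
apply=> x Kx; have [r r0 Cr] := HC x Kx.
have /subspace_continuousP/(_ x Kx)/cvgrPdist_lt/(_ r r0) := ch.
rewrite near_withinE => /nbhs_normP[d /= d0 Hd].
(* One half of [d] for moving the point to x', the other for the scale 1/(N+1). *)
have d20 : 0 < d / 2 by rewrite divr_gt0.
near=> x' N; exists (h x), r; split => // y Ky yx.
rewrite distrC; apply: Hd => //=; rewrite /ball_/= distrC.
rewrite -(subrKA x') [d]splitr; apply: (le_lt_trans (ler_normD _ _)).
apply: ltrD; last first.
  rewrite distrC; near: x'; apply/nbhs_normP; exists (d / 2) => //.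
apply: (le_lt_trans yx) => /=; near: N.
exact: near_infty_natSinv_lt (PosNum d20).
Unshelve. all: by end_near. Qed.

Lemma unitI_compact : compact (@unitI R).
Proof.
have -> : @unitI R = `[0, 1]%classic by rewrite set_itvcc.
exact: segment_compact.
Qed.

End Lebesgue.

Section PiecewiseLinear.
Context {R : realType} {n : nat} (p : nat -> 'rV[R]_n).

(** Retraction onto [0, 1]; the closed form with absolute values makes continuity immediate. *)
Definition clamp (s : R) : R := (`|s| - `|s - 1| + 1) / 2.

Lemma clamp0 s : s <= 0 -> clamp s = 0.
Proof. by move=> s0; rewrite /clamp !ler0_norm//; lra. Qed.

Lemma clamp1 s : 1 <= s -> clamp s = 1.
Proof. by move=> s0; rewrite /clamp !ger0_norm//; lra. Qed.

Lemma clamp01 s : 0 <= s <= 1 -> clamp s = s.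
Proof.
by move=> /andP[s0 s1]; rewrite /clamp ger0_norm// ler0_norm//; lra.
Qed.

Lemma clamp_continuous : continuous clamp.
Proof.
move=> s; apply: cvgM; last exact: cvg_cst.
apply: cvgD; last exact: cvg_cst.
apply: cvgB; first by apply: cvg_norm; exact: cvg_id.
by apply: cvg_norm; apply: cvgB; [exact: cvg_id|exact: cvg_cst].
Qed.

(** Polygon that visits [p j] at time j. As a sum of clamped increments it is continuous with no
    gluing of segments. *)
Fixpoint pl (m : nat) (u : R) : 'rV[R]_n :=
  match m with
  | 0 => p 0
  | m'.+1 => pl m' u + clamp (u - m'%:R) *: (p m'.+1 - p m')
  end.

Lemma pl_continuous m : continuous (pl m).
Proof.
elim: m => [|m IH] u; first exact: cvg_cst.
apply: cvgD; first exact: IH.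
apply: cvgZr_tmp.
apply: (@cvg_comp _ _ _ (fun u : R => u - m%:R) clamp).
  by apply: cvgB; [exact: cvg_id|exact: cvg_cst].
exact: clamp_continuous.
Qed.

Lemma pl_last m u : m%:R <= u -> pl m u = p m.
Proof.
elim: m => [//|m IH] mu /=.
have mu' : m%:R + 1 <= u by rewrite natr1.
rewrite IH; last lra.
by rewrite clamp1 ?scale1r ?subrKC//; lra.
Qed.

Lemma plE m j u : (j < m)%N -> j%:R <= u <= j.+1%:R ->
  pl m u = (u - j%:R) *: (p j.+1 - p j) + p j.
Proof.
elim: m => [//|m IH]; rewrite ltnS leq_eqVlt => /orP[/eqP -> |jm] /= ju.
  case/andP: ju; rewrite -natr1 => u1 u2.
  by rewrite pl_last// clamp01; [rewrite addrC|apply/andP; split; lra].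
rewrite IH// clamp0 ?scale0r ?addr0//.
case/andP: ju => _; have : j.+1%:R <= m%:R :> R by rewrite ler_nat.
lra.
Qed.

Lemma nat_interval m (u : R) : (0 < m)%N -> 0 <= u <= m%:R ->
  exists2 j, (j < m)%N & j%:R <= u <= j.+1%:R.
Proof.
elim: m => [//|[|m] IH] _ /andP[u0 um]; first by exists 0%N => //; rewrite u0.
have [ul|ul] := leP u m.+1%:R; last by exists m.+1 => //; rewrite ltW.
by have [//||j jm ju] := IH; [rewrite u0|exists j => //; exact: ltnW].
Qed.

End PiecewiseLinear.

(** * Monodromy: integrating a local cocycle over a simply connected set *)

Section Potential.
Context {R : realType} {n : nat} (D : set 'rV[R]_n) .
Context (P : 'rV[R]_n -> 'rV[R]_n -> R).

Context (Cov : 'rV[R]_n -> R -> Prop).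

Hypothesis CovD : forall a r, Cov a r -> forall y, `|y - a| < r -> D y.
Hypothesis Cov_ex : forall a, D a -> exists2 r : R, 0 < r & Cov a r.
Hypothesis cocycle : forall a r x y z, Cov a r ->
  `|x - a| < r -> `|y - a| < r -> `|z - a| < r -> P x y + P y z = P x z.

Definition close x y := exists a r, [/\ Cov a r, `|x - a| < r & `|y - a| < r].

(** [ch x y c] records a finite chain of close points from [x] to [y] whose increments [P] add up to
    [c]. A potential exists as soon as [c] depends only on the end points. *)
Inductive ch : 'rV[R]_n -> 'rV[R]_n -> R -> Prop :=
| ch0 x : ch x x 0
| chS x y z c : ch x y c -> close y z -> ch x z (c + P y z).

Lemma P_refl x : D x -> P x x = 0.
Proof.
move=> Dx; have [r r0 rD] := Cov_ex Dx.
have xr : `|x - x| < r by rewrite subrr normr0.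
by have /eqP := cocycle rD xr xr xr; rewrite -subr_eq0 addrK => /eqP.
Qed.

Lemma close_in x y : close x y -> D x.
Proof. by case=> a [r [arD xr _]]; exact: (CovD arD xr). Qed.

Lemma close_sym x y : close x y -> close y x.
Proof. by case=> a [r [? ? ?]]; exists a, r. Qed.

Lemma P_anti x y : close x y -> P y x = - P x y.
Proof.
move=> cxy; have Dx := close_in cxy; case: cxy => a [r [arD xr yr]].
by apply/eqP; rewrite -addr_eq0 addrC (cocycle arD xr yr xr) P_refl.
Qed.

Lemma ch_trans x y z c d : ch x y c -> ch y z d -> ch x z (c + d).
Proof.
move=> cxy cyz; elim: cyz c cxy => [w c|w u v e _ IH cuv c cxw].
  by rewrite addr0.
by rewrite addrA; apply: chS cuv; apply: IH.
Qed.

Lemma ch_rev x y c : ch x y c -> ch y x (- c).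
Proof.
elim=> [w|w u v e _ IH cuv]; first by rewrite oppr0; exact: ch0.
rewrite opprD addrC; apply: ch_trans IH.
by rewrite -(P_anti cuv) -[P v u]add0r; apply: chS (close_sym cuv); exact: ch0.
Qed.

Lemma ch_nat x y c : ch x y c -> exists (p : nat -> 'rV[R]_n) (m : nat),
  [/\ p 0%N = x, p m = y, forall j, (j < m)%N -> close (p j) (p j.+1) &
      c = \sum_(j < m) P (p j) (p j.+1)].
Proof.
elim=> [w|w u v e _ [p [m [p0 pm cl ->]]] cuv].
  by exists (fun=> w), 0%N; split => //; rewrite big_ord0.
exists (fun j => if (j <= m)%N then p j else v), m.+1; split => //.
- by rewrite ltnn.
- move=> j; rewrite ltnS => jm; rewrite jm.
  by case: ltngtP jm => // [jm _|-> _]; [exact: cl|rewrite pm].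
- rewrite big_ord_recr/= leqnn ltnn pm; congr (_ + _).
  by apply: eq_bigr => j _; rewrite ltnW ltn_ord.
Qed.

(** Each edge lies in one covering ball, and balls are convex, so the cocycle identity absorbs the
    division of the edge into [q] pieces. Stopping [i] pieces into edge [l] makes a double induction
    possible. *)
Lemma sum_refined (p : nat -> 'rV[R]_n) m q : (0 < q)%N ->
  (forall j, (j < m)%N -> close (p j) (p j.+1)) ->
  forall l i, (l < m)%N -> (i <= q)%N ->
  \sum_(j < l * q + i) P (pl p m (j%:R / q%:R)) (pl p m (j.+1%:R / q%:R)) =
  \sum_(j < l) P (p j) (p j.+1) + P (p l) (pl p m (l%:R + i%:R / q%:R)).
Proof.
move=> q0 cl.
have qR : (q%:R : R) != 0 by rewrite pnatr_eq0 -lt0n.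
have inseg l i : (i <= q)%N -> l%:R <= l%:R + i%:R / q%:R :> R /\ l%:R + i%:R / q%:R <= l.+1%:R :> R.
  move=> iq; rewrite lerDl divr_ge0// -natr1 lerD2l; split=> //.
  by rewrite ler_pdivrMr ?ltr0n// mul1r ler_nat.
have stepP l i a r : (l < m)%N -> (i <= q)%N -> `|p l - a| < r -> `|p l.+1 - a| < r ->
    `|pl p m (l%:R + i%:R / q%:R) - a| < r.
  move=> lm iq lr lr'; have [s1 s2] := inseg l i iq.
  rewrite (plE _ lm) ?s1//.
  by apply: seg_ball => //; rewrite addrAC subrr add0r divr_ge0//= ler_pdivrMr ?ltr0n// mul1r ler_nat.
have plp l : (l <= m)%N -> pl p m l%:R = p l.
  rewrite leq_eqVlt => /orP[/eqP ->|lm]; first by rewrite pl_last.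
  by rewrite (plE _ lm) ?subrr ?scale0r ?add0r// lexx ler_nat leqnSn.
elim=> [|l IHl].
  elim=> [|i IHi] m0 iq.
    rewrite !big_ord0 add0r mul0r addr0 plp// P_refl//; exact: close_in (cl _ m0).
  rewrite addnS big_ord_recr/= (IHi m0 (ltnW iq)) mul0n !add0n !big_ord0 !add0r.
  have [a [r [arD r1 r2]]] := cl _ m0.
  have := stepP _ i _ _ m0 (ltnW iq) r1 r2; have := stepP _ i.+1 _ _ m0 iq r1 r2.
  rewrite !add0r => b2 b1; exact: cocycle arD r1 b1 b2.
elim=> [|i IHi] lm iq.
  rewrite addn0 mulSn addnC (IHl q (ltnW lm) (leqnn q)) divff// natr1 mul0r addr0.
  rewrite (plp l.+1 (ltnW lm)).
  by rewrite (P_refl (close_in (cl _ lm))) addr0 big_ord_recr.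
rewrite addnS big_ord_recr/= (IHi lm (ltnW iq)) -addrA; congr (_ + _).
have e k : (l.+1 * q + k)%:R / q%:R = l.+1%:R + k%:R / q%:R :> R.
  by rewrite natrD natrM mulrDl mulfK.
rewrite -addnS !e.
have [a [r [arD r1 r2]]] := cl _ lm.
exact: cocycle arD r1 (stepP _ i _ _ lm (ltnW iq) r1 r2) (stepP _ i.+1 _ _ lm iq r1 r2).
Qed.

(** A discrete Stokes argument: on a grid so fine that each cell maps into one covering ball,
    neighbouring rows have equal sums, and the last row is constant. The conclusion for all large
    [N] leaves room to adapt the grid to a polygon. *)
Lemma homotopy_sum (H : R * R -> 'rV[R]_n) (g : R -> 'rV[R]_n) :
  {within @unitI R `*` @unitI R, continuous H} ->
  H @` (@unitI R `*` @unitI R) `<=` D ->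
  (forall t, unitI t -> H (0, t) = g t /\ H (1, t) = g 0) ->
  (forall s, unitI s -> H (s, 0) = g 0 /\ H (s, 1) = g 0) ->
  exists N0, forall N, (N0 <= N)%N ->
    \sum_(j < N.+1) P (g (j%:R / N.+1%:R)) (g (j.+1%:R / N.+1%:R)) = 0.
Proof.
move=> cH HD H1 H2.
have cK : compact (@unitI R `*` @unitI R) by apply: compact_setX; exact: unitI_compact.
have [|N0 _ HN] := @lebesgue_number R n _ _ H Cov cK cH.
  move=> x Kx; have Dx : D (H x) by apply: HD; exists x.
  by exact: Cov_ex.
exists N0 => N /HN {}HN.
have N0R : (0 : R) < N.+1%:R by rewrite ltr0n.
pose h i j := H (i%:R / N.+1%:R, j%:R / N.+1%:R).
have uN k : (k <= N.+1)%N -> unitI (k%:R / N.+1%:R : R).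
  by move=> kN; rewrite /unitI/= divr_ge0//= ler_pdivrMr// mul1r ler_nat.
have u0 : unitI (0 : R) by rewrite /unitI/= lexx ler01.
have u1 : unitI (1 : R) by rewrite /unitI/= lexx ler01.
have g0D : D (g 0) by have [<- _] := H2 0 u0; apply: HD; exists (0, 0).
(* Both ways around a cell give the increment along its diagonal. *)
have cell i j : (i < N.+1)%N -> (j < N.+1)%N ->
    P (h i j) (h i j.+1) + P (h i j.+1) (h i.+1 j.+1) =
    P (h i j) (h i.+1 j) + P (h i.+1 j) (h i.+1 j.+1).
  move=> iN jN.
  have [a [r [r0 arD Ha]]] := HN (i%:R / N.+1%:R, j%:R / N.+1%:R)
     (conj (uN i (ltnW iN)) (uN j (ltnW jN))).
  have near b c : (b <= 1)%N -> (c <= 1)%N -> `|h (b + i)%N (c + j)%N - a| < r.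
    move=> b1 c1; apply: Ha.
      by split; apply: uN; [apply: (leq_trans (leq_add b1 (leqnn i)))|apply: (leq_trans (leq_add c1 (leqnn j)))].
    rewrite prod_normE/= -!mulrBl !natrD !addrK ge_max !normrM !ger0_norm//.
    by rewrite !ler_piMl// ?lern1.
  have b00 := near 0%N 0%N isT isT; have b01 := near 0%N 1%N isT isT.
  have b10 := near 1%N 0%N isT isT; have b11 := near 1%N 1%N isT isT.
  rewrite !add0n !add1n in b00 b01 b10 b11.
  by rewrite (cocycle arD b00 b01 b11) (cocycle arD b00 b10 b11).
pose S i := \sum_(j < N.+1) P (h i j) (h i j.+1).
have rowS i : (i < N.+1)%N -> S i = S i.+1.
  move=> iN.
  have E : S i + \sum_(j < N.+1) P (h i j.+1) (h i.+1 j.+1) =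
      \sum_(j < N.+1) P (h i j) (h i.+1 j) + S i.+1.
    by rewrite /S -!big_split; apply: eq_bigr => j _; exact: cell.
  (* After cancelling interior vertical edges only those over t = 0 and t = 1 remain, where the
     homotopy stays at [g 0]. *)
  have edge c : (c = 0 \/ c = N.+1)%N -> P (h i c) (h i.+1 c) = 0.
    case=> ->; rewrite /h ?mul0r ?divff ?gt_eqF//.
      by rewrite (H2 _ (uN i (ltnW iN))).1 (H2 _ (uN i.+1 iN)).1 P_refl.
    by rewrite (H2 _ (uN i (ltnW iN))).2 (H2 _ (uN i.+1 iN)).2 P_refl.
  move: E; rewrite [X in _ + X]big_ord_recr/= [X in X + S _]big_ord_recl/=.
  rewrite (edge 0%N) ?(edge N.+1); [|by right|by left].
  by rewrite addr0 add0r addrC => /addrI.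
have S0N : S 0%N = S N.+1.
  have : forall i, (i <= N.+1)%N -> S 0%N = S i.
    by elim=> // i IH iN; rewrite (IH (ltnW iN)) rowS.
  by apply.
transitivity (S 0%N).
  apply: eq_bigr => j _; rewrite /h mul0r.
  by rewrite (H1 _ (uN j (ltnW (ltn_ord j)))).1 (H1 _ (uN j.+1 (ltn_ord j))).1.
rewrite S0N; apply: big1 => j _; rewrite /h divff ?gt_eqF//.
by rewrite (H1 _ (uN j (ltnW (ltn_ord j)))).2 (H1 _ (uN j.+1 (ltn_ord j))).2 P_refl.
Qed.

Hypothesis scD : simply_connected D.

(** The chain is turned into a closed polygon, contracted in [D], and its sum is compared with the
    sum over a fine subdivision. *)
Lemma ch_loop x c : ch x x c -> c = 0.
Proof.
case/ch_nat=> p [m [p0 pm cl ->]].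
have [->|m0] := posnP m; first by rewrite big_ord0.
pose g (t : R) := pl p m (m%:R * t).
have cg : {within @unitI R, continuous g}.
  apply: continuous_subspaceT => t.
  apply: (@continuous_comp _ _ _ (fun t : R => m%:R * t) (pl p m)).
    exact: mulrl_continuous.
  exact: pl_continuous.
have gD : g @` @unitI R `<=` D.
  move=> _ [t /andP[t0 t1] <-].
  have [|j jm ju] := nat_interval m0 (u := m%:R * t).
    by rewrite mulr_ge0//= ler_piMr.
  rewrite /g (plE _ jm)//; have [a [r [arD r1 r2]]] := cl j jm.
  apply: (CovD arD); apply: seg_ball => //; case/andP: ju; rewrite -natr1 => *.
  by apply/andP; split; lra.
have g0 : g 0 = x by rewrite /g mulr0 (plE _ m0) ?subrr ?scale0r ?add0r// lexx ler0n.
have g1 : g 1 = x by rewrite /g mulr1 pl_last.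
have [H [cH [HD [H1 H2]]]] := scD.2.2 g cg gD (etrans g0 (esym g1)).
have [N0 HN] := homotopy_sum cH HD H1 H2.
(* A grid of m (N0 + 1) intervals is fine enough for the homotopy and also contains all vertices of
   the polygon. *)
have := HN (m * N0.+1).-1.
have E : (m * N0.+1).-1.+1 = (m * N0.+1)%N by rewrite prednK// muln_gt0 m0.
rewrite E -ltnS E => /(_ (leq_pmull _ m0)) S0; rewrite -[RHS]S0 {S0}.
have em : m = m.-1.+1 by rewrite prednK.
have lm : (m.-1 < m)%N by rewrite prednK.
have := sum_refined (ltn0Sn N0) cl lm (leqnn N0.+1).
rewrite -mulSnr -em divff ?pnatr_eq0// natr1 -em pl_last// pm.
have -> : \sum_(j < m.-1) P (p j) (p j.+1) + P (p m.-1) x = \sum_(j < m) P (p j) (p j.+1).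
  by rewrite [in RHS]em big_ord_recr/= -em pm.
move=> <-; apply: eq_bigr => j _; rewrite /g.
have mR : (m%:R : R) != 0 by rewrite pnatr_eq0 -lt0n.
have mj (k : nat) : m%:R * (k%:R / (m * N0.+1)%:R) = k%:R / N0.+1%:R :> R.
  by rewrite natrM invfM mulrCA mulVKf.
by rewrite !mj.
Qed.

(** The transport property itself serves as the covering predicate, so a path is cut into finitely
    many steps along which [S] is carried. This gives constancy of functions, existence of chains
    and growth bounds alike. *)
Lemma chain_induction (S : 'rV[R]_n -> Prop) :
  (forall y, D y -> exists2 r : R, 0 < r &
     forall x0 x1, `|x0 - y| < r -> `|x1 - y| < r -> S x0 -> S x1) ->
  forall x y, D x -> D y -> S x -> S y.
Proof.
move=> HS x y Dx Dy; have [g [cg [gD [g0 g1]]]] := scD.2.1 x y Dx Dy.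
have [|N0 _ HN] := @lebesgue_number R n _ _ g (fun a r => 
     forall x0 x1, `|x0 - a| < r -> `|x1 - a| < r -> S x0 -> S x1) unitI_compact cg.
  by move=> t Kt; apply: HS; apply: gD; exists t.
have {}HN := HN N0 (leqnn _).
have N0R : (0 : R) < N0.+1%:R by rewrite ltr0n.
have uN k : (k <= N0.+1)%N -> unitI (k%:R / N0.+1%:R : R).
  by move=> kN; rewrite /unitI/= divr_ge0//= ler_pdivrMr// mul1r ler_nat.
suff H k : (k <= N0.+1)%N -> S x -> S (g (k%:R / N0.+1%:R)).
  by have := H N0.+1 (leqnn _); rewrite divff ?gt_eqF// g1.
elim: k => [|k IH] kN; first by rewrite mul0r g0.
move=> /(IH (ltnW kN)).
have [a [r [r0 arD Ha]]] := HN _ (uN k (ltnW kN)).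
apply: arD; apply: Ha; rewrite ?subrr ?normr0//.
- exact: uN (ltnW kN).
- exact: uN kN.
by rewrite -mulrBl -natr1 addrAC subrr add0r mul1r ger0_norm// invr_ge0.
Qed.

Lemma ch_exists x y : D x -> D y -> exists c, ch x y c.
Proof.
move=> Dx Dy; apply: (@chain_induction (fun y => exists c, ch x y c) _ x y) => //.
  move=> z Dz; have [r r0 rD] := Cov_ex Dz; exists r => // u v ur vr [c Hc].
  by exists (c + P u v); apply: chS Hc _; exists z, r.
by exists 0; exact: ch0.
Qed.

(** [f x] is the sum along any chain from a base point; two such chains closed up by one edge form a
    loop, whose sum is 0. *)
Lemma potential : exists f : 'rV[R]_n -> R, forall a r x y, Cov a r ->
  `|x - a| < r -> `|y - a| < r -> f y - f x = P x y.
Proof.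
have [b Db] := scD.1.
have Hex x : exists c, D x -> ch b x c.
  have [Dx|nDx] := pselect (D x); last by exists 0.
  by have [c Hc] := ch_exists Db Dx; exists c.
have [f Hf] := choice Hex; exists f => a r x y arD xr yr.
have cxy : close x y by exists a, r.
have := ch_loop (ch_trans (ch_rev (Hf y (CovD arD yr))) (chS (Hf x (CovD arD xr)) cxy)).
by rewrite addrC => /eqP; rewrite subr_eq0 => /eqP <-; rewrite addrC addKr.
Qed.

End Potential.

(** * The Poincare lemma on a simply connected open set *)

Lemma sub_swap_eq0 {A : comRingType} (a b c d : A) : a - b - (c - d) = 0 -> a - c = b - d.
Proof. by move=> H; apply/eqP; rewrite -subr_eq0 -[X in _ == X]H; apply/eqP; ring. Qed.

Section Global.
Context {R : realType} {n : nat} (D : set 'rV[R]_n) (oD : open D) (scD : simply_connected D).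

Lemma partial0_on (f : 'rV[R]_n -> R^o) :
  (forall x i, D x -> is_derive x (ev R i) f 0) ->
  forall x y, D x -> D y -> f x = f y.
Proof.
move=> Hf x y Dx Dy.
apply: (@chain_induction R n D scD (fun z => f x = f z) _ x y Dx Dy erefl).
move=> z Dz; have [r r0 rD] := open_ball oD Dz; exists r => // u v ur vr ->.
have Cf : Ck D 1 f.
  apply: (CkSI (df := fun _ _ => 0) oD) => //.
    move=> w Dw; apply: (cont_of_partials (df := fun _ _ => 0) oD) => // _ ? _.
    exact: cst_continuous.
  by move=> i; exact: Ck_cst.
apply/esym/(partial0_cst oD Cf _ ur vr) => w wr; have Dw := rD _ wr; split => // i.
exact: is_deriveP (Hf w i Dw).
Qed.

Definition is_primitive (al : 'I_n -> 'rV[R]_n -> R^o) (a : 'rV[R]_n) (r : R) (f : 'rV[R]_n -> R^o) :=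
  (forall x, `|x - a| < r -> D x) /\
  (forall x i, `|x - a| < r -> is_derive x (ev R i) f (al i x)).

(** The intersection of two balls is convex, so the difference of the primitives has zero derivative
    along the segment from [x] to [y]. *)
Lemma primitive_unique al a r f a' r' f' x y : (forall i, sm D (al i)) ->
  is_primitive al a r f -> is_primitive al a' r' f' ->
  `|x - a| < r -> `|y - a| < r -> `|x - a'| < r' -> `|y - a'| < r' ->
  f y - f x = f' y - f' x.
Proof.
move=> sal pf pf' xr yr xr' yr'.
suff H : (f \- f') y - (f \- f') x = 0.
  exact: sub_swap_eq0 H.
pose B a r : set 'rV[R]_n := [set z | `|z - a| < r].
have oB (b : 'rV[R]_n) s : open (B b s).
  have -> : B b s = ball b s.
    by apply/funext => z; rewrite /B/= -ball_normE/= distrC.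
  exact: ball_open.
have oBB : open (B a r `&` B a' r') by exact: openI.
have Hd (t : R) : 0 <= t <= 1 -> is_derive t (1 : R) (fun t : R => (f \- f') (t *: (y - x) + x))
    (\sum_i (y - x) 0 i * (al i (t *: (y - x) + x) - al i (t *: (y - x) + x))).
  move=> t01; apply: (is_derive_line_at (f \- f') x (y - x) t _).1.
  have Bt : (B a r `&` B a' r') (t *: (y - x) + x).
    by split; apply: seg_ball.
  have H1 (i : 'I_n) z : (B a r `&` B a' r') z ->
      is_derive z (ev R i) (f \- f') ((al i \- al i) z).
    by move=> [zr zr']; apply: is_deriveB; [exact: pf.2|exact: pf'.2].
  have H2 (i : 'I_n) : {for t *: (y - x) + x, continuous (al i \- al i)}.
    have -> : al i \- al i = (fun _ => 0) by apply/funext => z /=; rewrite subrr.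
    exact: cst_continuous.
  exact: (dirderiv oBB (y - x) H1 H2 Bt).
have := ler_norm_MVT_cst (K := 0) Hd.
rewrite scale1r subrK scale0r add0r => H; apply/eqP; rewrite -normr_le0; apply: H.
by move=> t _; rewrite big1 ?normr0// => i _; rewrite subrr mulr0.
Qed.

(** Increments of local primitives form a cocycle, well defined by [primitive_unique]; [potential]
    integrates it, and near each point the result differs from a local primitive by a constant. *)
Lemma poincare (al : 'I_n -> 'rV[R]_n -> R^o) : (forall i, sm D (al i)) ->
  (forall x i j, D x -> partial i (al j) x = partial j (al i) x) ->
  forall b (c : R), D b ->
  exists f : 'rV[R]_n -> R^o, [/\ sm D f, f b = c &
    forall x i, D x -> is_derive x (ev R i) f (al i x)].
Proof.
move=> sal clo b c Db.
pose Cov a r := exists f, is_primitive al a r f.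
(* The increment is common to all balls containing both points; it is set to 0 when there is no such
   ball. *)
have exP (p : 'rV[R]_n * 'rV[R]_n) : exists d : R, forall a r f, is_primitive al a r f ->
    `|p.1 - a| < r -> `|p.2 - a| < r -> d = f p.2 - f p.1.
  have [[a [r [f [pf r1 r2]]]]|nE] := pselect (exists a r f,
    [/\ is_primitive al a r f, `|p.1 - a| < r & `|p.2 - a| < r]).
    exists (f p.2 - f p.1) => a' r' f' pf' r1' r2'.
    exact: primitive_unique sal pf pf' r1 r2 r1' r2'.
  by exists 0 => a r f pf r1 r2; case: nE; exists a, r, f.
have [Q HQ] := choice exP.
have [|||F HF] := @potential R n D (fun x y => Q (x, y)) Cov _ _ _ scD.
- by move=> a r [f pf]; exact: pf.1.
- move=> a Da.
  have [r [r0 rD [f Hf]]] := local_poincare oD Da (fun i => sal i 2%N) clo.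
  by exists r => //; exists f; split => // x i; exact: Hf.
- move=> a r x y z [f pf] xr yr zr.
  by rewrite (HQ (x, y) a r f)// (HQ (y, z) a r f)// (HQ (x, z) a r f)//= addrC subrKA.
have dF x i : D x -> is_derive x (ev R i) (fun x => F x - F b + c) (al i x).
  move=> Dx.
  have [r [r0 rD [f Hf]]] := local_poincare oD Dx (fun i => sal i 2%N) clo.
  have pf : is_primitive al x r f by split.
  have xr : `|x - x| < r by rewrite subrr normr0.
  apply: (near_eq_is_derive (f := fun y => f y - f x + (F x - F b + c))); last first.
    have := is_deriveD (Hf x i xr) (@is_derive_cst _ _ _ (- f x + (F x - F b + c) : R^o) x (ev R i)).
    rewrite addr0; congr is_derive; apply/funext => y.
    exact: (addrA (f y)).
  have : nbhs x [set y | `|y - x| < r].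
    exact: nbhs_rV r0 _.
  apply: filterS => y /= yr.
  have := HF x r x y (ex_intro _ f pf) xr yr; rewrite (HQ (x, y) x r f)//= => <-.
  by rewrite !addrA subrK.
exists (fun x => F x - F b + c); split.
- by apply: (sm_of_partials oD (df := al)) => // i y; exact: dF.
- by rewrite subrr add0r.
- exact: dF.
Qed.

End Global.

(** * Power series whose coefficients decay like those of an exponential *)

Section ExpBounded.
Context {R : realType}.
Implicit Types (u v : nat -> R) (K C : R).

(** This decay survives termwise differentiation, index shifts and multiplication by powers of
    lambda, each time at the price of new constants [K] and [C]. *)
Definition exp_bounded K C u := forall m, `|u m| <= K * (C ^+ m / m`!%:R).

Definition Ser u : R := limn (series (u : R^o^nat)).

Lemma exp_bounded_normed_cvg K C u : 0 <= K -> 0 <= C -> exp_bounded K C u ->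
  cvgn [normed series (u : R^o^nat)].
Proof.
move=> K0 C0 H.
apply: (@series_le_cvg R _ (K *: (exp_coeff C))) => [m|m|m|].
- exact: normr_ge0.
- by rewrite mulr_ge0// exp_coeff_ge0.
- exact: H.
- apply: is_cvg_seriesZ; exact: is_cvg_series_exp_coeff.
Qed.

Lemma exp_bounded_cvg K C u : 0 <= K -> 0 <= C -> exp_bounded K C u ->
  cvgn (series (u : R^o^nat)).
Proof. by move=> K0 C0 H; apply: normed_cvg; exact: exp_bounded_normed_cvg H. Qed.

Lemma Ser_le K C u : 0 <= K -> 0 <= C -> exp_bounded K C u -> `|Ser u| <= K * expR C.
Proof.
move=> K0 C0 H.
have cn := exp_bounded_normed_cvg K0 C0 H.
apply: (le_trans (lim_series_norm cn)).
rewrite /expR -[K * _]/(K *: _) -lim_seriesZ; last exact: is_cvg_series_exp_coeff.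
apply: lim_series_le => //; apply: is_cvg_seriesZ; exact: is_cvg_series_exp_coeff.
Qed.

Definition entire_seq u := exists K C, [/\ 0 <= K, 0 <= C & exp_bounded K C u].

Lemma entire_seq_cvg u : entire_seq u -> cvgn (series (u : R^o^nat)).
Proof. by case=> K [C [K0 C0 H]]; exact: exp_bounded_cvg H. Qed.

Lemma SerD u v : entire_seq u -> entire_seq v -> Ser (fun m => u m + v m) = Ser u + Ser v.
Proof. by move=> /entire_seq_cvg cu /entire_seq_cvg cv; exact: lim_seriesD. Qed.

Lemma SerB u v : entire_seq u -> entire_seq v -> Ser (fun m => u m - v m) = Ser u - Ser v.
Proof. by move=> /entire_seq_cvg cu /entire_seq_cvg cv; exact: lim_seriesB. Qed.

Lemma SerZ (a : R) u : entire_seq u -> Ser (fun m => a * u m) = a * Ser u.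
Proof. by move=> /entire_seq_cvg cu; exact: lim_seriesZ. Qed.

Lemma Ser_recl u : entire_seq u -> Ser u = u 0%N + Ser (fun m => u m.+1).
Proof.
move=> /entire_seq_cvg cu; rewrite /Ser.
have -> : (series ((fun m => u m.+1) : R^o^nat)) =
    (fun m => - u 0%N + series (u : R^o^nat) m.+1).
  apply/funext => m; rewrite /series/= !big_mkord big_ord_recl/= addKr.
  by apply: eq_bigr.
have cu1 : (series (u : R^o^nat) m.+1) @[m --> \oo] --> limn (series (u : R^o^nat)).
  by have := cu; rewrite -(cvg_shiftS (series (u : R^o^nat))).
have L : (- u 0%N + series (u : R^o^nat) m.+1) @[m --> \oo] --> - u 0%N + limn (series (u : R^o^nat)).
  by apply: cvgD => //; exact: cvg_cst.
by rewrite (cvg_lim _ L)// addNKr.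
Qed.

Lemma exp_bounded_mul K C u w rho a : 0 <= K -> 0 <= C -> exp_bounded K C u ->
  (forall m, `|w m| <= a * rho ^+ m) -> exp_bounded (K * a) (C * rho) (fun m => u m * w m).
Proof.
move=> K0 C0 H Hw m; rewrite normrM.
apply: (le_trans (ler_pM _ _ (H m) (Hw m))) => //.
by rewrite exprMn; rewrite le_eqVlt; apply/orP; left; apply/eqP; ring.
Qed.

Lemma entire_seqD u v : entire_seq u -> entire_seq v -> entire_seq (fun m => u m + v m).
Proof.
case=> K [C [K0 C0 H]] [K' [C' [K'0 C'0 H']]].
exists (K + K'), (Num.max C C'); split; [exact: addr_ge0|by rewrite le_max C0|].
move=> m; apply: (le_trans (ler_normD _ _)); rewrite mulrDl; apply: lerD.
  apply: (le_trans (H m)); rewrite ler_wpM2l// ler_wpM2r ?invr_ge0//.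
  by rewrite lerXn2r ?nnegrE ?le_max ?C0 ?lexx.
apply: (le_trans (H' m)); rewrite ler_wpM2l// ler_wpM2r ?invr_ge0//.
by rewrite lerXn2r ?nnegrE ?le_max ?C'0 ?C0 ?lexx ?orbT.
Qed.

Lemma entire_seqZ (a : R) u : entire_seq u -> entire_seq (fun m => a * u m).
Proof.
case=> K [C [K0 C0 H]]; exists (`|a| * K), C; split => //; first exact: mulr_ge0.
by move=> m; rewrite normrM -mulrA ler_wpM2l.
Qed.

Definition deriv_seq u m := m.+1%:R * u m.+1.

Lemma exp_bounded_deriv K C u : exp_bounded K C u ->
  exp_bounded (K * C) C (deriv_seq u).
Proof.
move=> H m; rewrite /deriv_seq normrM ger0_norm//.
apply: (le_trans (ler_wpM2l _ (H m.+1))) => //.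
rewrite factS natrM exprS le_eqVlt; apply/orP; left; apply/eqP.
have : (m.+1%:R : R) != 0 by rewrite pnatr_eq0.
have : (m`!%:R : R) != 0 by rewrite pnatr_eq0 -lt0n fact_gt0.
move: (m.+1%:R : R) (m`!%:R : R) (C ^+ m) => a b c b0 a0.
by field; rewrite a0 b0.
Qed.

Lemma entire_seq_deriv u : entire_seq u -> entire_seq (deriv_seq u).
Proof.
case=> K [C [K0 C0 H]]; exists (K * C), C; split; rewrite ?mulr_ge0//.
exact: exp_bounded_deriv.
Qed.

End ExpBounded.

(** Second-order remainder of the m-th power. At m = 0 the truncated exponent is harmless, as the
    term carries the multiplicity 0. *)
Definition pow_rem {A : comRingType} (l h : A) m := (l + h) ^+ m - l ^+ m - h * (l ^+ m.-1 *+ m).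

Lemma pow_remS {A : comRingType} (l h : A) m : pow_rem l h m.+1 = (l + h) * pow_rem l h m + h ^+ 2 * (l ^+ m.-1 *+ m).
Proof.
rewrite /pow_rem; case: m => [|m] /=; first by rewrite !expr1 !expr0 mulr0n mulr1n; ring.
rewrite -(mulr_natr _ m.+2) -(mulr_natr _ m.+1) -[m.+2%:R](natr1 m.+1) !exprS; ring.
Qed.

Section ComplexPowers.
Context {R : realType}.
Local Notation C := R[i].
Implicit Types (l h : R[i]).
Local Notation Re := complex.Re.
Local Notation Im := complex.Im.
Local Notation normc := (@ComplexField.Normc.normc R).

Lemma ler_Re_normc l : `|Re l| <= normc l.
Proof.
case: l => a b /=; rewrite -sqrtr_sqr ler_wsqrtr// lerDl sqr_ge0//.
Qed.

Lemma ler_Im_normc l : `|Im l| <= normc l.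
Proof.
case: l => a b /=; rewrite -sqrtr_sqr ler_wsqrtr// lerDr sqr_ge0//.
Qed.

Lemma normc_ge0 l : 0 <= normc l.
Proof. by case: l => a b /=; exact: sqrtr_ge0. Qed.

Lemma normcX l m : normc (l ^+ m) = normc l ^+ m.
Proof.
elim: m => [|m IH]; first by rewrite !expr0 ComplexField.Normc.normc1.
by rewrite !exprS ComplexField.Normc.normcM IH.
Qed.

Lemma normc_norm l : `|l| = (normc l)%:C%C.
Proof. by rewrite normc_def; case: l. Qed.

Lemma normc_triangle l h : normc (l + h) <= normc l + normc h.
Proof. exact: le_normcD. Qed.

Lemma cReM l h : Re (l * h) = Re l * Re h - Im l * Im h.
Proof. by case: l h => a b [c d]. Qed.
Lemma cImM l h : Im (l * h) = Re l * Im h + Im l * Re h.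
Proof. by case: l h => a b [c d]. Qed.
Lemma cReD l h : Re (l + h) = Re l + Re h.
Proof. by case: l h => a b [c d]. Qed.
Lemma cImD l h : Im (l + h) = Im l + Im h.
Proof. by case: l h => a b [c d]. Qed.
Lemma cReN l : Re (- l) = - Re l. Proof. by case: l. Qed.
Lemma cImN l : Im (- l) = - Im l. Proof. by case: l. Qed.
Lemma cReB l h : Re (l - h) = Re l - Re h. Proof. by rewrite cReD cReN. Qed.
Lemma cImB l h : Im (l - h) = Im l - Im h. Proof. by rewrite cImD cImN. Qed.

(** [1 <= rho] lets lower powers of [rho] be raised to a common exponent. *)
Lemma pow_rem_le l h m (rho : R) : 1 <= rho -> normc l <= rho -> normc (l + h) <= rho ->
  normc (pow_rem l h m) <= normc h ^+ 2 * (4 * rho) ^+ m.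
Proof.
move=> rho1 lr lhr; have rho0 : 0 <= rho by apply: le_trans rho1.
(* The recursion [pow_remS] closes with the factor m^2, since m^2 + m <= (m + 1)^2; then m^2 <= 4^m
   because m <= 2^m. *)
suff H : normc (pow_rem l h m) <= normc h ^+ 2 * (m%:R ^+ 2 * rho ^+ m).
  apply: (le_trans H); rewrite ler_wpM2l ?exprn_ge0 ?normc_ge0// exprMn ler_wpM2r ?exprn_ge0//.
  rewrite -!natrX ler_nat (_ : 4 = 2 ^ 2)%N// -!expnM mulnC expnM leq_exp2r//.
  by rewrite ltnW// ltn_expl.
elim: m => [|m IH].
  by rewrite /pow_rem mulr0n mulr0 !expr0 subrr subr0 ComplexField.Normc.normc0 expr0n/= mul0r mulr0.
rewrite pow_remS; apply: (le_trans (normc_triangle _ _)).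
rewrite (ComplexField.Normc.normcM (l + h)) (ComplexField.Normc.normcM (h ^+ 2)) (normcX h 2).
rewrite normcMn (normcX l m.-1).
have E1 : normc (l + h) * normc (pow_rem l h m) <= normc h ^+ 2 * (m%:R ^+ 2 * rho ^+ m.+1).
  apply: (le_trans (ler_pM (normc_ge0 _) (normc_ge0 _) lhr IH)).
  by rewrite [rho ^+ m.+1]exprS mulrCA (mulrCA rho (m%:R ^+ 2)).
have E2 : normc l ^+ m.-1 *+ m <= m%:R * rho ^+ m.+1.
  rewrite -mulr_natl ler_wpM2l//.
  apply: (@le_trans _ _ (rho ^+ m.-1)); first by rewrite lerXn2r ?nnegrE ?normc_ge0.
  by apply: ler_weXn2l => //; rewrite (leq_trans (leq_pred m)).
apply: (le_trans (lerD E1 (ler_wpM2l (exprn_ge0 2 (normc_ge0 h)) E2))).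
rewrite -mulrDr ler_wpM2l ?exprn_ge0 ?normc_ge0// -mulrDl ler_wpM2r ?exprn_ge0//.
rewrite -!natrX -natrD ler_nat; lia.
Qed.

End ComplexPowers.

Section PowerSum.
Context {R : realType}.
Local Notation normc := (@ComplexField.Normc.normc R).
Variable L : R[i] -> R.
Hypothesis LD : forall x y, L (x + y) = L x + L y.
Hypothesis L_le : forall x, `|L x| <= normc x.
Implicit Types (u v : nat -> R) (l h : R[i]).

(** [L] stands for the real or the imaginary part, so a complex power series with real coefficients
    is summed as two real series. *)
Definition PL u l := Ser (fun m => u m * L (l ^+ m)).

Lemma L0 : L 0 = 0.
Proof. by apply/eqP; rewrite -normr_le0 -(ComplexField.Normc.normc0 R) L_le. Qed.
Lemma LN x : L (- x) = - L x.
Proof. by apply/eqP; rewrite -addr_eq0 -LD addNr L0. Qed.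
Lemma LB x y : L (x - y) = L x - L y. Proof. by rewrite LD LN. Qed.
Lemma LMn x m : L (x *+ m) = L x *+ m.
Proof. by elim: m => [|m IH]; rewrite ?mulr0n ?L0// !mulrS LD IH. Qed.

Lemma normcX_le l m (rho : R) : normc l <= rho -> normc (l ^+ m) <= rho ^+ m.
Proof.
move=> lr; rewrite normcX; apply: lerXn2r => //; rewrite nnegrE ?normc_ge0//.
exact: le_trans (normc_ge0 l) lr.
Qed.

Lemma exp_bounded_pow K C u l (rho : R) : 0 <= K -> 0 <= C -> exp_bounded K C u ->
  normc l <= rho -> exp_bounded K (C * rho) (fun m => u m * L (l ^+ m)).
Proof.
move=> K0 C0 H lr; rewrite -[K]mulr1; apply: exp_bounded_mul => // m.
by rewrite mul1r; apply: (le_trans (L_le _)); exact: normcX_le.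
Qed.

Lemma normc_rho_ge0 l (rho : R) : normc l <= rho -> 0 <= rho.
Proof. exact: le_trans (normc_ge0 l). Qed.

Lemma entire_seq_pow u l : entire_seq u -> entire_seq (fun m => u m * L (l ^+ m)).
Proof.
case=> K [C [K0 C0 H]]; exists K, (C * normc l); split => //.
  by rewrite mulr_ge0// normc_ge0.
exact: exp_bounded_pow H (le_refl _).
Qed.

Lemma PL_le K C u l (rho : R) : 0 <= K -> 0 <= C -> exp_bounded K C u -> normc l <= rho ->
  `|PL u l| <= K * expR (C * rho).
Proof.
move=> K0 C0 H lr; apply: Ser_le => //; last exact: exp_bounded_pow.
by rewrite mulr_ge0// (normc_rho_ge0 lr).
Qed.

Lemma PLD u v l : entire_seq u -> entire_seq v -> PL (fun m => u m + v m) l = PL u l + PL v l.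
Proof.
move=> su sv; rewrite /PL -SerD; try exact: entire_seq_pow.
by congr Ser; apply/funext => m; rewrite mulrDl.
Qed.

Lemma PLB u v l : entire_seq u -> entire_seq v -> PL (fun m => u m - v m) l = PL u l - PL v l.
Proof.
move=> su sv; rewrite /PL -SerB; try exact: entire_seq_pow.
by congr Ser; apply/funext => m; rewrite mulrBl.
Qed.

Lemma PLZ (a : R) u l : entire_seq u -> PL (fun m => a * u m) l = a * PL u l.
Proof.
move=> su; rewrite /PL -SerZ; try exact: entire_seq_pow.
by congr Ser; apply/funext => m; rewrite mulrA.
Qed.

(** This is [L] of h times the sum. As [L] is only real-linear, the factor [h] stays inside;
    [PL1_Re] and [PL1_Im] expand it. *)
Definition PL1 u h l := Ser (fun m => u m * L (h * l ^+ m)).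

Lemma PL1_le K C u h l (rho : R) : 0 <= K -> 0 <= C -> exp_bounded K C u -> normc l <= rho ->
  `|PL1 u h l| <= K * normc h * expR (C * rho).
Proof.
move=> K0 C0 H lr; apply: Ser_le; first by rewrite mulr_ge0// normc_ge0.
  by rewrite mulr_ge0// (normc_rho_ge0 lr).
apply: exp_bounded_mul => // m; apply: (le_trans (L_le _)).
by rewrite ComplexField.Normc.normcM ler_wpM2l ?normc_ge0//; exact: normcX_le.
Qed.

(** [pow_rem_le] applied termwise; its factor 4 goes into the argument of the exponential. *)
Lemma PL_deriv_le K C u l h (rho : R) : 0 <= K -> 0 <= C -> exp_bounded K C u -> 1 <= rho ->
  normc l <= rho -> normc (l + h) <= rho ->
  `|PL u (l + h) - PL u l - PL1 (deriv_seq u) h l| <= K * normc h ^+ 2 * expR (C * (4 * rho)).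
Proof.
move=> K0 C0 H rho1 lr lhr.
have rho0 : 0 <= rho by apply: le_trans rho1.
have su : entire_seq u by exists K, C.
have sd : exp_bounded (K * normc h) (C * (2 * rho)) (fun m => u m * L (h * (l ^+ m.-1 *+ m))).
  apply: exp_bounded_mul => // m; apply: (le_trans (L_le _)).
  rewrite ComplexField.Normc.normcM ler_wpM2l ?normc_ge0// normcMn -[_ *+ m]mulr_natl exprMn.
  apply: ler_pM => //; first exact: normc_ge0.
    by rewrite -natrX ler_nat ltnW// ltn_expl.
  apply: (@le_trans _ _ (rho ^+ m.-1)); first exact: normcX_le.
  by apply: ler_weXn2l => //; exact: leq_pred.
have sds : entire_seq (fun m => u m * L (h * (l ^+ m.-1 *+ m))).
  by exists (K * normc h), (C * (2 * rho)); split; rewrite ?mulr_ge0 ?normc_ge0.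
have E1 : PL1 (deriv_seq u) h l = Ser (fun m => u m * L (h * (l ^+ m.-1 *+ m))).
  rewrite (Ser_recl sds) mulr0n mulr0 L0 mulr0 add0r; congr Ser; apply/funext => m /=.
  by rewrite (mulrnAr h) LMn mulrnAr /deriv_seq mulr_natl mulrnAl.
rewrite E1 /PL -SerB; try exact: entire_seq_pow.
rewrite -SerB//; last first.
  have -> : (fun m => u m * L ((l + h) ^+ m) - u m * L (l ^+ m)) =
     (fun m => u m * L ((l + h) ^+ m) + (-1) * (u m * L (l ^+ m))).
    by apply/funext => m; rewrite mulN1r.
  by apply: entire_seqD; [exact: entire_seq_pow|apply: entire_seqZ; exact: entire_seq_pow].
apply: Ser_le; [by rewrite mulr_ge0// exprn_ge0// normc_ge0|by rewrite !mulr_ge0|].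
have -> : (fun m => u m * L ((l + h) ^+ m) - u m * L (l ^+ m) - u m * L (h * (l ^+ m.-1 *+ m)))
    = (fun m => u m * L (pow_rem l h m)).
  by apply/funext => m; rewrite /pow_rem !LB !mulrBr.
apply: exp_bounded_mul => // m; apply: (le_trans (L_le _)).
exact: pow_rem_le.
Qed.

End PowerSum.

Section PC.
Context {R : realType}.
Local Notation normc := (@ComplexField.Normc.normc R).
Implicit Types (u v : nat -> R) (l h : R[i]).
Local Notation Re := (@complex.Re R).
Local Notation Im := (@complex.Im R).

Definition PR u l := PL Re u l.
Definition PI u l := PL Im u l.
Definition PC u l : R[i] := (PR u l +i* PI u l)%C.

Lemma PL1_Re u h l : entire_seq u -> PL1 Re u h l = Re h * PR u l - Im h * PI u l.
Proof.
move=> su.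
have sR := entire_seq_pow ler_Re_normc l su; have sI := entire_seq_pow ler_Im_normc l su.
rewrite /PR /PI /PL -!SerZ// -SerB; try exact: entire_seqZ.
congr Ser; apply/funext => m; rewrite cReM; ring.
Qed.

Lemma PL1_Im u h l : entire_seq u -> PL1 Im u h l = Re h * PI u l + Im h * PR u l.
Proof.
move=> su.
have sR := entire_seq_pow ler_Re_normc l su; have sI := entire_seq_pow ler_Im_normc l su.
rewrite /PR /PI /PL -!SerZ// -SerD; try exact: entire_seqZ.
congr Ser; apply/funext => m; rewrite cImM; ring.
Qed.

Lemma PCD u v l : entire_seq u -> entire_seq v -> PC (fun m => u m + v m) l = PC u l + PC v l.
Proof.
move=> su sv; rewrite /PC /PR /PI !PLD//; try exact: cReD; try exact: cImD;
  try exact: ler_Re_normc; exact: ler_Im_normc.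
Qed.

Lemma PCZ (a : R) u l : entire_seq u -> PC (fun m => a * u m) l = a%:C%C * PC u l.
Proof.
move=> su; rewrite /PC /PR /PI !PLZ//; try exact: cReD; try exact: cImD;
  try exact: ler_Re_normc; try exact: ler_Im_normc.
by apply/eqP; rewrite eq_complex/= !mul0r subr0 addr0 !eqxx.
Qed.

Definition shift_seq u m := if m is m'.+1 then u m' else 0.

(** Passing from m! to (m + 1)! costs m + 1 <= 2^(m+1), and C + 1 >= 1 permits the raised
    exponent. *)
Lemma exp_bounded_shift K C u : 0 <= K -> 0 <= C -> exp_bounded K C u ->
  exp_bounded K (2 * (C + 1)) (shift_seq u).
Proof.
move=> K0 C0 H [|m] /=; first by rewrite normr0 mulr_ge0// divr_ge0// exprn_ge0// mulr_ge0// addr_ge0.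
apply: (le_trans (H m)); rewrite ler_wpM2l//.
have f0 : 0 < m`!%:R :> R by rewrite ltr0n fact_gt0.
rewrite ler_pdivrMr// factS natrM invfM mulrA mulfVK ?gt_eqF//.
rewrite ler_pdivlMr ?ltr0n// mulrC exprMn ler_pM// ?exprn_ge0//.
  by rewrite -natrX ler_nat; apply: ltnW; exact: ltn_expl.
apply: (@le_trans _ _ ((C + 1) ^+ m)).
  by apply: lerXn2r; rewrite ?nnegrE ?addr_ge0// lerDl.
by apply: ler_weXn2l => //; rewrite lerDr.
Qed.

Lemma entire_seq_shift u : entire_seq u -> entire_seq (shift_seq u).
Proof.
case=> K [C [K0 C0 H]]; exists K, (2 * (C + 1)); split => //.
  by rewrite mulr_ge0// addr_ge0.
exact: exp_bounded_shift.
Qed.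

Lemma PC_shift u l : entire_seq u -> PC (shift_seq u) l = l * PC u l.
Proof.
move=> su; have ss := entire_seq_shift su.
have ER : PR (shift_seq u) l = PL1 Re u l l.
  rewrite /PR /PL (Ser_recl (entire_seq_pow ler_Re_normc l ss))/=.
  rewrite mul0r add0r; congr Ser; apply/funext => m; by rewrite exprS.
have EI : PI (shift_seq u) l = PL1 Im u l l.
  rewrite /PI /PL (Ser_recl (entire_seq_pow ler_Im_normc l ss))/=.
  rewrite mul0r add0r; congr Ser; apply/funext => m; by rewrite exprS.
rewrite /PC ER EI PL1_Re// PL1_Im//; case: l {ER EI} => a b /=.
by apply/eqP; rewrite eq_complex/= !eqxx.
Qed.

Lemma PR_deriv_le K C u l h (rho : R) : 0 <= K -> 0 <= C -> exp_bounded K C u -> 1 <= rho ->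
  normc l <= rho -> normc (l + h) <= rho ->
  `|PR u (l + h) - PR u l - Re (h * PC (deriv_seq u) l)| <= K * normc h ^+ 2 * expR (C * (4 * rho)).
Proof.
move=> K0 C0 H r1 lr lhr.
have sd : entire_seq (deriv_seq u) by apply: entire_seq_deriv; exists K, C.
have := PL_deriv_le cReD ler_Re_normc K0 C0 H r1 lr lhr.
by rewrite PL1_Re// cReM.
Qed.

Lemma PI_deriv_le K C u l h (rho : R) : 0 <= K -> 0 <= C -> exp_bounded K C u -> 1 <= rho ->
  normc l <= rho -> normc (l + h) <= rho ->
  `|PI u (l + h) - PI u l - Im (h * PC (deriv_seq u) l)| <= K * normc h ^+ 2 * expR (C * (4 * rho)).
Proof.
move=> K0 C0 H r1 lr lhr.
have sd : entire_seq (deriv_seq u) by apply: entire_seq_deriv; exists K, C.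
have := PL_deriv_le cImD ler_Im_normc K0 C0 H r1 lr lhr.
by rewrite PL1_Im// cImM.
Qed.

(** The quadratic remainder becomes linear in h because |h| <= 2 rho. *)
Lemma PL_lipschitz (L : R[i] -> R) K C u l h (rho : R) :
  (forall x y, L (x + y) = L x + L y) -> (forall x, `|L x| <= normc x) ->
  0 <= K -> 0 <= C -> exp_bounded K C u -> 1 <= rho ->
  normc l <= rho -> normc (l + h) <= rho ->
  `|PL L u (l + h) - PL L u l| <=
    normc h * (K * C * expR (C * rho) + K * (2 * rho) * expR (C * (4 * rho))).
Proof.
move=> LD L_le K0 C0 H r1 lr lhr.
have A := PL_deriv_le LD L_le K0 C0 H r1 lr lhr.
have B := PL1_le L_le h (mulr_ge0 K0 C0) C0 (exp_bounded_deriv H) lr.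
have hr : normc h <= 2 * rho.
  have -> : h = (l + h) + (- l) by rewrite addrC addKr.
  apply: (le_trans (normc_triangle _ _)); rewrite normcN mulr_natl mulr2n; exact: lerD.
rewrite -[X in `|X|](subrK (PL1 L (deriv_seq u) h l)) addrC.
apply: (le_trans (ler_normD _ _)); rewrite mulrDr; apply: lerD.
  by apply: (le_trans B); rewrite mulrA [normc h * _]mulrC.
apply: (le_trans A); rewrite [X in _ <= X]mulrA ler_wpM2r ?expR_ge0//.
by rewrite expr2 (mulrCA _ K) ler_wpM2l// ler_wpM2l ?normc_ge0.
Qed.

End PC.

Lemma exp_boundedW {R : realType} (K K' C C' : R) u : 0 <= K -> 0 <= C -> K <= K' -> C <= C' ->
  exp_bounded K C u -> exp_bounded K' C' u.
Proof.
move=> K0 C0 KK CC H m; apply: (le_trans (H m)); apply: ler_pM => //.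
  by rewrite divr_ge0// exprn_ge0.
rewrite ler_wpM2r ?invr_ge0//; apply: lerXn2r; rewrite ?nnegrE//.
exact: le_trans CC.
Qed.

(** * Families of such coefficient sequences depending smoothly on x *)

Section Families.
Context {R : realType} {n : nat} (D : set 'rV[R]_n) (oD : open D).
Implicit Types (f g : nat -> 'rV[R]_n -> R^o).

Definition loc_exp_bounded f := forall x, D x -> exists r K C : R,
  [/\ 0 < r, 0 <= K, 0 <= C & forall y, `|y - x| < r -> D y /\ exp_bounded K C (f ^~ y)].

(** Exponential decay of all x-derivatives of order at most [k], locally uniform in x, with
    constants that may depend on the derivative. *)
Fixpoint EF k f : Prop :=
  match k with
  | 0 => loc_exp_bounded f
  | k'.+1 => loc_exp_bounded f /\ forall i, EF k' (fun m => partial i (f m))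
  end.

(** Stable under [partial i] in x and, through [deriv_fam], under the derivative in lambda; this is
    what lets joint smoothness be proved by induction. *)
Definition entire_family f := (forall m, sm D (f m)) /\ forall k, EF k f.

Lemma eq_EF k f g : (forall m x, D x -> f m x = g m x) -> EF k f -> EF k g.
Proof.
elim: k f g => [|k IH] f g fg /=.
  move=> Hf x Dx; have [r [K [C [r0 K0 C0 H]]]] := Hf x Dx.
  exists r, K, C; split => // y yr; have [Dy Hy] := H y yr; split => // m.
  by rewrite -fg.
case=> Hf dHf; split.
  move=> x Dx; have [r [K [C [r0 K0 C0 H]]]] := Hf x Dx.
  exists r, K, C; split => // y yr; have [Dy Hy] := H y yr; split => // m.
  by rewrite -fg.
move=> i; apply: IH (dHf i) => m x Dx; apply: (eq_partial oD i Dx) => y Dy; exact: fg.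
Qed.

Lemma EFW k f : EF k.+1 f -> EF k f.
Proof.
elim: k f => [|k IH] f [] //= H dH; split => // i; apply: IH; exact: dH.
Qed.

Lemma loc_exp_bounded_min f x : loc_exp_bounded f -> D x ->
  forall r1 : R, 0 < r1 -> exists r K C : R,
  [/\ 0 < r <= r1, 0 <= K, 0 <= C & forall y, `|y - x| < r -> D y /\ exp_bounded K C (f ^~ y)].
Proof.
move=> Hf Dx r1 r10; have [r [K [C [r0 K0 C0 H]]]] := Hf x Dx.
exists (Num.min r r1), K, C; split => //; first by rewrite lt_min r0 r10 ge_min lexx orbT.
by move=> y yr; apply: H; apply: (lt_le_trans yr); rewrite ge_min lexx.
Qed.

Lemma loc_exp_boundedD f g : loc_exp_bounded f -> loc_exp_bounded g ->
  loc_exp_bounded (fun m x => f m x + g m x).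
Proof.
move=> Hf Hg x Dx; have [r [K [C [r0 K0 C0 H]]]] := Hf x Dx.
have [r' [K' [C' [/andP[r'0 r'r] K'0 C'0 H']]]] := loc_exp_bounded_min Hg Dx r0.
exists r', (K + K'), (Num.max C C'); split => //; [exact: addr_ge0|by rewrite le_max C0|].
move=> y yr; have [Dy Hy] := H y (lt_le_trans yr r'r); have [_ Hy'] := H' y yr.
split => // m; apply: (le_trans (ler_normD _ _)); rewrite mulrDl; apply: lerD.
  by apply: (exp_boundedW K0 C0 (le_refl _) _ Hy); rewrite le_max lexx.
by apply: (exp_boundedW K'0 C'0 (le_refl _) _ Hy'); rewrite le_max lexx orbT.
Qed.

Lemma EFD k f g : (forall m, sm D (f m)) -> (forall m, sm D (g m)) ->
  EF k f -> EF k g -> EF k (fun m x => f m x + g m x).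
Proof.
elim: k f g => [|k IH] f g sf sg; first exact: loc_exp_boundedD.
case=> Hf dHf [Hg dHg]; split; first exact: loc_exp_boundedD.
move=> i; apply: (@eq_EF _ (fun m x => partial i (f m) x + partial i (g m) x)).
  move=> m x Dx; apply/esym/is_deriveP.
  by apply: is_deriveD; [exact: (sm_derive i (sf m) Dx)|exact: (sm_derive i (sg m) Dx)].
by apply: IH; [move=> m; exact: sm_partial|move=> m; exact: sm_partial|exact: dHf|exact: dHg].
Qed.

Lemma loc_exp_boundedM f (a : 'rV[R]_n -> R^o) : loc_exp_bounded f -> sm D a ->
  loc_exp_bounded (fun m x => f m x * a x).
Proof.
move=> Hf sa x Dx; have [r [r0 rD [A A0 HA]]] := cont_bounded oD (sm_cont sa Dx) Dx.
have [r' [K [C [/andP[r'0 r'r] K0 C0 H]]]] := loc_exp_bounded_min Hf Dx r0.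
exists r', (K * A), C; split => //; first exact: mulr_ge0.
move=> y yr; have [Dy Hy] := H y yr; split => // m; rewrite normrM mulrAC.
by apply: ler_pM => //; apply: HA; exact: lt_le_trans yr r'r.
Qed.

Lemma EFM k f (a : 'rV[R]_n -> R^o) : (forall m, sm D (f m)) -> sm D a -> EF k f ->
  EF k (fun m x => f m x * a x).
Proof.
elim: k f a => [|k IH] f a sf sa; first by move=> Hf; exact: loc_exp_boundedM.
case=> Hf dHf; split; first exact: loc_exp_boundedM.
move=> i; apply: (@eq_EF _ (fun m x => f m x * partial i a x + partial i (f m) x * a x)).
  move=> m x Dx; apply/esym/is_deriveP.
  have := is_deriveM (sm_derive i (sf m) Dx) (sm_derive i sa Dx).
  by rewrite [a x *: _]mulrC.
apply: EFD.
- by move=> m; apply: smM => //; exact: sm_partial.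
- by move=> m; apply: smM => //; exact: sm_partial.
- by apply: IH => //; [exact: sm_partial|apply: EFW; split].
- by apply: IH; [move=> m; exact: sm_partial| |exact: dHf].
Qed.

Lemma EF0 k : EF k (fun _ _ => 0).
Proof.
have L : loc_exp_bounded (fun _ _ => 0).
  move=> x Dx; have [r r0 rD] := open_ball oD Dx; exists r, 0, 0; split => // y yr.
  by split; [exact: rD|move=> m; rewrite normr0 mul0r].
elim: k => [|k IH] //; split => // i; apply: eq_EF IH => m x Dx.
by apply/esym/is_deriveP; exact: is_derive_cst.
Qed.

Lemma entire_family_sum (I : Type) (s : seq I) (f : I -> nat -> 'rV[R]_n -> R^o) :
  (forall c, entire_family (f c)) ->
  entire_family (fun m x => \sum_(c <- s) f c m x).
Proof.
move=> Hf; split; first by move=> m; apply: sm_sum => // c _; exact: (Hf c).1.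
move=> k; elim: s => [|c s IH].
  by apply: eq_EF (EF0 k) => m x _; rewrite big_nil.
have := EFD (Hf c).1 (fun m => sm_sum oD s (P := xpredT) (fun c _ => (Hf c).1 m)) ((Hf c).2 k) IH.
by apply: eq_EF => m x _; rewrite big_cons.
Qed.

Lemma entire_familyM f (a : 'rV[R]_n -> R^o) : entire_family f -> sm D a ->
  entire_family (fun m x => f m x * a x).
Proof.
by move=> [sf Hf] sa; split=> [m|k]; [exact: smM|exact: EFM].
Qed.

Lemma EF_shift k f : EF k f -> EF k (fun m => if m is m'.+1 then f m' else fun _ => 0).
Proof.
have L f' : loc_exp_bounded f' -> loc_exp_bounded (fun m => if m is m'.+1 then f' m' else fun _ => 0).
  move=> Hf x Dx; have [r [K [C [r0 K0 C0 H]]]] := Hf x Dx.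
  exists r, K, (2 * (C + 1)); split => //; first by rewrite mulr_ge0// addr_ge0.
  move=> y yr; have [Dy Hy] := H y yr; split => //.
  by have := exp_bounded_shift K0 C0 Hy; move=> Hs [|m]; [exact: (Hs 0%N)|exact: (Hs m.+1)].
elim: k f => [|k IH] f; first exact: L.
case=> Hf dHf; split; first exact: L.
move=> i; apply: eq_EF (IH _ (dHf i)) => -[|m] x Dx //.
by apply/esym/is_deriveP; exact: is_derive_cst.
Qed.

Lemma entire_family_partial f i : entire_family f -> entire_family (fun m => partial i (f m)).
Proof.
by move=> [sf Hf]; split=> [m|k]; [exact: sm_partial|case: (Hf k.+1) => _; apply].
Qed.

Definition deriv_fam f m x : R^o := m.+1%:R * f m.+1 x.

Lemma entire_family_deriv f : entire_family f -> entire_family (deriv_fam f).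
Proof.
move=> [sf Hf]; split=> [m|k]; first exact: smZ.
elim: k f sf Hf => [|k IH] f sf Hf.
  move=> x Dx; have [r [K [C [r0 K0 C0 H]]]] := Hf 0%N x Dx.
  exists r, (K * C), C; split => //; first exact: mulr_ge0.
  by move=> y yr; have [Dy Hy] := H y yr; split => //; exact: exp_bounded_deriv Hy.
split.
  move=> x Dx; have [r [K [C [r0 K0 C0 H]]]] := Hf 0%N x Dx.
  exists r, (K * C), C; split => //; first exact: mulr_ge0.
  by move=> y yr; have [Dy Hy] := H y yr; split => //; exact: exp_bounded_deriv Hy.
move=> i; apply: (@eq_EF _ (deriv_fam (fun m => partial i (f m)))).
  move=> m x Dx; apply/esym/is_deriveP.
  exact: (@is_deriveZ _ _ _ (f m.+1) (m.+1%:R) x (ev R i) _ (sm_derive i (sf m.+1) Dx)).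
by apply: IH => [m|k']; [exact: sm_partial|case: (Hf k'.+1) => _; apply].
Qed.

Lemma entire_family_at f x : entire_family f -> D x -> entire_seq (f ^~ x).
Proof.
move=> [_ /(_ 0%N) Hf] Dx; have [r [K [C [r0 K0 C0 H]]]] := Hf x Dx.
by exists K, C; split => //; have [] := H x; rewrite ?subrr ?normr0.
Qed.

Lemma loc_exp_bounded_all (I : eqType) (s : seq I) (g : I -> nat -> 'rV[R]_n -> R^o) x : D x ->
  (forall i, loc_exp_bounded (g i)) -> exists r K C : R,
  [/\ 0 < r, 0 <= K, 0 <= C & forall y, `|y - x| < r ->
     D y /\ forall i, i \in s -> exp_bounded K C (g i ^~ y)].
Proof.
move=> Dx Hg; elim: s => [|i s [r [K [C [r0 K0 C0 H]]]]].
  by have [r r0 rD] := open_ball oD Dx; exists r, 0, 0; split => // y yr; split => //; exact: rD.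
have [r' [K' [C' [/andP[r'0 r'r] K'0 C'0 H']]]] := loc_exp_bounded_min (Hg i) Dx r0.
exists r', (Num.max K K'), (Num.max C C'); split => //; rewrite ?le_max ?K0 ?C0//.
move=> y yr; have [Dy Hy] := H y (lt_le_trans yr r'r); have [_ Hy'] := H' y yr.
split => // j; rewrite inE => /orP[/eqP ->|js].
  by apply: (exp_boundedW K'0 C'0 _ _ Hy'); rewrite le_max lexx orbT.
by apply: (exp_boundedW K0 C0 _ _ (Hy j js)); rewrite le_max lexx.
Qed.

End Families.

(** * Joint smoothness in x and lambda of the sums of these series *)

Section Joint.
Context {R : realType} {n : nat} (D : set 'rV[R]_n) (oD : open D).
Implicit Types (f g : nat -> 'rV[R]_n -> R^o) (p q : 'rV[R]_(n + 2)).
Local Notation normc := (@ComplexField.Normc.normc R).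

Definition DC : set 'rV[R]_(n + 2) := [set p | D (xpart p)].

Lemma xpart_norm p q : `|xpart q - xpart p| <= `|q - p|.
Proof.
apply: rV_norm_le => // j; rewrite !mxE.
by have := rV_coord_le (q - p) (lshift 2 j); rewrite !mxE.
Qed.

Lemma lpart_norm p q : normc (lpart q - lpart p) <= 2 * `|q - p|.
Proof.
rewrite -lecR -normc_norm /lpart.
have -> : ((q 0 (rshift n 0) +i* q 0 (rshift n 1)) - (p 0 (rshift n 0) +i* p 0 (rshift n 1)))%C =
  ((q - p) 0 (rshift n 0)%R)%:C%C + ('i * ((q - p) 0 (rshift n 1)%R)%:C)%C.
  by apply/eqP; rewrite eq_complex/= !mxE; apply/andP; split; apply/eqP; ring.
apply: (le_trans (ler_normD _ _)).
rewrite normrM !normc_norm /= -!rmorphM -rmorphD lecR expr0n expr1n/= !add0r sqrtr1 mul1r.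
rewrite !addr0 !sqrtr_sqr mulr_natl mulr2n.
by apply: lerD; exact: rV_coord_le.
Qed.

Lemma open_DC : open DC.
Proof.
rewrite openE => p Dp; have [r r0 rD] := open_ball oD Dp.
by apply: (nbhs_rV r0) => q qr; apply: rD; apply: le_lt_trans qr; exact: xpart_norm.
Qed.

Lemma xpartD (h : R) i p : xpart (h *: ev R (lshift 2 i) + p) = h *: ev R i + xpart p.
Proof. by apply/rowP => j; rewrite !mxE/= eq_lshift. Qed.

Lemma lpart_x (h : R) i p : lpart (h *: ev R (lshift 2 i) + p) = lpart p.
Proof. by rewrite /lpart !mxE/= !eq_rlshift /= !mulr0 !add0r. Qed.

Lemma xpart_l (h : R) j p : xpart (h *: ev R (rshift n j) + p) = xpart p.
Proof. by apply/rowP => i; rewrite !mxE/= eq_lrshift mulr0 add0r. Qed.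

Lemma lpart_re (h : R) p : lpart (h *: ev R (rshift n 0) + p) = lpart p + h%:C%C.
Proof.
rewrite /lpart !mxE/= !eq_rshift /= mulr1 mulr0.
by apply/eqP; rewrite eq_complex/= add0r addr0 [h + _]addrC !eqxx.
Qed.

Lemma lpart_im (h : R) p : lpart (h *: ev R (rshift n 1) + p) = lpart p + (0 +i* h)%C.
Proof.
rewrite /lpart !mxE/= !eq_rshift /= mulr1 mulr0.
by apply/eqP; rewrite eq_complex/= add0r addr0 [h + _]addrC !eqxx.
Qed.

Section L.
Variable L : R[i] -> R.
Hypothesis LD : forall x y, L (x + y) = L x + L y.
Hypothesis L_le : forall x, `|L x| <= normc x.

(** Lipschitz in both variables: first x is moved at the new value of lambda, by bounds on the
    x-partials of the coefficients, then lambda at the old x. *)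
Lemma PL_continuous f p : entire_family D f -> DC p ->
  {for p, continuous (fun p => PL L (f ^~ (xpart p)) (lpart p))}.
Proof.
move=> Ef Dp.
(* [None] indexes the family and [Some i] its partials, so that all share one radius and one pair of
   constants. *)
pose g (k : option 'I_n) := if k is Some i then (fun m => partial i (f m)) else f.
have Hg k : loc_exp_bounded D (g k).
  case: k => [i|]; [exact: (entire_family_partial i Ef).2 0%N|exact: Ef.2 0%N].
have [r [K [C [r0 K0 C0 H]]]] := loc_exp_bounded_all oD (enum {: option 'I_n}) Dp Hg.
(* For |q - p| < 1 lambda moves by at most 2, so [rho] bounds both values and is at least 1. *)
pose rho : R := normc (lpart p) + 3.
have rho1 : 1 <= rho by rewrite /rho; have := normc_ge0 (lpart p); lra.
have l0rho : normc (lpart p) <= rho by rewrite lerDl.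
pose M1 := n%:R * K * expR (C * rho).
pose M2 := K * C * expR (C * rho) + K * (2 * rho) * expR (C * (4 * rho)).
have M10 : 0 <= M1 by rewrite !mulr_ge0// expR_ge0.
have M20 : 0 <= M2.
  by rewrite addr_ge0// !mulr_ge0// ?expR_ge0//; apply: le_trans rho1.
apply: (@lipschitz_cont _ _ _ _ (Num.min r 1) (M1 + 2 * M2)).
- by rewrite lt_min r0 ltr01.
- by rewrite addr_ge0// mulr_ge0.
move=> q; rewrite lt_min => /andP[qr q1].
set h := lpart q - lpart p.
have El : lpart q = lpart p + h by rewrite subrKC.
have hq : normc h <= 2 * `|q - p| := lpart_norm p q.
have lrho : normc (lpart q) <= rho.
  rewrite El; apply: (le_trans (normc_triangle _ _)); rewrite lerD2l.
  by apply: (le_trans hq); move: q1; move: `|q - p| => u; lra.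
have xr : `|xpart p - xpart p| < r by rewrite subrr normr0.
have yr : `|xpart q - xpart p| < r by apply: le_lt_trans qr; exact: xpart_norm.
have [Dp' Hp] := H _ xr; have [Dq Hq] := H _ yr.
have fp : exp_bounded K C (f ^~ (xpart p)) by apply: (Hp None); rewrite mem_enum.
have fq : exp_bounded K C (f ^~ (xpart q)) by apply: (Hq None); rewrite mem_enum.
have sp : entire_seq (f ^~ (xpart p)) by exists K, C.
have sq : entire_seq (f ^~ (xpart q)) by exists K, C.
have diff : exp_bounded (n%:R * K * `|xpart q - xpart p|) C
    (fun m => f m (xpart q) - f m (xpart p)).
  move=> m; have := C1_lipschitz (r := r) (a := xpart p) (K := K * (C ^+ m / m`!%:R)) oD (Ef.1 m 1%N) _ xr yr.
  have -> : n%:R * (K * (C ^+ m / m`!%:R)) * `|xpart q - xpart p| =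
     n%:R * K * `|xpart q - xpart p| * (C ^+ m / m`!%:R) by rewrite [n%:R * (K * _)]mulrA mulrAC.
  apply=> y yr'; have [Dy Hy] := H _ yr'; split => // i.
  by apply: (Hy (Some i)); rewrite mem_enum.
have E1 := PL_le L_le (mulr_ge0 (mulr_ge0 (ler0n _ n) K0) (normr_ge0 _)) C0 diff lrho.
rewrite (PLB L_le _ sq sp) in E1.
have lh : normc (lpart p + h) <= rho by rewrite -El.
have E2 := PL_lipschitz LD L_le K0 C0 fp rho1 l0rho lh.
rewrite -El in E2.
have E1' : n%:R * K * `|xpart q - xpart p| * expR (C * rho) <= M1 * `|q - p|.
  rewrite /M1 mulrAC ler_wpM2l//; exact: xpart_norm.
have E2' : normc h * M2 <= 2 * M2 * `|q - p|.
  by rewrite [X in _ <= X]mulrAC ler_wpM2r.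
rewrite -(subrKA (PL L (f ^~ (xpart p)) (lpart q))).
apply: (le_trans (ler_normD _ _)); rewrite mulrDl.
by apply: lerD; [exact: le_trans E1 E1'|exact: le_trans E2 E2'].
Qed.

(** Taylor's bound holds for each coefficient with a constant that decays exponentially, so the
    remainders sum to O(h^2). *)
Lemma PL_partial_x f p i : entire_family D f -> DC p ->
  is_derive p (ev R (lshift 2 i)) (fun p => PL L (f ^~ (xpart p)) (lpart p) : R^o)
    (PL L ((fun m => partial i (f m)) ^~ (xpart p)) (lpart p)).
Proof.
move=> Ef Dp.
pose rho := normc (lpart p).
have [r [K [C [r0 K0 C0 H]]]] :=
  (entire_family_partial i (entire_family_partial i Ef)).2 0%N _ Dp.
apply: (is_derive_quad (e := r) (C := K * expR (C * rho))) => //.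
  by rewrite mulr_ge0// expR_ge0.
move=> h hr; rewrite xpartD lpart_x.
have ball (s : R) : `|s| <= `|h| -> `|s *: ev R i + xpart p - xpart p| < r.
  move=> sh; rewrite addrK; apply: (le_lt_trans (norm_ev _ _)); exact: le_lt_trans hr.
have Dh : D (h *: ev R i + xpart p) by have [] := H _ (ball h (le_refl _)).
have sh := entire_family_at Ef Dh; have sp := entire_family_at Ef Dp.
have sd := entire_family_at (entire_family_partial i Ef) Dp.
have sdiff : entire_seq (fun m => f m (h *: ev R i + xpart p) - f m (xpart p)).
  have := entire_seqD sh (entire_seqZ (-1) sp).
  by congr entire_seq; apply/funext => m; rewrite mulN1r.
rewrite -PLB// -[h *: _]/(h * _) -PLZ// -PLB//; last exact: entire_seqZ.
rewrite mulrAC; apply: PL_le => //; first by rewrite mulr_ge0// exprn_ge0.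
move=> m.
rewrite mulrAC; apply: (taylor2 (Ef.1 m 2%N)) => s /ball /H[Ds Hs].
by split => //; exact: Hs.
Qed.

End L.

(** The Cauchy-Riemann equations: index 0 is the direction of Re lambda, index 1 that of Im lambda,
    where the derivative is multiplied by i. *)
Lemma PC_partial_l f p j : entire_family D f -> DC p ->
  is_derive p (ev R (rshift n j)) (fun p => PR (f ^~ (xpart p)) (lpart p) : R^o)
    (if j == 0 then PR ((deriv_fam f) ^~ (xpart p)) (lpart p)
     else - PI ((deriv_fam f) ^~ (xpart p)) (lpart p)) /\
  is_derive p (ev R (rshift n j)) (fun p => PI (f ^~ (xpart p)) (lpart p) : R^o)
    (if j == 0 then PI ((deriv_fam f) ^~ (xpart p)) (lpart p)
     else PR ((deriv_fam f) ^~ (xpart p)) (lpart p)).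
Proof.
move=> Ef Dp.
pose rho : R := normc (lpart p) + 1.
have rho1 : 1 <= rho by rewrite /rho lerDr normc_ge0.
have lr : normc (lpart p) <= rho by rewrite lerDl.
have [K [C [K0 C0 H]]] := entire_family_at Ef Dp.
have nr (h : R) : normc h%:C%C = `|h| by rewrite /= expr0n addr0 sqrtr_sqr.
have ni (h : R) : normc (0 +i* h)%C = `|h| by rewrite /= expr0n add0r sqrtr_sqr.
have lhr (z : R[i]) (h : R) : normc z = `|h| -> `|h| < 1 -> normc (lpart p + z) <= rho.
  move=> zh h1; apply: (le_trans (normc_triangle _ _)).
  by rewrite lerD2l zh ltW.
have K'0 : 0 <= K * expR (C * (4 * rho)) by rewrite mulr_ge0// expR_ge0.
have j01 : j = 0 \/ j = 1.
  by case: j => -[|[|//]] ?; [left|right]; apply: val_inj.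
by case: j01 => ->; split; apply: (is_derive_quad (e := 1) (C := K * expR (C * (4 * rho)))) => // h h1;
  rewrite xpart_l ?lpart_re ?lpart_im mulrAC;
  [have := PR_deriv_le K0 C0 H rho1 lr (lhr h%:C%C h (nr h) h1)
  |have := PI_deriv_le K0 C0 H rho1 lr (lhr h%:C%C h (nr h) h1)
  |have := PR_deriv_le K0 C0 H rho1 lr (lhr (0 +i* h)%C h (ni h) h1)
  |have := PI_deriv_le K0 C0 H rho1 lr (lhr (0 +i* h)%C h (ni h) h1)];
  rewrite ?nr ?ni /= ?mul0r ?subr0 ?addr0 ?sub0r ?add0r -?mulrN.
Qed.

(** Both parts go through the induction together, since the derivative in Im lambda exchanges
    them. *)
Lemma Ck_PC k f : entire_family D f ->
  Ck DC k (fun p => PR (f ^~ (xpart p)) (lpart p)) /\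
  Ck DC k (fun p => PI (f ^~ (xpart p)) (lpart p)).
Proof.
elim: k f => [|k IH] f Ef.
  by split=> p Dp; [apply: PL_continuous cReD _ _ _ _ _|apply: PL_continuous cImD _ _ _ _ _] => //;
    [exact: ler_Re_normc|exact: ler_Im_normc].
have EX i := IH _ (entire_family_partial i Ef).
have EL := IH _ (entire_family_deriv oD Ef).
pose dR (i : 'I_(n + 2)) : 'rV[R]_(n + 2) -> R^o := match fintype.split i with
    | inl i => fun p => PR ((fun m => partial i (f m)) ^~ (xpart p)) (lpart p)
    | inr j => fun p => if j == 0 then PR ((deriv_fam f) ^~ (xpart p)) (lpart p)
               else - PI ((deriv_fam f) ^~ (xpart p)) (lpart p) end.
pose dI (i : 'I_(n + 2)) : 'rV[R]_(n + 2) -> R^o := match fintype.split i with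
    | inl i => fun p => PI ((fun m => partial i (f m)) ^~ (xpart p)) (lpart p)
    | inr j => fun p => if j == 0 then PI ((deriv_fam f) ^~ (xpart p)) (lpart p)
               else PR ((deriv_fam f) ^~ (xpart p)) (lpart p) end.
have cR p : DC p -> {for p, continuous (fun p => PR (f ^~ (xpart p)) (lpart p))}.
  by move=> Dp; exact: (PL_continuous cReD (@ler_Re_normc R) Ef Dp).
have cI p : DC p -> {for p, continuous (fun p => PI (f ^~ (xpart p)) (lpart p))}.
  by move=> Dp; exact: (PL_continuous cImD (@ler_Im_normc R) Ef Dp).
have hR i p : DC p -> is_derive p (ev R i) (fun p => PR (f ^~ (xpart p)) (lpart p) : R^o) (dR i p).
  move=> Dp; rewrite /dR; case: (split_ordP i) => j ->.
    exact: (PL_partial_x (@ler_Re_normc R) j Ef Dp).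
  exact: (PC_partial_l j Ef Dp).1.
have hI i p : DC p -> is_derive p (ev R i) (fun p => PI (f ^~ (xpart p)) (lpart p) : R^o) (dI i p).
  move=> Dp; rewrite /dI; case: (split_ordP i) => j ->.
    exact: (PL_partial_x (@ler_Im_normc R) j Ef Dp).
  exact: (PC_partial_l j Ef Dp).2.
split.
- apply: (CkSI open_DC cR hR) => i; rewrite /dR; case: (fintype.split i) => j; first exact: (EX j).1.
  by case: (j == 0); [exact: EL.1|exact: (CkN open_DC EL.2)].
- apply: (CkSI open_DC cI hI) => i; rewrite /dI; case: (fintype.split i) => j; first exact: (EX j).2.
  by case: (j == 0); [exact: EL.2|exact: EL.1].
Qed.

End Joint.

(** * Entrywise derivatives of matrix-valued maps *)

Section MatrixDerivative.
Context {R : realType} {V : normedModType R}.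
Implicit Types (x v : V).

Lemma is_derive_fsum (I : Type) (s : seq I) (f : I -> V -> R^o) (df : I -> R) x v :
  (forall i, is_derive x v (f i) (df i)) ->
  is_derive x v (fun y => \sum_(i <- s) f i y : R^o) (\sum_(i <- s) df i).
Proof.
move=> H; elim: s => [|i s IH].
  rewrite big_nil; have := @is_derive_cst R V R^o 0 x v.
  by congr is_derive; apply/funext => y; rewrite big_nil.
rewrite big_cons; have := is_deriveD (H i) IH.
by congr is_derive; apply/funext => y; rewrite big_cons.
Qed.

Definition mxd {p q} x v (M : V -> 'M[R]_(p, q)) (M' : 'M[R]_(p, q)) :=
  forall a b, is_derive x v (fun y => M y a b : R^o) (M' a b).

Lemma mxd_cst {p q} x v (A : 'M[R]_(p, q)) : mxd x v (fun _ => A) 0.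
Proof. by move=> a b; rewrite mxE; exact: is_derive_cst. Qed.

Lemma mxd_tr {p q} x v (M : V -> 'M[R]_(p, q)) M' : mxd x v M M' ->
  mxd x v (fun y => (M y)^T) M'^T.
Proof.
move=> H a b; rewrite mxE; have := H b a.
by congr is_derive; apply/funext => y; rewrite mxE.
Qed.

Lemma mxdD {p q} x v (M N : V -> 'M[R]_(p, q)) M' N' : mxd x v M M' -> mxd x v N N' ->
  mxd x v (fun y => M y + N y) (M' + N').
Proof.
move=> HM HN a b; rewrite mxE; have := is_deriveD (HM a b) (HN a b).
by congr is_derive; apply/funext => y; rewrite mxE.
Qed.

Lemma mxdN {p q} x v (M : V -> 'M[R]_(p, q)) M' : mxd x v M M' ->
  mxd x v (fun y => - M y) (- M').
Proof.
move=> HM a b; rewrite mxE; have := is_deriveN (HM a b).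
by congr is_derive; apply/funext => y; rewrite mxE.
Qed.

Lemma mxdM {p q r} x v (M : V -> 'M[R]_(p, q)) (N : V -> 'M[R]_(q, r)) M' N' :
  mxd x v M M' -> mxd x v N N' ->
  mxd x v (fun y => M y *m N y) (M' *m N x + M x *m N').
Proof.
move=> HM HN a b; rewrite !mxE -big_split/=.
have := is_derive_fsum (index_enum _) (fun c => is_deriveM (HM a c) (HN c b)).
have -> : \sum_c (M x a c *: N' c b + N x c b *: M' a c) =
   \sum_c (M' a c * N x c b + M x a c * N' c b).
  by apply: eq_bigr => c _; rewrite addrC; congr (_ + _); exact: mulrC.
by congr is_derive; apply/funext => y; rewrite mxE.
Qed.

Lemma mxd_unique {p q} x v (M : V -> 'M[R]_(p, q)) M' M'' : mxd x v M M' -> mxd x v M M'' -> M' = M''.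
Proof.
by move=> H1 H2; apply/matrixP => a b; rewrite -(is_deriveP (H1 a b)) (is_deriveP (H2 a b)).
Qed.

Lemma mxd_partial {p q} x v (M : V -> 'M[R]_(p, q)) M' : mxd x v M M' -> is_derive x v M M'.
Proof.
move=> H; have dM : derivable M x v by apply/derivable_mxP => a b; case: (H a b).
split => //; rewrite derive_mx//; apply/matrixP => a b; rewrite mxE.
exact: is_deriveP (H a b).
Qed.

End MatrixDerivative.

(** * The iterated primitives G_m of a commuting closed matrix form *)

Section Tower.
Context {R : realType} {n p : nat} (D : set 'rV[R]_n) (oD : open D) (scD : simply_connected D).
Context (b0 : 'rV[R]_n) (Db0 : D b0).
Context (al : 'I_n -> 'rV[R]_n -> 'M[R]_p).

Definition smx {q r} (M : 'rV[R]_n -> 'M[R]_(q, r)) := forall a b, sm D (fun y => M y a b).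

Definition dmx {q r} i (M : 'rV[R]_n -> 'M[R]_(q, r)) x : 'M[R]_(q, r) :=
  \matrix_(a, b) partial i (fun y => M y a b : R^o) x.

Lemma smx_mxd {q r} (M : 'rV[R]_n -> 'M[R]_(q, r)) i x : smx M -> D x ->
  mxd x (ev R i) M (dmx i M x).
Proof. by move=> sM Dx a b; rewrite mxE; exact: sm_derive i (sM a b) Dx. Qed.

Lemma smx_dmx {q r} (M : 'rV[R]_n -> 'M[R]_(q, r)) i : smx M -> smx (dmx i M).
Proof.
move=> sM a b; apply: (eq_sm oD _ (sm_partial i (sM a b))) => y _; by rewrite mxE.
Qed.

Lemma smxM {q r s} (M : 'rV[R]_n -> 'M[R]_(q, r)) (N : 'rV[R]_n -> 'M[R]_(r, s)) :
  smx M -> smx N -> smx (fun y => M y *m N y).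
Proof.
move=> sM sN a b; apply: (eq_sm oD (f := fun y => \sum_c M y a c * N y c b)).
  by move=> y _; rewrite mxE.
by apply: sm_sum => // c _; exact: smM.
Qed.

Lemma smx_cst {q r} (A : 'M[R]_(q, r)) : smx (fun _ => A).
Proof. by move=> a b; exact: sm_cst. Qed.

Lemma smx_tr {q r} (M : 'rV[R]_n -> 'M[R]_(q, r)) : smx M -> smx (fun y => (M y)^T).
Proof. by move=> sM a b; apply: (eq_sm oD _ (sM b a)) => y _; rewrite mxE. Qed.

Lemma smxN {q r} (M : 'rV[R]_n -> 'M[R]_(q, r)) : smx M -> smx (fun y => - M y).
Proof. by move=> sM a b; apply: (eq_sm oD _ (smN oD (sM a b))) => y _; rewrite mxE. Qed.

Lemma dmx_sym {q r} (M : 'rV[R]_n -> 'M[R]_(q, r)) i j x : smx M -> D x ->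
  dmx i (dmx j M) x = dmx j (dmx i M) x.
Proof.
move=> sM Dx; apply/matrixP => a b; rewrite [LHS]mxE [RHS]mxE.
have E k l : partial k (fun y => dmx l M y a b : R^o) x = partial k (partial l (fun y => M y a b)) x.
  by apply: (eq_partial oD k Dx) => y _; rewrite mxE.
by rewrite !E (schwarz oD _ _ (sM a b 2%N) Dx).
Qed.

Hypothesis sal : forall i, smx (al i).
Hypothesis closed_al : forall i j x, D x -> dmx i (al j) x = dmx j (al i) x.
Hypothesis comm_al : forall i j x, D x -> al i x *m al j x = al j x *m al i x.

Definition closedM (M : 'rV[R]_n -> 'M[R]_p) := smx M /\
  forall i j x, D x -> dmx i (fun y => M y *m al j y) x = dmx j (fun y => M y *m al i y) x.

(** With dM' = M al, the derivative d_i (M' al_j) equals M al_i al_j + M' d_i al_j. It is symmetric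
    in i and j, because the coefficients commute and [al] is closed, so the construction can be
    repeated. *)
Lemma closedM_step M : closedM M -> exists M', [/\ closedM M', M' b0 = 0 &
  forall i x, D x -> mxd x (ev R i) M' (M x *m al i x)].
Proof.
move=> [sM cM].
have H (ab : 'I_p * 'I_p) : exists f : 'rV[R]_n -> R^o, [/\ sm D f, f b0 = 0 &
    forall x i, D x -> is_derive x (ev R i) f ((M x *m al i x) ab.1 ab.2)].
  apply: (poincare oD scD) => // [i|x i j Dx]; first exact: smxM.
  have := cM i j x Dx => /matrixP/(_ ab.1 ab.2).
  by rewrite !mxE.
have [f Hf] := choice H.
pose M' x : 'M[R]_p := \matrix_(a, b) f (a, b) x.
have dM' i x : D x -> mxd x (ev R i) M' (M x *m al i x).
  move=> Dx a b; have [_ _ /(_ x i Dx)] := Hf (a, b).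
  by congr is_derive; apply/funext => y; rewrite mxE.
have sM' : smx M'.
  move=> a b; have [sf _ _] := Hf (a, b).
  by apply: (eq_sm oD _ sf) => y _; rewrite mxE.
exists M'; split => //.
  split=> // i j x Dx.
  have dd k l : mxd x (ev R k) (fun y => M' y *m al l y)
      (M x *m al k x *m al l x + M' x *m dmx k (al l) x).
    by apply: mxdM; [exact: dM'|exact: smx_mxd].
  have U k l := mxd_unique (smx_mxd k (smxM sM' (sal l)) Dx) (dd k l).
  by rewrite !U -!mulmxA comm_al// closed_al.
by apply/matrixP => a b; rewrite !mxE; have [_ -> _] := Hf (a, b).
Qed.

Lemma tower_exists : exists G : nat -> 'rV[R]_n -> 'M[R]_p,
  [/\ forall x, G 0%N x = 1%:M, forall m, smx (G m), forall m, G m.+1 b0 = 0 &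
   forall m i x, D x -> mxd x (ev R i) (G m.+1) (G m x *m al i x)].
Proof.
(* A total successor function, so that the tower is its iteration from the identity; the value is
   arbitrary when [M] does not give a closed form. *)
have ex M : exists M', closedM M -> [/\ closedM M', M' b0 = 0 &
  forall i x, D x -> mxd x (ev R i) M' (M x *m al i x)].
  have [cM|ncM] := pselect (closedM M); last by exists M.
  by have [M' HM'] := closedM_step cM; exists M'.
have [nxt Hn] := choice ex.
have c0 : closedM (fun _ => 1%:M).
  split; first exact: smx_cst.
  move=> i j x Dx; have := closed_al i j Dx.
  have E k l : dmx k (fun y => 1%:M *m al l y) x = dmx k (al l) x.
    by congr dmx; apply/funext => y; rewrite mul1mx.
  by rewrite !E.
have cG m : closedM (iter m nxt (fun _ => 1%:M)).
  by elim: m => //= m IH; have [] := Hn _ IH.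
exists (fun m => iter m nxt (fun _ => 1%:M)); split => //.
- by move=> m; exact: (cG m).1.
- by move=> m /=; have [] := Hn _ (cG m).
- by move=> m i x Dx /=; have [_ _] := Hn _ (cG m); apply.
Qed.

Variable G : nat -> 'rV[R]_n -> 'M[R]_p.
Hypothesis G0 : forall x, G 0%N x = 1%:M.
Hypothesis sG : forall m, smx (G m).
Hypothesis Gb0 : forall m, G m.+1 b0 = 0.
Hypothesis dG : forall m i x, D x -> mxd x (ev R i) (G m.+1) (G m x *m al i x).

Lemma exp_power_derive (c q s : R) m :
  is_derive s (1 : R) (fun s : R => (c + q * s) ^+ m.+1 / m.+1`!%:R) (q * ((c + q * s) ^+ m / m`!%:R)).
Proof.
have dl : is_derive s (1 : R) (fun s : R => c + q * s) q.
  have := is_deriveD (@is_derive_cst R R^o R^o c s 1) (@is_deriveZ R R^o R^o id q s 1 1 (is_derive_id _ _)).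
  by rewrite add0r [q *: (1 : R^o)]mulr1.
have := @is_deriveM R R^o _ _ s 1 _ _ (@is_deriveX R R^o _ m.+1 s 1 _ dl) (@is_derive_cst R R^o R^o (m.+1`!%:R^-1) s 1).
have -> : (((fun s : R => c + q * s) ^+ m.+1) s *: (0 : R^o) +
    cst (m.+1`!%:R^-1 : R) s *: ((m.+1%:R * (c + q * s) ^+ m.+1.-1) *: q)) =
  q * ((c + q * s) ^+ m / m`!%:R).
  rewrite scaler0 add0r /= /GRing.scale/= factS natrM.
  have : (m.+1%:R : R) != 0 by rewrite pnatr_eq0.
  have : (m`!%:R : R) != 0 by rewrite pnatr_eq0 -lt0n fact_gt0.
  move: (m.+1%:R : R) (m`!%:R : R) ((c + q * s) ^+ m) => a b d b0' a0.
  by field; rewrite a0 b0'.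
congr is_derive; apply/funext => t; rewrite -[LHS]/(((fun s : R => c + q * s) ^+ m.+1) t * _).
by congr (_ * _); elim: m.+1 => [//|k IH]; rewrite !exprS -IH.
Qed.

(** By induction on m, the derivative of G_(m+1) along the segment is dominated by that of the
    divided power (C + q t)^(m+1) / (m+1)!. The bound keeps its form with only [C] enlarged, so
    steps can be chained along a path. *)
Lemma tower_bound_step (y : 'rV[R]_n) (r A C : R) x0 x : 0 <= C -> 0 <= A ->
  (forall z, `|z - y| < r -> D z /\ forall i a b, `|al i z a b| <= A) ->
  `|x0 - y| < r -> `|x - y| < r ->
  (forall m a b, `|G m x0 a b| <= C ^+ m / m`!%:R) ->
  forall m a b, `|G m x a b| <= (C + n%:R * (p%:R * A) * `|x - x0|) ^+ m / m`!%:R.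
Proof.
move=> C0 A0 HA x0r xr Hx0.
(* n directions of differentiation, and p terms in each entry of the product G_m al_i. *)
set q := n%:R * (p%:R * A) * `|x - x0|.
have q0 : 0 <= q by rewrite !mulr_ge0.
have r0 : 0 < r by apply: le_lt_trans xr.
suff H m : forall t, 0 <= t <= 1 -> forall a b,
    `|G m (t *: (x - x0) + x0) a b| <= (C + q * t) ^+ m / m`!%:R.
  move=> m a b; have := H m 1 _ a b; rewrite scale1r subrK mulr1; apply.
  by rewrite ler01 lexx.
elim: m => [|m IH] t /andP[t0 t1] a b.
  by rewrite G0 mxE expr0 divr1; case: (a == b); rewrite ?normr1 ?normr0.
have Hd (s : R) : 0 <= s <= 1 -> is_derive s (1 : R) (fun s : R => G m.+1 (s *: (t *: (x - x0)) + x0) a b : R^o)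
    (\sum_i (t *: (x - x0)) 0 i * (G m (s *: (t *: (x - x0)) + x0) *m al i (s *: (t *: (x - x0)) + x0)) a b).
  move=> /andP[s0 s1].
  apply: (is_derive_line_at (fun z => G m.+1 z a b : R^o) x0 (t *: (x - x0)) s _).1.
  have Ds : D (s *: (t *: (x - x0)) + x0).
    apply: (HA _ _).1; rewrite scalerA; apply: seg_ball => //.
    by rewrite mulr_ge0//= mulr_ile1.
  apply: (dirderiv oD (df := fun i z => (G m z *m al i z) a b)) => // [i z Dz|i].
    exact: dG.
  exact: sm_cont (smxM (sG m) (sal i) a b) Ds.
have Hh (s : R) : 0 <= s <= 1 -> is_derive s (1 : R) (fun s : R => (C + (q * t) * s) ^+ m.+1 / m.+1`!%:R)
    ((q * t) * ((C + (q * t) * s) ^+ m / m`!%:R)) by move=> _; exact: exp_power_derive.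
have Hle (s : R) : 0 <= s <= 1 ->
   `|\sum_i (t *: (x - x0)) 0 i * (G m (s *: (t *: (x - x0)) + x0) *m al i (s *: (t *: (x - x0)) + x0)) a b|
   <= (q * t) * ((C + (q * t) * s) ^+ m / m`!%:R).
  move=> /andP[s0 s1]; rewrite scalerA.
  have st01 : 0 <= s * t <= 1 by rewrite mulr_ge0//= mulr_ile1.
  have [Dz HAz] := HA _ (seg_ball x0r xr st01).
  have HG := IH _ st01; rewrite (mulrC s t) mulrA in HG.
  set B := (C + q * t * s) ^+ m / m`!%:R in HG *.
  have B0 : 0 <= B by apply: le_trans (HG a b).
  rewrite (mulrC s t) in HAz; rewrite (mulrC s t); set z := _ + x0 in HG HAz *.
  have -> : q * t * B = \sum_(i < n) (t * `|x - x0|) * (p%:R * (B * A)).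
    by rewrite sumr_const card_ord -[RHS]mulr_natl /q; ring.
  apply: (le_trans (ler_norm_sum _ _ _)); apply: ler_sum => i _.
  rewrite normrM; apply: ler_pM => //.
    by rewrite mxE normrM ger0_norm// ler_wpM2l// rV_coord_le.
  rewrite mxE; apply: (le_trans (ler_norm_sum _ _ _)).
  have -> : p%:R * (B * A) = \sum_(c < p) (B * A).
    by rewrite sumr_const card_ord -[RHS]mulr_natl.
  by apply: ler_sum => c _; rewrite normrM; apply: ler_pM.
have := ler_norm_MVT Hd Hh Hle.
rewrite scale1r scale0r add0r mulr1 mulr0 addr0 => E.
have := Hx0 m.+1 a b; move: E.
move: (G m.+1 _ a b) (G m.+1 x0 a b) => g1 g0.
move: ((C + q * t) ^+ m.+1 / _) (C ^+ m.+1 / _) => h1 h0 E E0.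
rewrite -[g1](subrK g0); apply: (le_trans (ler_normD _ _)).
by rewrite -[h1](subrK h0); exact: lerD.
Qed.

Lemma al_bounded y : D y -> exists r A : R, [/\ 0 < r, 0 <= A &
  forall z, `|z - y| < r -> D z /\ forall i a b, `|al i z a b| <= A].
Proof.
move=> Dy.
have [|r [r0 rD [A A0 HA]]] := @family_bounded R n D oD _ (enum {: 'I_n * ('I_p * 'I_p)})
  (fun k z => al k.1 z k.2.1 k.2.2) y Dy.
  by move=> k; exact: sm_cont (sal k.1 k.2.1 k.2.2) Dy.
exists r, A; split => // z zr; split; first exact: rD.
by move=> i a b; apply: (HA (i, (a, b))) => //; rewrite mem_enum.
Qed.

(** At the base point all G_m with m > 0 vanish, so C = 0 starts the propagation. *)
Lemma tower_bound x : D x -> exists2 C : R, 0 <= C & forall m a b, `|G m x a b| <= C ^+ m / m`!%:R.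
Proof.
move=> Dx; apply: (@chain_induction R n D scD (fun x => exists2 C : R, 0 <= C &
  forall m a b, `|G m x a b| <= C ^+ m / m`!%:R) _ b0 x Db0 Dx).
  move=> y Dy; have [r [A [r0 A0 HA]]] := al_bounded Dy; exists r => // x0 x1 x0r x1r [C C0 HC].
  exists (C + n%:R * (p%:R * A) * `|x1 - x0|); first by rewrite addr_ge0// !mulr_ge0.
  exact: tower_bound_step C0 A0 HA x0r x1r HC.
exists 0 => // -[|m] a b.
  by rewrite G0 mxE expr0 divr1; case: (a == b); rewrite ?normr1 ?normr0.
by rewrite Gb0 mxE normr0 expr0n/= mul0r.
Qed.

Lemma tower_loc_bounded a b : loc_exp_bounded D (fun m x => G m x a b).
Proof.
move=> x Dx; have [C C0 HC] := tower_bound Dx.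
have [r [A [r0 A0 HA]]] := al_bounded Dx.
have xr : `|x - x| < r by rewrite subrr normr0.
exists r, 1, (C + n%:R * (p%:R * A) * r); split => //.
  by rewrite addr_ge0// !mulr_ge0// ltW.
move=> y yr; split; first by case: (HA y yr).
move=> m; rewrite mul1r; apply: (le_trans (tower_bound_step C0 A0 HA xr yr HC m a b)).
rewrite ler_wpM2r ?invr_ge0//; apply: lerXn2r; rewrite ?nnegrE ?addr_ge0 ?mulr_ge0//; try exact: ltW.
by rewrite lerD2l ler_wpM2l ?mulr_ge0// ltW.
Qed.

(** The x-derivative of G_(m+1) is G_m al_i, that is, the same family shifted and multiplied by
    smooth functions; hence the induction on the order, over all entries at once. *)
Lemma tower_entire a b : entire_family D (fun m x => G m x a b).
Proof.
split; first by move=> m; exact: sG.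
move=> k; elim: k a b => [|k IH] a b; first exact: tower_loc_bounded.
split; first exact: tower_loc_bounded.
move=> i.
have S : EF D k (fun m x => \sum_c G m x a c * al i x c b).
  have: forall s : seq 'I_p, EF D k (fun m x => \sum_(c <- s) G m x a c * al i x c b).
    elim=> [|c s IHs]; first by apply: (eq_EF oD _ (EF0 oD k)) => m x _; rewrite big_nil.
    have sm1 m : sm D (fun x => G m x a c * al i x c b : R^o).
      by apply: smM => //; [exact: sG|exact: sal].
    have sm2 m : sm D (fun x => \sum_(c <- s) G m x a c * al i x c b : R^o).
      by apply: sm_sum => // d _; apply: smM => //; [exact: sG|exact: sal].
    have := EFD oD sm1 sm2 (EFM oD (fun m => sG m a c) (sal i c b) (IH a c)) IHs.
    by apply: (eq_EF oD) => m x _; rewrite big_cons.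
  by apply.
apply: (eq_EF oD _ (EF_shift oD S)) => -[|m] x Dx; apply/esym.
  rewrite /partial; apply: is_deriveP.
  have := @is_derive_cst R 'rV[R]_n R^o ((1%:M : 'M[R]_p) a b) x (ev R i).
  by congr is_derive; apply/funext => y; rewrite G0.
by rewrite /partial (is_deriveP (dG m i Dx a b)) mxE.
Qed.

End Tower.

(** * Algebra of the matrices J and E_i *)

Section Entries.
Context {R : realType} {n : nat} (k : nat).
Local Notation J := (@Jmat R n k).

Definition eps (i : 'I_n) : R := if (i < n - k)%N then 1 else -1.

Lemma eps2 i : eps i * eps i = 1.
Proof. by rewrite /eps; case: ifP => _; rewrite ?mulr1 ?mulrNN ?mulr1. Qed.

Lemma JmxE {m} (M : 'M[R]_(n, m)) a b : (J *m M) a b = eps a * M a b.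
Proof. by rewrite /Jmat mul_diag_mx !mxE. Qed.

Lemma mxJE {m} (M : 'M[R]_(m, n)) a b : (M *m J) a b = M a b * eps b.
Proof. by rewrite /Jmat mul_mx_diag !mxE. Qed.

Lemma JJ : J *m J = 1%:M.
Proof.
apply/matrixP => a b; rewrite JmxE /Jmat !mxE -/(eps a).
by have [->|] := eqVneq a b; rewrite ?mulr1n ?eps2 // !mulr0n mulr0.
Qed.

Lemma JT : J^T = J. Proof. exact: tr_diag_mx. Qed.

Lemma EmxE {m} i (M : 'M[R]_(n, m)) a b : (Emat R i *m M) a b = M i b *+ (a == i).
Proof.
rewrite mxE (bigD1 i)//= big1 ?addr0 => [|j ji]; rewrite /Emat mxE.
  by rewrite eqxx andbT; case: (a == i); rewrite ?mul1r ?mul0r.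
by rewrite (negbTE ji) andbF mul0r.
Qed.

Lemma mxEE {m} i (M : 'M[R]_(m, n)) a b : (M *m Emat R i) a b = M a i *+ (b == i).
Proof.
rewrite mxE (bigD1 i)//= big1 ?addr0 => [|j ji]; rewrite /Emat mxE.
  by rewrite eqxx; case: (b == i); rewrite ?mulr1 ?mulr0.
by rewrite (negbTE ji) mulr0.
Qed.

Lemma orth_inv (B : 'M[R]_n) : B^T *m J *m B = J -> B *m (J *m B^T *m J) = 1%:M.
Proof.
move=> BB; apply: mulmx1C.
have -> : J *m B^T *m J *m B = J *m (B^T *m J *m B) by rewrite !mulmxA.
by rewrite BB JJ.
Qed.

(** J B^T J inverts [B], so V = J B^T J C and U = - B^T J C; the constant matrix [C] then
    cancels. *)
Lemma potential_derivative (A E B V C U : 'M[R]_n) : B *m V = C -> B^T *m J *m B = J ->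
  V = - (J *m U) -> C \in unitmx ->
  A *m E *m U *m invmx C = - (A *m E *m B^T *m J).
Proof.
move=> BVC BB VU uC.
have VE : J *m B^T *m J *m C = V.
  rewrite -BVC.
  have -> : J *m B^T *m J *m (B *m V) = J *m (B^T *m J *m B) *m V by rewrite !mulmxA.
  by rewrite BB JJ mul1mx.
have -> : U = - (B^T *m J *m C).
  transitivity (- (J *m V)); first by rewrite VU mulmxN opprK mulmxA JJ mul1mx.
  by rewrite -VE !mulmxA JJ mul1mx.
by rewrite mulmxN mulNmx !mulmxA mulmxK.
Qed.

(** [X] is the derivative of [B] and - t V that of [V]; the hypothesis says that B V is constant. *)
Lemma transport_derivative (X B t V : 'M[R]_n) : V \in unitmx ->
  X *m V + B *m (- (t *m V)) = 0 -> X = B *m t.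
Proof.
move=> uV /eqP; rewrite mulmxN subr_eq0 mulmxA => /eqP E.
by rewrite -[LHS](mulmxK uV) E (mulmxK uV).
Qed.

Lemma Emat_tr i : (Emat R i)^T = Emat R i :> 'M[R]_n. Proof. exact: trmx_delta. Qed.

Lemma EJ i : Emat R i *m J = J *m Emat R i.
Proof.
apply/matrixP => a b; rewrite mxJE JmxE /Emat !mxE.
by have [->|] := eqVneq a b; [rewrite mulrC|move=> ab; case: eqP => [->|]; case: eqP => [->|]; rewrite /= ?mul0r ?mulr0// mulrC].
Qed.

Lemma EE i j : i != j -> Emat R i *m Emat R j = 0 :> 'M[R]_n.
Proof. by move=> ij; rewrite /Emat mul_delta_mx_cond (negbTE ij). Qed.

End Entries.

Lemma curvature_cancel {V : zmodType} (P Q S : V) : - P + S - (- Q + S) + (P - Q) = 0.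
Proof.
by rewrite [- (- Q + S)]opprD opprK [- P + S + _]addrACA subrr addr0 addrACA addNr subrr addr0.
Qed.

(** * Flatness of pure gauge forms *)

Section Flat.
Context {R : realType} {n m : nat} (D : set 'rV[R]_n) (oD : open D).

(** The Maurer-Cartan equation for A^-1 dA. The inverse is supplied as a smooth map [A'], since it
    has an explicit polynomial formula for both frames. *)
Lemma pure_gauge_flat (A A' : 'rV[R]_n -> 'M[R]_m) (th : 'I_n -> 'rV[R]_n -> 'M[R]_m) :
  smx D A -> smx D A' -> (forall x, D x -> A' x *m A x = 1%:M) ->
  (forall i x, D x -> dmx i A x = A x *m th i x) -> flat_on D th.
Proof.
move=> sA sA' AA dA x Dx i j.
have thE l y : D y -> th l y = A' y *m dmx l A y.
  by move=> Dy; rewrite dA// mulmxA AA// mul1mx.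
have pth k l : partial k (th l) x = dmx k A' x *m dmx l A x + A' x *m dmx k (dmx l A) x.
  rewrite (eq_partial oD k Dx (thE l)); apply: is_deriveP; apply: mxd_partial.
  by apply: mxdM; [exact: (smx_mxd k sA' Dx)|exact: (smx_mxd k (smx_dmx oD l sA) Dx)].
have AA' : A x *m A' x = 1%:M by apply: mulmx1C; exact: AA.
have dA' k : dmx k A' x = - (A' x *m dmx k A x *m A' x).
  have d1 : mxd x (ev R k) (fun y => A' y *m A y) (dmx k A' x *m A x + A' x *m dmx k A x).
    by apply: mxdM; [exact: (smx_mxd k sA' Dx)|exact: (smx_mxd k sA Dx)].
  have d0 : mxd x (ev R k) (fun y => A' y *m A y) 0.
    move=> a b; have := mxd_cst x (ev R k) (1%:M : 'M[R]_m) a b.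
    by apply: near_eq_is_derive; apply: near_openW Dx _ => // y Dy; rewrite AA.
  have /eqP := mxd_unique d1 d0; rewrite addr_eq0 => /eqP E.
  by rewrite -[LHS]mulmx1 -AA' mulmxA E mulNmx.
rewrite (pth i j) (pth j i) (dA' i) (dA' j) (dmx_sym oD i j sA Dx) (thE i x Dx) (thE j x Dx).
rewrite !mulNmx !mulmxA.
exact: curvature_cancel.
Qed.

End Flat.

(** * The solution F, the second frame B and the potential Y *)

Section Core.
Context {R : realType} {n : nat} (k : nat) (D : set 'rV[R]_n) (oD : open D).
Local Notation J := (@Jmat R n k).
Local Notation eps := (@eps R n k).
Context (Phi A U : 'rV[R]_n -> 'M[R]_n).
Hypothesis sPhi : smx D Phi.
Hypothesis sA : smx D A.
Hypothesis sU : smx D U.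
Hypothesis AA : forall x, D x -> (A x)^T *m A x = 1%:M.
Hypothesis dPhi : forall j x, D x -> dmx j Phi x = A x *m Emat R j *m U x.
Hypothesis uU : forall x, D x -> U x \in unitmx.
Hypothesis gU : forall x l, D x -> \sum_j eps j * (U x j l * U x j l) = 0.
Hypothesis U_neq0 : forall x j l, D x -> U x j l != 0.

Definition Gam i x := (A x)^T *m dmx i A x.
(** Off the diagonal, row i of omega_i is - eps_i F_ib, which forces this formula if A^T d_i A is to
    be omega_i. *)
Definition Fsol x : 'M[R]_n := \matrix_(i, b) (- eps i * Gam i x i b).

Lemma smx_F : smx D Fsol.
Proof.
move=> i b; apply: (eq_sm oD (f := fun x => - eps i * Gam i x i b)).
  by move=> y _; rewrite [RHS]mxE.
by apply: smZ => //; apply: (smxM oD); [exact: smx_tr|exact: smx_dmx].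
Qed.

Lemma Gam_skew i x a b : D x -> Gam i x a b = - Gam i x b a.
Proof.
move=> Dx.
have d1 : mxd x (ev R i) (fun y => (A y)^T *m A y) ((dmx i A x)^T *m A x + (A x)^T *m dmx i A x).
  by apply: mxdM; [exact: (mxd_tr (smx_mxd i sA Dx))|exact: (smx_mxd i sA Dx)].
have d0 : mxd x (ev R i) (fun y => (A y)^T *m A y) 0.
  move=> a' b'; have := mxd_cst x (ev R i) (1%:M : 'M[R]_n) a' b'.
  by apply: near_eq_is_derive; apply: near_openW Dx _ => // y Dy; rewrite AA.
have := mxd_unique d1 d0.
have -> : (dmx i A x)^T *m A x = (Gam i x)^T by rewrite /Gam trmx_mul trmxK.
rewrite -/(Gam i x); move: (Gam i x) => g /matrixP/(_ a b); rewrite !mxE addrC => /eqP.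
by rewrite addr_eq0 => /eqP.
Qed.

Lemma Gam_diag i x a : D x -> Gam i x a a = 0.
Proof.
move=> Dx; have := Gam_skew i a a Dx; move: (Gam i x a a) => g.
by move=> /eqP; rewrite -subr_eq0 opprK -mulr2n mulrn_eq0/= => /eqP.
Qed.

(** Entry (b, l) of A^T d_i d_j Phi = A^T d_j d_i Phi, with dPhi replaced by its factored form. *)
Lemma second_derivatives i j b l x : D x ->
  Gam i x b j * U x j l + dmx i U x j l *+ (b == j) =
  Gam j x b i * U x i l + dmx j U x i l *+ (b == i).
Proof.
move=> Dx.
have dd k1 k2 : dmx k1 (dmx k2 Phi) x =
    dmx k1 A x *m Emat R k2 *m U x + A x *m Emat R k2 *m dmx k1 U x.
  have E : mxd x (ev R k1) (dmx k2 Phi) (dmx k1 (dmx k2 Phi) x).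
    exact: (smx_mxd k1 (smx_dmx oD k2 sPhi) Dx).
  apply: (mxd_unique E) => a' b'.
  have d1 : mxd x (ev R k1) (fun y => A y *m Emat R k2) (dmx k1 A x *m Emat R k2).
    have := mxdM (smx_mxd k1 sA Dx) (mxd_cst x (ev R k1) (Emat R k2 : 'M[R]_n)).
    by rewrite mulmx0 addr0.
  have := mxdM d1 (smx_mxd k1 sU Dx) a' b'.
  by apply: near_eq_is_derive; apply: near_openW Dx _ => // y Dy; rewrite dPhi.
have := dmx_sym oD i j sPhi Dx; rewrite !dd => /(congr1 (mulmx (A x)^T)).
rewrite !mulmxDr !mulmxA (AA Dx) !mul1mx -/(Gam i x) -/(Gam j x) => /matrixP/(_ b l).
rewrite [LHS]mxE [RHS]mxE -!mulmxA !EmxE.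
have GE i' j' : ((A x)^T *m (dmx i' A x *m (Emat R j' *m U x))) b l = Gam i' x b j' * U x j' l.
  rewrite mulmxA -/(Gam i' x) [LHS]mxE (bigD1 j')//= big1 ?addr0 ?EmxE ?eqxx// => c cj.
  by rewrite EmxE (negbTE cj) mulr0.
by rewrite !GE.
Qed.

(** For b different from i and j, [second_derivatives] makes a multiple of row j of [U] equal to a
    multiple of row i; these rows are independent. *)
Lemma Gam0 i x b j : D x -> b != i -> j != i -> Gam i x b j = 0.
Proof.
move=> Dx bi ji; have [->|bj] := eqVneq b j; first exact: Gam_diag.
have E l : Gam i x b j * U x j l = Gam j x b i * U x i l.
  by have := second_derivatives i j b l Dx; rewrite (negbTE bi) (negbTE bj) !addr0.
have inv a a' : \sum_l U x a l * invmx (U x) l a' = (a == a')%:R.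
  by have := mulmxV (uU Dx) => /matrixP/(_ a a'); rewrite !mxE.
(* Pairing with column j of U^-1 isolates the coefficient of row j. *)
have : \sum_l Gam i x b j * U x j l * invmx (U x) l j = \sum_l Gam j x b i * U x i l * invmx (U x) l j.
  by apply: eq_bigr => l _; rewrite E.
under eq_bigr do rewrite -mulrA.
under [RHS]eq_bigr do rewrite -mulrA.
by rewrite -!mulr_sumr !inv eqxx eq_sym (negbTE ji) mulr1 mulr0.
Qed.

Lemma F_diag x i : D x -> Fsol x i i = 0.
Proof. by move=> Dx; rewrite [LHS]mxE Gam_diag// mulr0. Qed.

Lemma Gam_omega i x : D x -> Gam i x = omega_form k Fsol i x.
Proof.
move=> Dx; apply/matrixP => a b; rewrite /omega_form [RHS]mxE [X in _ = X + _]mxE.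
rewrite mxEE mxJE [(_^T) a i]mxE -mulmxA EmxE JmxE ![Fsol x _ _]mxE.
have e (g : R) (c : 'I_n) : eps c * (- eps c * g) = - g by rewrite mulNr mulrN mulrA eps2 mul1r.
rewrite e [_ * eps i]mulrC e.
have [->|ai] := eqVneq a i; have [->|bi] := eqVneq b i; rewrite ?mulr1n ?mulr0n ?oppr0 ?opprK ?addr0 ?add0r.
- by rewrite Gam_diag// oppr0 addr0.
- by [].
- exact: Gam_skew.
- exact: Gam0.
Qed.

Lemma dU_off i j l x : D x -> j != i -> dmx i U x j l = - (eps j * Fsol x j i) * U x i l.
Proof.
move=> Dx ji; have := second_derivatives i j j l Dx.
rewrite eqxx (negbTE ji) mulr1n mulr0n addr0 Gam_diag// mul0r add0r => ->.
by rewrite [Fsol x j i]mxE (mulrA (eps j)) mulrN eps2 mulN1r opprK.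
Qed.

(** Mixed derivatives of Phi do not determine d_i U_il. It is obtained by differentiating the
    Guichard relation, inserting [dU_off] for the other terms and dividing by the nonzero U_il. *)
Lemma dU_diag i l x : D x -> dmx i U x i l = eps i * \sum_b Fsol x b i * U x b l.
Proof.
move=> Dx.
have d1 : is_derive x (ev R i) (fun y => \sum_j eps j * (U y j l * U y j l) : R^o)
    (\sum_j eps j * (U x j l * dmx i U x j l + U x j l * dmx i U x j l)).
  apply: is_derive_fsum => j.
  have d := smx_mxd i sU Dx j l.
  exact: (@is_deriveZ _ _ _ (fun y => U y j l * U y j l) (eps j) x (ev R i) _ (is_deriveM d d)).
have d0 : is_derive x (ev R i) (fun y => \sum_j eps j * (U y j l * U y j l) : R^o) 0.
  have := @is_derive_cst R 'rV[R]_n R^o 0 x (ev R i).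
  by apply: near_eq_is_derive; apply: near_openW Dx _ => // y Dy; rewrite gU.
have E : \sum_j eps j * (U x j l * dmx i U x j l + U x j l * dmx i U x j l) = 0.
  by rewrite -(is_deriveP d1) (is_deriveP d0).
have {}E : \sum_j eps j * (U x j l * dmx i U x j l) = 0.
  move: E; under eq_bigr do rewrite mulrDr.
  by rewrite big_split/= -mulr2n => /eqP; rewrite mulrn_eq0/= => /eqP.
move: E; rewrite (bigD1 i)//=.
have -> : \sum_(j | j != i) eps j * (U x j l * dmx i U x j l) =
    - (U x i l * \sum_b Fsol x b i * U x b l).
  rewrite [in RHS](bigD1 i)//= (F_diag i Dx) mul0r add0r mulr_sumr -sumrN.
  apply: eq_bigr => j ji; rewrite dU_off//.
  have := @eps2 R n k j; move: (eps j) (U x j l) (U x i l) (Fsol x j i) => e u v f ee.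
  by transitivity (- (e * e) * (v * (f * u))); [ring|rewrite ee mulN1r].
move=> /eqP; rewrite subr_eq0 mulrCA => /eqP /(mulfI (U_neq0 i l Dx)) <-.
by rewrite mulrA eps2 mul1r.
Qed.

Definition Vmx x : 'M[R]_n := - (J *m U x).

Lemma smx_V : smx D Vmx.
Proof. by apply: (smxN oD); apply: (smxM oD) => //; exact: smx_cst. Qed.

Lemma dV i x : D x -> dmx i Vmx x = - (tau_form k Fsol i x *m Vmx x).
Proof.
move=> Dx.
have d1 : mxd x (ev R i) Vmx (- (J *m dmx i U x)).
  have := mxdM (mxd_cst x (ev R i) J) (smx_mxd i sU Dx).
  by rewrite mul0mx add0r => /mxdN.
rewrite (mxd_unique (smx_mxd i smx_V Dx) d1) /Vmx mulmxN opprK.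
apply/matrixP => j l; rewrite [LHS]mxE JmxE /tau_form mulmxDl mulNmx [RHS]mxE [X in _ = X + _]mxE.
rewrite -!mulmxA (mulmxA J J) JJ mul1mx !EmxE.
have -> : (Fsol x *m (Emat R i *m U x)) j l = Fsol x j i * U x i l.
  rewrite mxE (bigD1 i)//= big1 ?addr0 ?EmxE ?eqxx// => c ci.
  by rewrite EmxE (negbTE ci) mulr0.
have -> : ((Fsol x)^T *m U x) i l = \sum_b Fsol x b i * U x b l.
  by rewrite mxE; apply: eq_bigr => b _; rewrite mxE.
have [->|ji] := eqVneq j i.
  by rewrite dU_diag// mulrA eps2 mul1r F_diag// mul0r addr0 mulr1n.
by rewrite dU_off// mulr0n oppr0 add0r mulNr mulrN opprK !mulrA eps2 mul1r.
Qed.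

Lemma Jtau_skew i x : (tau_form k Fsol i x)^T *m J + J *m tau_form k Fsol i x = 0.
Proof.
have -> : (tau_form k Fsol i x)^T = - (J *m Fsol x *m Emat R i) + J *m Emat R i *m (Fsol x)^T.
  by rewrite /tau_form linearD linearN/= !trmx_mul !trmxK JT Emat_tr !mulmxA.
rewrite /tau_form mulmxDl mulmxDr mulNmx mulmxN !mulmxA.
move: (J *m Fsol x *m Emat R i *m J) (J *m Emat R i *m (Fsol x)^T *m J) => P Q.
by rewrite addrA addrK addNr.
Qed.

Hypothesis scD : simply_connected D.
Context (b0 : 'rV[R]_n) (Db0 : D b0).

Definition C0mx := Vmx b0.

Lemma unit_J : J \in unitmx.
Proof. by have /mulmx1_unit[] := @JJ R n k. Qed.

Lemma unit_V x : D x -> Vmx x \in unitmx.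
Proof. by move=> Dx; rewrite /Vmx -scaleN1r unitmxZ ?unitrN1// unitmx_mul unit_J uU. Qed.

Lemma VJV x : D x -> (Vmx x)^T *m J *m Vmx x = C0mx^T *m J *m C0mx.
Proof.
move=> Dx; apply/matrixP => a b.
apply: (@partial0_on R n D oD scD (fun x => ((Vmx x)^T *m J *m Vmx x) a b)) => // y i Dy.
have dVy := smx_mxd i smx_V Dy.
have d1 : mxd y (ev R i) (fun y => (Vmx y)^T *m J) ((dmx i Vmx y)^T *m J).
  by have := mxdM (mxd_tr dVy) (mxd_cst y (ev R i) J); rewrite mulmx0 addr0.
have := mxdM d1 dVy a b.
have -> : (dmx i Vmx y)^T *m J *m Vmx y + (Vmx y)^T *m J *m dmx i Vmx y = 0.
  rewrite (dV i Dy); move: (tau_form k Fsol i y) (Jtau_skew i y) (Vmx y) => t ht v.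
  have -> : (- (t *m v))^T = - (v^T *m t^T) by rewrite raddfN /= trmx_mul.
  rewrite !mulNmx mulmxN -opprD.
  have -> : v^T *m t^T *m J *m v + v^T *m J *m (t *m v) = v^T *m (t^T *m J + J *m t) *m v.
    by rewrite mulmxDr mulmxDl !mulmxA.
  by rewrite ht mulmx0 mul0mx oppr0.
by rewrite mxE.
Qed.

(** This is C0 V^-1, rewritten by V^T J V = C0^T J C0. In this form it is linear in [V], so its
    smoothness is immediate. *)
Definition Bmx x := J *m (invmx C0mx)^T *m (Vmx x)^T *m J.

Lemma smx_B : smx D Bmx.
Proof.
apply: (smxM oD); last exact: smx_cst.
by apply: (smxM oD); [exact: smx_cst|apply: (smx_tr oD); exact: smx_V].
Qed.

Lemma BV x : D x -> Bmx x *m Vmx x = C0mx.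
Proof.
move=> Dx.
have -> : Bmx x *m Vmx x = J *m (invmx C0mx)^T *m ((Vmx x)^T *m J *m Vmx x).
  by rewrite /Bmx; move: (Vmx x) => v; rewrite !mulmxA.
rewrite (VJV Dx); have := unit_V Db0; rewrite -/C0mx; move: C0mx => c uc.
have -> : J *m (invmx c)^T *m (c^T *m J *m c) = J *m (c *m invmx c)^T *m J *m c.
  by rewrite trmx_mul !mulmxA.
by rewrite mulmxV// trmx1 mulmx1 JJ mul1mx.
Qed.

Lemma BJB x : D x -> (Bmx x)^T *m J *m Bmx x = J.
Proof.
move=> Dx; have uV := unit_V Dx.
have E : (Vmx x)^T *m ((Bmx x)^T *m J *m Bmx x) *m Vmx x = (Vmx x)^T *m J *m Vmx x.
  by rewrite (VJV Dx) -(BV Dx) (trmx_mul (Bmx x) (Vmx x)) !mulmxA.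
move: uV E; move: (Vmx x) ((Bmx x)^T *m J *m Bmx x) => v w uv E.
have := congr1 (fun M => invmx v^T *m M *m invmx v) E => /=.
rewrite -!mulmxA !mulmxV// !mulmx1 !mulmxA !mulVmx ?unitmx_tr// !mul1mx.
by [].
Qed.

Lemma dB i x : D x -> dmx i Bmx x = Bmx x *m tau_form k Fsol i x.
Proof.
move=> Dx; have uV := unit_V Dx.
have d1 : mxd x (ev R i) (fun y => Bmx y *m Vmx y) (dmx i Bmx x *m Vmx x + Bmx x *m dmx i Vmx x).
  by apply: mxdM; [exact: (smx_mxd i smx_B Dx)|exact: (smx_mxd i smx_V Dx)].
have d0 : mxd x (ev R i) (fun y => Bmx y *m Vmx y) 0.
  move=> a b; have := mxd_cst x (ev R i) C0mx a b.
  by apply: near_eq_is_derive; apply: near_openW Dx _ => // y Dy; rewrite BV.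
have := mxd_unique d1 d0; rewrite (dV i Dx).
exact: (transport_derivative uV).
Qed.

Definition Ymx x := Phi x *m invmx C0mx.

Lemma smx_Y : smx D Ymx.
Proof. by apply: (smxM oD) => //; exact: smx_cst. Qed.

Lemma YC x : Ymx x *m C0mx = Phi x.
Proof. by rewrite /Ymx mulmxKV// unit_V. Qed.

Lemma dY i x : D x -> dmx i Ymx x = - (A x *m Emat R i *m (Bmx x)^T *m J).
Proof.
move=> Dx.
have d1 : mxd x (ev R i) Ymx (dmx i Phi x *m invmx C0mx).
  by have := mxdM (smx_mxd i sPhi Dx) (mxd_cst x (ev R i) (invmx C0mx)); rewrite mulmx0 addr0.
rewrite (mxd_unique (smx_mxd i smx_Y Dx) d1) (dPhi i Dx).
exact: (potential_derivative (A x) (Emat R i) (BV Dx) (BJB Dx) erefl (unit_V Db0)).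
Qed.

End Core.

(** * Smoothness of matrix-valued maps compared with smoothness of their entries *)

Section SmoothMx.
Context {R : realType} {n : nat} (D : set 'rV[R]_n) (oD : open D).

Lemma iter_partial_rcons (V : normedModType R) s i (f : 'rV[R]_n -> V) :
  iter_partial (rcons s i) f = iter_partial s (partial i f).
Proof. by elim: s => //= j s ->. Qed.

Lemma smooth_on_sm (f : 'rV[R]_n -> R^o) : smooth_on D f -> sm D f.
Proof.
move=> H m; elim: m f H => [|m IH] f H; first by move=> x Dx; case: (H [::] x Dx).
split=> [x Dx|i]; first exact: (H [::] x Dx).
by apply: IH => s x Dx; have := H (rcons s i) x Dx; rewrite iter_partial_rcons.
Qed.

Lemma sm_iter_partial s (f : 'rV[R]_n -> R^o) : sm D f -> sm D (iter_partial s f).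
Proof. by move=> sf; elim: s => //= i s IH; exact: sm_partial. Qed.

Lemma mx_continuous {p q} (M : 'rV[R]_n -> 'M[R]_(p, q)) x :
  (forall a b, {for x, continuous (fun y => M y a b : R^o)}) -> {for x, continuous M}.
Proof.
move=> H A /nbhs_ballP[e /= e0 eA].
have e20 : 0 < e / 2 by rewrite divr_gt0.
have ex (ab : 'I_p * 'I_q) : exists r : {posnum R}, forall y, `|y - x| < r%:num ->
    `|M y ab.1 ab.2 - M x ab.1 ab.2| <= e / 2.
  by have [r r0 Hr] := cont_ball e20 (H ab.1 ab.2); exists (PosNum r0).
have [F HF] := choice ex.
have m0 : 0 < \big[Num.min/1]_ab (F ab)%:num by apply: lt_bigmin.
apply: (nbhs_rV m0) => y yr; apply: eA; rewrite -ball_normE/=.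
rewrite distrC; apply: (@le_lt_trans _ _ (e / 2)); last first.
  by rewrite ltr_pdivrMr// ltr_pMr// ltr1n.
rewrite /Num.Def.normr/= mx_normrE; apply: bigmax_le => [|[a b] _]; first exact: ltW.
rewrite !mxE; apply: (HF (a, b)); apply: (lt_le_trans yr); exact: bigmin_le.
Qed.

Lemma smooth_on_smx {p q} (F : 'rV[R]_n -> 'M[R]_(p, q)) : smooth_on D F -> smx D F.
Proof.
move=> H a b.
(* Iterated partials of the map and of an entry are compared on [D] only, where the derivatives are
   known to exist. *)
have claim s x : D x -> iter_partial s F x a b = iter_partial s (fun y => F y a b : R^o) x.
  elim: s x => //= i s IH x Dx.
  have [_ /(_ i) dF] := H s x Dx.
  by rewrite /partial derive_mx// mxE; apply: (eq_partial oD i Dx) => y Dy; exact: IH.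
apply: smooth_on_sm => s x Dx; split.
  apply: (continuous_eq_open oD Dx (fun y Dy => claim s y Dy)).
  apply: (@continuous_comp _ _ _ (iter_partial s F) (fun M : 'M[R]_(p, q) => M a b : R^o)).
    by case: (H s x Dx).
  exact: coord_continuous.
move=> i; apply: (eq_derivable oD Dx (fun y Dy => claim s y Dy)).
by apply: (derivable_mxP _ _ _).1; case: (H s x Dx).
Qed.

Lemma smx_smooth_on {p q} (F : 'rV[R]_n -> 'M[R]_(p, q)) : smx D F -> smooth_on D F.
Proof.
move=> sF.
have claim s x : D x -> forall a b, iter_partial s F x a b = iter_partial s (fun y => F y a b : R^o) x.
  elim: s x => //= i s IH x Dx a b.
  rewrite /partial derive_mx ?mxE; first by apply: (eq_partial oD i Dx) => y Dy; exact: IH.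
  apply/derivable_mxP => a' b'.
  apply: (eq_derivable oD Dx (fun y Dy => esym (IH y Dy a' b'))).
  by case: (sm_derive i (sm_iter_partial s (sF a' b')) Dx).
move=> s x Dx; split.
  apply: mx_continuous => a b.
  apply: (continuous_eq_open oD Dx (fun y Dy => esym (claim s y Dy a b))).
  exact: sm_cont (sm_iter_partial s (sF a b)) Dx.
move=> i; apply/derivable_mxP => a b.
apply: (eq_derivable oD Dx (fun y Dy => esym (claim s y Dy a b))).
by case: (sm_derive i (sm_iter_partial s (sF a b)) Dx).
Qed.

Lemma smx_partialE {p q} (F : 'rV[R]_n -> 'M[R]_(p, q)) i x : smx D F -> D x ->
  partial i F x = dmx i F x.
Proof. by move=> sF Dx; apply: is_deriveP; apply: mxd_partial; exact: smx_mxd. Qed.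

End SmoothMx.

(** * The common orthonormal frame of a Combescure sequence *)

Section Frame.
Context {R : realType} {n : nat}.

Lemma edotE (v w : 'cV[R]_n) : edot v w = \sum_a v a 0 * w a 0.
Proof. by rewrite /edot mxE; apply: eq_bigr => a _; rewrite mxE. Qed.

Lemma edot_gt0 (v : 'cV[R]_n) : v != 0 -> 0 < edot v v.
Proof.
move=> v0; rewrite edotE lt_def sumr_ge0 ?andbT => [|a _]; last by rewrite -expr2 sqr_ge0.
apply: contra v0; rewrite psumr_eq0 => [/allP H|a _]; last by rewrite -expr2 sqr_ge0.
apply/eqP/matrixP => a b; rewrite ord1 mxE; apply/eqP.
by have := H a (mem_index_enum a); rewrite mulf_eq0 orbb.
Qed.

End Frame.

(** The metric fields [u] carry no smoothness and no sign. So [A] normalises the partials of phi_1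
    by a square root, [U] is defined by inner products, and [u] is used only pointwise, to prove the
    algebraic identities. *)
Lemma frame_exists (R : realType) (n k : nat) (hn : (2 <= n)%N)
  (D : set 'rV[R]_n) (phi : nat -> 'rV[R]_n -> 'cV[R]_n) :
  open D -> combescure_seq k D phi ->
  let Phi x := \matrix_(a < n, l < n) phi l.+1 x a 0 in
  exists A U : 'rV[R]_n -> 'M[R]_n,
  [/\ smx D Phi, smx D A, smx D U & forall x, D x ->
    [/\ (A x)^T *m A x = 1%:M, forall j, dmx j Phi x = A x *m Emat R j *m U x,
      U x \in unitmx, forall l, \sum_j eps k j * (U x j l * U x j l) = 0 &
      forall j l, U x j l != 0]].
Proof.
move=> oD [Hg [_ [u [mf [par fu]]]]] Phi.
have n1 : (1 <= 1 <= n)%N by rewrite (leq_trans _ hn).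
have ln (l : 'I_n) : (1 <= l.+1 <= n)%N by rewrite ltn_ord.
have sphi (l : nat) : (1 <= l <= n)%N -> smx D (phi l).
  by move=> hl; have [[sp _] _] := Hg l hl; exact: (smooth_on_smx oD sp).
have sPhi : smx D Phi.
  move=> a l; apply: (eq_sm oD _ (sphi _ (ln l) a 0)) => y _; by rewrite mxE.
pose q j x := edot (dmx j (phi 1%N) x) (dmx j (phi 1%N) x).
pose r j x := (Num.sqrt (q j x))^-1.
have dphiE l j x : (1 <= l <= n)%N -> D x -> partial j (phi l) x = dmx j (phi l) x.
  by move=> hl Dx; exact: (smx_partialE j (sphi l hl) Dx).
have q0 j x : D x -> 0 < q j x.
  move=> Dx; apply: edot_gt0; rewrite -(dphiE _ _ _ n1 Dx).
  by have [[_ H] _] := Hg 1%N n1; exact: (H x Dx).1 j.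
have sd1 j a : sm D (fun x => dmx j (phi 1%N) x a 0) by exact: (smx_dmx oD j (sphi _ n1)).
have sr j : sm D (r j).
  apply: (sm_invsqrt oD); last exact: q0.
  apply: (eq_sm oD (f := fun x => \sum_a dmx j (phi 1%N) x a 0 * dmx j (phi 1%N) x a 0)).
    by move=> y _; rewrite /q edotE.
  by apply: sm_sum => // a _; apply: smM.
pose A x : 'M[R]_n := \matrix_(a, j) (r j x * dmx j (phi 1%N) x a 0).
pose U x : 'M[R]_n := \matrix_(j, l) \sum_a A x a j * dmx j (phi l.+1) x a 0.
have sA : smx D A.
  move=> a j; apply: (eq_sm oD (f := fun x => r j x * dmx j (phi 1%N) x a 0)).
    by move=> y _; rewrite [RHS]mxE.
  exact: smM.
have sU : smx D U.
  move=> j l; apply: (eq_sm oD (f := fun x => \sum_a A x a j * dmx j (phi l.+1) x a 0)).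
    by move=> y _; rewrite [RHS]mxE.
  apply: sm_sum => // a _; apply: smM => //; exact: (smx_dmx oD j (sphi _ (ln l))).
exists A, U; split => // x Dx.
have mfx l i j : (1 <= l <= n)%N -> edot (dmx i (phi l) x) (dmx j (phi l) x) =
    (if i == j then (u l x i 0) ^+ 2 else 0).
  by move=> hl; rewrite -!dphiE//; exact: mf.
have q0x j := q0 j x Dx.
have r2q j : r j x * r j x * q j x = 1.
  rewrite /r -invfM -expr2 sqr_sqrtr ?(ltW (q0x j))// mulVf// gt_eqF//.
have rn0 j : r j x != 0 by rewrite invr_eq0 gt_eqF// sqrtr_gt0.
have un0 l j : (1 <= l <= n)%N -> u l x j 0 != 0.
  move=> hl; have : dmx j (phi l) x != 0.
    by rewrite -dphiE//; have [[_ H] _] := Hg l hl; exact: (H x Dx).1 j.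
  by move=> /edot_gt0; rewrite mfx// eqxx => /lt0r_neq0; rewrite sqrf_eq0.
have qu j : q j x = u 1%N x j 0 ^+ 2 by rewrite /q mfx// eqxx.
(* The choice of the metric fields in the sequence makes the j-th partials of phi_(l+1) and phi_1
   proportional with this ratio. *)
pose t (l : 'I_n) j := u l.+1 x j 0 / u 1%N x j 0.
have tphi (l : 'I_n) j : dmx j (phi l.+1) x = t l j *: dmx j (phi 1%N) x.
  have := par l.+1 j x (ln l) Dx; rewrite !dphiE// => /(congr1 (fun v => u l.+1 x j 0 *: v)).
  by rewrite !scalerA mulfV ?un0// scale1r.
have scE (l : 'I_n) j a : (t l j *: dmx j (phi 1%N) x) a 0 = t l j * dmx j (phi 1%N) x a 0 by rewrite [LHS]mxE.
have UE j l : U x j l = r j x * t l j * q j x.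
  rewrite [LHS]mxE tphi /q edotE mulr_sumr; apply: eq_bigr => a _.
  by rewrite [A x a j]mxE scE mulrACA.
have tn0 l j : t l j != 0 by rewrite mulf_neq0 ?invr_eq0 ?un0.
have qn0 j : q j x != 0 by rewrite gt_eqF.
have Un0 j l : U x j l != 0.
  by rewrite UE; apply: mulf_neq0 (qn0 j); apply: mulf_neq0 (tn0 l j); exact: rn0.
have UU j l : U x j l * U x j l = u l.+1 x j 0 ^+ 2.
  rewrite UE; transitivity (r j x * r j x * q j x * (t l j * t l j * q j x)); first by ring.
  by rewrite r2q mul1r qu /t; field; rewrite un0.
split => //.
- apply/matrixP => i j; rewrite [LHS]mxE [RHS]mxE.
  transitivity (r i x * r j x * edot (dmx i (phi 1%N) x) (dmx j (phi 1%N) x)).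
    rewrite edotE mulr_sumr; apply: eq_bigr => a _.
    by rewrite [(_^T) i a]mxE [A x a i]mxE [A x a j]mxE mulrACA.
  rewrite mfx//; have [->|ij] := eqVneq i j; last by rewrite mulr0.
  by rewrite -qu r2q.
- move=> j; apply/matrixP => a l.
  have -> : (A x *m Emat R j *m U x) a l = A x a j * U x j l.
    rewrite [LHS]mxE (bigD1 j)//= big1 ?addr0 ?mxEE ?eqxx// => c cj.
    by rewrite mxEE (negbTE cj) mul0r.
  rewrite [LHS]mxE UE [A x a j]mxE.
  have -> : partial j (fun y => Phi y a l : R^o) x = dmx j (phi l.+1) x a 0.
    by rewrite [RHS]mxE; apply: (eq_partial oD j Dx) => y _; rewrite mxE.
  rewrite tphi scE; transitivity (r j x * r j x * q j x * (t l j * dmx j (phi 1%N) x a 0)).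
    by rewrite r2q mul1r.
  by ring.
(* d_j is the sign |u_1j| / u_1j; up to these signs on its rows, [U] is the transposed matrix of
   metric fields. *)
- pose d : 'rV[R]_n := \row_j (r j x * q j x / u 1%N x j 0).
  have -> : U x = diag_mx d *m (\matrix_(i < n) (u i.+1 x)^T)^T.
    apply/matrixP => j l; rewrite UE mul_diag_mx !mxE /t; ring.
  rewrite unitmx_mul unitmx_tr -[X in _ && X]row_free_unit fu// andbT.
  rewrite unitmxE det_diag unitfE; apply/prodf_neq0 => j _.
  by rewrite mxE; apply: mulf_neq0; [exact: mulf_neq0 (rn0 j) (qn0 j)|rewrite invr_eq0; exact: un0].
(* The Guichard condition comes with a metric field of its own; only squares occur, and those are
   fixed by the map. *)
- move=> l; have [_ [u' [mf' gu]]] := Hg l.+1 (ln l).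
  have W j : U x j l * U x j l = u' x j 0 ^+ 2.
    rewrite UU; have := mf' x Dx j j; rewrite eqxx => <-.
    by rewrite dphiE// mfx// eqxx.
  rewrite (bigID (fun j : 'I_n => (j < n - k)%N))/=.
  have := gu x Dx => G.
  have -> : \sum_(j < n | (j < n - k)%N) eps k j * (U x j l * U x j l) =
     \sum_(i < n | (i < n - k)%N) u' x i 0 ^+ 2.
    by apply: eq_bigr => j jk; rewrite /eps jk mul1r W.
  have -> : \sum_(j < n | ~~ (j < n - k)%N) eps k j * (U x j l * U x j l) =
     - \sum_(i < n | (n - k <= i)%N) u' x i 0 ^+ 2.
    rewrite -sumrN; apply: eq_big => [j|j jk]; first by rewrite -leqNgt.
    by rewrite /eps (negbTE jk) mulN1r W.
  by rewrite G subrr.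
Qed.

(** * Values, symmetries and complex derivative of the power series *)

Section PCmore.
Context {R : realType}.
Implicit Types (u v : nat -> R) (l h : R[i]).
Local Notation Re := (@complex.Re R).
Local Notation Im := (@complex.Im R).
Local Notation normc := (@ComplexField.Normc.normc R).

Lemma Ser0 : Ser (fun _ => 0 : R) = 0.
Proof.
apply/eqP; rewrite -normr_le0 -[leRHS](mul0r (expR 0)); apply: Ser_le => // m.
by rewrite normr0 mul0r.
Qed.

Lemma PC_cst u l : entire_seq u -> (forall m, u m.+1 = 0) -> PC u l = (u 0%N)%:C%C.
Proof.
move=> su u0.
have tail (L : R[i] -> R) : Ser (fun m => u m.+1 * L (l ^+ m.+1)) = 0.
  by rewrite -Ser0; congr Ser; apply/funext => m; rewrite u0 mul0r.
rewrite /PC /PR /PI /PL (Ser_recl (entire_seq_pow (@ler_Re_normc R) l su)).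
rewrite (Ser_recl (entire_seq_pow (@ler_Im_normc R) l su)) !tail !addr0 expr0 /=.
by rewrite mulr1 mulr0.
Qed.

Lemma PC_0 u : entire_seq u -> PC u 0 = (u 0%N)%:C%C.
Proof.
move=> su.
have tail (L : R[i] -> R) : L 0 = 0 -> Ser (fun m => u m.+1 * L (0 ^+ m.+1)) = 0.
  by move=> L0; rewrite -Ser0; congr Ser; apply/funext => m; rewrite exprS mul0r L0 mulr0.
rewrite /PC /PR /PI /PL (Ser_recl (entire_seq_pow (@ler_Re_normc R) 0 su)).
rewrite (Ser_recl (entire_seq_pow (@ler_Im_normc R) 0 su)) !tail// !addr0 expr0 /=.
by rewrite mulr1 mulr0.
Qed.

Lemma entire_seq0 : entire_seq (fun _ => 0 : R).
Proof. by exists 0, 0; split => // m; rewrite normr0 mul0r. Qed.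

Lemma entire_seq_sum (I : Type) (s : seq I) (f : I -> nat -> R) (a : I -> R) :
  (forall c, entire_seq (f c)) -> entire_seq (fun m => \sum_(c <- s) f c m * a c).
Proof.
move=> Hf; elim: s => [|c s IH].
  by have := entire_seq0; congr entire_seq; apply/funext => m; rewrite big_nil.
have := entire_seqD (entire_seqZ (a c) (Hf c)) IH.
by congr entire_seq; apply/funext => m; rewrite big_cons; congr (_ + _); exact: mulrC.
Qed.

Lemma PC_sum (I : Type) (s : seq I) (f : I -> nat -> R) (a : I -> R) l :
  (forall c, entire_seq (f c)) ->
  PC (fun m => \sum_(c <- s) f c m * a c) l = \sum_(c <- s) PC (f c) l * (a c)%:C%C.
Proof.
move=> Hf; elim: s => [|c s IH].
  have -> : (fun m => \sum_(c <- [::]) f c m * a c) = (fun _ => 0 : R).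
    by apply/funext => m; rewrite big_nil.
  by rewrite PC_cst ?big_nil//; exact: entire_seq0.
have -> : (fun m => \sum_(d <- c :: s) f d m * a d) =
    (fun m => a c * f c m + \sum_(d <- s) f d m * a d).
  by apply/funext => m; rewrite big_cons; congr (_ + _); exact: mulrC.
rewrite big_cons PCD; [|exact: entire_seqZ|exact: entire_seq_sum].
by rewrite PCZ// IH; congr (_ + _); exact: mulrC.
Qed.

Lemma ReIm_conj l : Re (l^*)%R = Re l /\ Im (l^*)%R = - Im l.
Proof. by case: l. Qed.

Lemma PC_conj u l : entire_seq u -> PC u (l^*)%R = ((PC u l)^*)%R.
Proof.
move=> su.
have cX m : (l^*)%R ^+ m = ((l ^+ m)^*)%R by rewrite rmorphXn.
have ER : PR u (l^*)%R = PR u l.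
  by rewrite /PR /PL; congr Ser; apply/funext => m; rewrite cX (ReIm_conj _).1.
have EI : PI u (l^*)%R = - PI u l.
  rewrite /PI /PL -[RHS]mulN1r -(SerZ (-1) (entire_seq_pow (@ler_Im_normc R) l su)).
  by congr Ser; apply/funext => m; rewrite cX (ReIm_conj _).2 mulrN mulN1r.
apply/eqP; rewrite eq_complex; apply/andP; split; apply/eqP.
  by rewrite (ReIm_conj _).1.
by rewrite (ReIm_conj _).2.
Qed.

Lemma PC_opp u l : PC u (- l) = PC (fun m => (-1) ^+ m * u m) l.
Proof.
have oX (L : R[i] -> R) : (forall z, L (- z) = - L z) ->
    PL L u (- l) = PL L (fun m => (-1) ^+ m * u m) l.
  move=> LN; rewrite /PL; congr Ser; apply/funext => m.
  have -> : L ((- l) ^+ m) = (-1) ^+ m * L (l ^+ m).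
    rewrite [(- l) ^+ m]exprNn; move: (l ^+ m) => z; elim: m => [|m IH]; first by rewrite !expr0 !mul1r.
    by rewrite !exprS !mulN1r !mulNr LN IH.
  by rewrite mulrCA mulrA.
by rewrite /PC /PR /PI !oX; [|exact: cImN|exact: cReN].
Qed.

Lemma norm_ReIm (z : R[i]) : `|z| <= (`|Re z| + `|Im z|)%:C%C.
Proof.
have {1}-> : z = (Re z)%:C%C + ('i * (Im z)%:C)%C by exact: complexE.
apply: (le_trans (ler_normD _ _)).
rewrite normrM !normc_norm /= -!rmorphM -rmorphD lecR expr0n expr1n/= !add0r sqrtr1 mul1r.
by rewrite !addr0 !sqrtr_sqr.
Qed.

Lemma PC_quad u l : entire_seq u -> exists2 c : R, 0 <= c & forall h : R[i], `|h| < 1 ->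
  `|PC u (h + l) - PC u l - h * PC (deriv_seq u) l| <= c%:C%C * `|h| ^+ 2.
Proof.
case=> K [C [K0 C0 H]]; pose rho : R := normc l + 1.
have rho1 : 1 <= rho by rewrite /rho lerDr normc_ge0.
have lr : normc l <= rho by rewrite lerDl.
pose c := K * expR (C * (4 * rho)).
have c0 : 0 <= c by rewrite mulr_ge0// expR_ge0.
(* One [c] for the real part and one for the imaginary part. *)
exists (c + c) => [|h]; first exact: addr_ge0.
rewrite normc_norm -(rmorph1 (real_complex R)) ltcR => h1.
have lhr : normc (l + h) <= rho.
  by apply: (le_trans (normc_triangle _ _)); rewrite lerD2l ltW.
apply: (le_trans (norm_ReIm _)).
rewrite -rmorphXn -rmorphM lecR mulrDl [h + l]addrC !cReB !cImB.
apply: lerD; rewrite /c mulrAC; [exact: PR_deriv_le|exact: PI_deriv_le].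
Qed.

End PCmore.

Lemma mx_norm_le {K : numFieldType} {p q} (N : 'M[K]_(p, q)) (c : K) : 0 <= c ->
  (forall a b, `|N a b| <= c) -> `|N| <= c.
Proof.
move=> /nonnegP[{}c] H; rewrite /Num.Def.normr/= mx_normE num_le; apply/bigmax_leP; split.
  by rewrite -num_le/=.
by case=> a b _; rewrite -num_le/=; exact: H.
Qed.

Lemma PC_mx_derive {R : realType} {p q} (u : 'I_p -> 'I_q -> nat -> R) (l : R[i]) :
  (forall a b, entire_seq (u a b)) ->
  is_derive (l : R[i]^o) (1 : R[i]^o) (fun l : R[i]^o => (\matrix_(a, b) PC (u a b) l : 'M[R[i]]_(p, q)))
    (\matrix_(a, b) PC (deriv_seq (u a b)) l).
Proof.
move=> Hu.
have ex (ab : 'I_p * 'I_q) : exists c : R, 0 <= c /\ forall h : R[i], `|h| < 1 ->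
  `|PC (u ab.1 ab.2) (h + l) - PC (u ab.1 ab.2) l - h * PC (deriv_seq (u ab.1 ab.2)) l| <= c%:C%C * `|h| ^+ 2.
  by have [c c0 Hc] := PC_quad l (Hu ab.1 ab.2); exists c.
have [c Hc] := choice ex.
have S0 : 0 <= \sum_ab c ab by apply: sumr_ge0 => ab _; exact: (Hc ab).1.
apply: (is_derive_quad (e := 1) (C := (\sum_ab c ab)%:C%C)) => //; first by rewrite ler0c.
move=> h h1; apply: mx_norm_le; first by rewrite mulr_ge0 ?ler0c// exprn_ge0.
move=> a b; rewrite !mxE [h *: (1 : R[i]^o)]mulr1.
apply: (le_trans ((Hc (a, b)).2 h h1)); rewrite ler_wpM2r ?exprn_ge0// lecR.
by rewrite (bigD1 (a, b))//= lerDl; apply: sumr_ge0 => ab _; exact: (Hc ab).1.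
Qed.

(** * Real directional derivatives of complex matrix-valued maps *)

Section CMD.
Context {R : realType} {n : nat}.
Local Notation Re := (@complex.Re R).
Local Notation Im := (@complex.Im R).
Implicit Types (x : 'rV[R]_n).

Definition cpd i x (z : 'rV[R]_n -> R[i]) (z' : R[i]) :=
  is_derive x (ev R i) (fun y => Re (z y) : R^o) (Re z') /\
  is_derive x (ev R i) (fun y => Im (z y) : R^o) (Im z').

Lemma cpd_cst i x (z : R[i]) : cpd i x (fun _ => z) 0.
Proof. by split; exact: is_derive_cst. Qed.

Lemma cpdD i x z w z' w' : cpd i x z z' -> cpd i x w w' -> cpd i x (fun y => z y + w y) (z' + w').
Proof.
move=> [zr zi] [wr wi]; split.
  rewrite cReD; have := is_deriveD zr wr.
  by congr is_derive; apply/funext => y; rewrite cReD.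
rewrite cImD; have := is_deriveD zi wi.
by congr is_derive; apply/funext => y; rewrite cImD.
Qed.

Lemma cpdM i x z w z' w' : cpd i x z z' -> cpd i x w w' ->
  cpd i x (fun y => z y * w y) (z' * w x + z x * w').
Proof.
move=> [zr zi] [wr wi]; split.
  have := is_deriveB (is_deriveM zr wr) (is_deriveM zi wi).
  have -> : Re (z x) *: Re w' + Re (w x) *: Re z' - (Im (z x) *: Im w' + Im (w x) *: Im z') =
      Re (z' * w x + z x * w').
    by rewrite cReD !cReM /GRing.scale/=; ring.
  by congr is_derive; apply/funext => y; rewrite cReM.
have := is_deriveD (is_deriveM zr wi) (is_deriveM zi wr).
have -> : Re (z x) *: Im w' + Im (w x) *: Re z' + (Im (z x) *: Re w' + Re (w x) *: Im z') =
    Im (z' * w x + z x * w').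
  by rewrite cImD !cImM /GRing.scale/=; ring.
by congr is_derive; apply/funext => y; rewrite cImM.
Qed.

Lemma cpd_sum i x (I : Type) (s : seq I) (f : I -> 'rV[R]_n -> R[i]) (df : I -> R[i]) :
  (forall c, cpd i x (f c) (df c)) -> cpd i x (fun y => \sum_(c <- s) f c y) (\sum_(c <- s) df c).
Proof.
move=> H; elim: s => [|c s IH].
  by rewrite big_nil; have := cpd_cst i x 0; congr cpd; apply/funext => y; rewrite big_nil.
by rewrite big_cons; have := cpdD (H c) IH; congr cpd; apply/funext => y; rewrite big_cons.
Qed.

Definition cmd {p q} i x (M : 'rV[R]_n -> 'M[R[i]]_(p, q)) (M' : 'M[R[i]]_(p, q)) :=
  forall a b, cpd i x (fun y => M y a b) (M' a b).

Lemma cmdM {p q r} i x (M : 'rV[R]_n -> 'M[R[i]]_(p, q)) (N : 'rV[R]_n -> 'M[R[i]]_(q, r)) M' N' :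
  cmd i x M M' -> cmd i x N N' -> cmd i x (fun y => M y *m N y) (M' *m N x + M x *m N').
Proof.
move=> HM HN a b; rewrite [X in cpd _ _ _ X]mxE [X in cpd _ _ _ (X + _)]mxE [X in cpd _ _ _ (_ + X)]mxE -big_split/=.
have := cpd_sum (index_enum _) (fun c => cpdM (HM a c) (HN c b)).
by congr cpd; apply/funext => y; rewrite mxE.
Qed.

Lemma cmd_tr {p q} i x (M : 'rV[R]_n -> 'M[R[i]]_(p, q)) M' : cmd i x M M' ->
  cmd i x (fun y => (M y)^T) M'^T.
Proof.
by move=> H a b; rewrite mxE; have := H b a; congr cpd; apply/funext => y; rewrite mxE.
Qed.

Lemma cmd_cst {p q} i x (M : 'M[R[i]]_(p, q)) : cmd i x (fun _ => M) 0.
Proof. by move=> a b; rewrite mxE; exact: cpd_cst. Qed.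

Lemma cmd_cpartial {p q} i x (M : 'rV[R]_n -> 'M[R[i]]_(p, q)) M' : cmd i x M M' ->
  cpartial i M x = M'.
Proof.
move=> H; apply/matrixP => a b; rewrite mxE; have [Hr Hi] := H a b.
apply/eqP; rewrite eq_complex/=; apply/andP; split; apply/eqP.
  exact: is_deriveP Hr.
exact: is_deriveP Hi.
Qed.

(** The joint derivative of [PL_partial_x], restricted to a fixed lambda. *)
Lemma PL_partial (D : set 'rV[R]_n) (L : R[i] -> R) (f : nat -> 'rV[R]_n -> R^o) i x l :
  (forall z, `|L z| <= @ComplexField.Normc.normc R z) -> entire_family D f -> D x ->
  is_derive x (ev R i) (fun y => PL L (f ^~ y) l : R^o) (PL L ((fun m => partial i (f m)) ^~ x) l).
Proof.
move=> L_le Ef Dx.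
(* The point with coordinates (x, Re l, Im l). *)
pose p : 'rV[R]_(n + 2) := row_mx x (\row_j (if j == 0 then Re l else Im l)).
have xp : xpart p = x by apply/rowP => j; rewrite mxE row_mxEl.
have lp : lpart p = l.
  by rewrite /lpart !row_mxEr !mxE /=; case: (l).
have Dp : DC D p by rewrite /DC/= xp.
have := (is_derive_line _ _ _ _).1 (PL_partial_x L_le i Ef Dp).
rewrite xp lp => H; apply: (is_derive_line _ _ _ _).2.
by move: H; congr is_derive; apply/funext => h; rewrite xpartD lpart_x xp lp.
Qed.

Lemma cmd_const (D : set 'rV[R]_n) (oD : open D) (scD : simply_connected D) {p q}
    (M : 'rV[R]_n -> 'M[R[i]]_(p, q)) x y :
  (forall i x, D x -> cmd i x M 0) -> D x -> D y -> M x = M y.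
Proof.
move=> H Dx Dy; apply/matrixP => a b; apply/eqP; rewrite eq_complex; apply/andP; split; apply/eqP.
  apply: (partial0_on oD scD (f := fun y => Re (M y a b))) => // z i Dz.
  by have [] := H i z Dz a b; rewrite mxE.
apply: (partial0_on oD scD (f := fun y => Im (M y a b))) => // z i Dz.
by have [] := H i z Dz a b; rewrite mxE.
Qed.

End CMD.

Lemma mxd_block {R : realType} {V : normedModType R} {p1 p2 q1 q2} (x v : V)
   (M1 : V -> 'M[R]_(p1, q1)) (M2 : V -> 'M[R]_(p1, q2)) (M3 : V -> 'M[R]_(p2, q1))
   (M4 : V -> 'M[R]_(p2, q2)) N1 N2 N3 N4 :
  mxd x v M1 N1 -> mxd x v M2 N2 -> mxd x v M3 N3 -> mxd x v M4 N4 ->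
  mxd x v (fun y => block_mx (M1 y) (M2 y) (M3 y) (M4 y)) (block_mx N1 N2 N3 N4).
Proof.
move=> H1 H2 H3 H4 a b; case: (split_ordP a) => i ->; case: (split_ordP b) => j ->.
- rewrite block_mxEul; have := H1 i j.
  by congr is_derive; apply/funext => y; rewrite block_mxEul.
- rewrite block_mxEur; have := H2 i j.
  by congr is_derive; apply/funext => y; rewrite block_mxEur.
- rewrite block_mxEdl; have := H3 i j.
  by congr is_derive; apply/funext => y; rewrite block_mxEdl.
- rewrite block_mxEdr; have := H4 i j.
  by congr is_derive; apply/funext => y; rewrite block_mxEdr.
Qed.

Lemma smx_block {R : realType} {n p1 p2 q1 q2} (D : set 'rV[R]_n) (oD : open D)
   (M1 : 'rV[R]_n -> 'M[R]_(p1, q1)) (M2 : 'rV[R]_n -> 'M[R]_(p1, q2))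
   (M3 : 'rV[R]_n -> 'M[R]_(p2, q1)) (M4 : 'rV[R]_n -> 'M[R]_(p2, q2)) :
  smx D M1 -> smx D M2 -> smx D M3 -> smx D M4 ->
  smx D (fun y => block_mx (M1 y) (M2 y) (M3 y) (M4 y)).
Proof.
move=> H1 H2 H3 H4 a b; case: (split_ordP a) => i ->; case: (split_ordP b) => j ->.
- by apply: (eq_sm oD _ (H1 i j)) => y _; rewrite block_mxEul.
- by apply: (eq_sm oD _ (H2 i j)) => y _; rewrite block_mxEur.
- by apply: (eq_sm oD _ (H3 i j)) => y _; rewrite block_mxEdl.
- by apply: (eq_sm oD _ (H4 i j)) => y _; rewrite block_mxEdr.
Qed.

Lemma cmxE {R : realType} {m p} (M : 'M[R]_(m, p)) : cmx M = map_mx (real_complex R) M.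
Proof. by []. Qed.

Lemma mxd_const {R : realType} {n p q} (D : set 'rV[R]_n) (oD : open D)
    (scD : simply_connected D) (M : 'rV[R]_n -> 'M[R]_(p, q)) x y :
  (forall i z, D z -> mxd z (ev R i) M 0) -> D x -> D y -> M x = M y.
Proof.
move=> H Dx Dy; apply/matrixP => a b.
apply: (partial0_on oD scD (f := fun y => M y a b)) => // z i Dz.
by have := H i z Dz a b; rewrite mxE.
Qed.

(** * The extended frame and its logarithmic derivative *)

Section Frame.
Context {R : realType} {n : nat} (k : nat) (D : set 'rV[R]_n) (oD : open D).
Context (scD : simply_connected D) (D0 : D 0).
Local Notation J := (@Jmat R n k).
Context (F A B Y : 'rV[R]_n -> 'M[R]_n).
Hypothesis sA : smx D A.
Hypothesis sB : smx D B.
Hypothesis sY : smx D Y.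
Hypothesis AA : forall x, D x -> (A x)^T *m A x = 1%:M.
Hypothesis BB : forall x, D x -> (B x)^T *m J *m B x = J.
Hypothesis dA : forall i x, D x -> dmx i A x = A x *m omega_form k F i x.
Hypothesis dB : forall i x, D x -> dmx i B x = B x *m tau_form k F i x.
Hypothesis dY : forall i x, D x -> dmx i Y x = - (A x *m Emat R i *m (B x)^T *m J).
Hypothesis Y0 : Y 0 = 0.

Definition Kmx x : 'M[R]_(n + n) := block_mx 0 (Y x) (- (J *m (Y x)^T)) 0.
Definition al i := dmx i Kmx.
Definition E0 x : 'M[R]_(n + n) := block_mx (A x) 0 0 (B x).
Definition th0 i x : 'M[R]_(n + n) :=
  block_mx (omega_form k F i x) 0 0 (tau_form k F i x).
Definition th1 i : 'M[R]_(n + n) := block_mx 0 (- (Emat R i *m J)) (Emat R i) 0.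
Definition Gre : 'M[R]_(n + n) := block_mx 1%:M 0 0 J.
Definition sre : 'M[R]_(n + n) := block_mx 1%:M 0 0 (- 1%:M).

Lemma smx_K : smx D Kmx.
Proof.
apply: (smx_block oD); [exact: smx_cst|exact: sY| |exact: smx_cst].
by apply: (smxN oD); apply: (smxM oD); [exact: smx_cst|exact: smx_tr].
Qed.

Lemma smx_E0 : smx D E0.
Proof.
by apply: (smx_block oD); [exact: sA|exact: smx_cst|exact: smx_cst|exact: sB].
Qed.

Lemma al_block i x : D x -> al i x = block_mx 0 (dmx i Y x) (- (J *m (dmx i Y x)^T)) 0.
Proof.
move=> Dx; apply: (mxd_unique (smx_mxd i smx_K Dx)).
apply: mxd_block; [exact: mxd_cst|exact: smx_mxd|apply: mxdN|exact: mxd_cst].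
by have := mxdM (mxd_cst x (ev R i) J) (mxd_tr (smx_mxd i sY Dx)); rewrite mul0mx add0r.
Qed.

Lemma alE i x : D x -> al i x =
  block_mx 0 (- (A x *m Emat R i *m (B x)^T *m J)) (B x *m Emat R i *m (A x)^T) 0.
Proof.
move=> Dx; rewrite al_block// dY//; congr block_mx.
by rewrite linearN/= mulmxN opprK !trmx_mul trmxK JT Emat_tr !mulmxA JJ mul1mx.
Qed.

(** In both diagonal blocks the inner factors collapse, by B^T J B = J or A^T A = 1, and leave E_i
    E_j = 0. *)
Lemma al_al0 i j x : D x -> i != j -> al i x *m al j x = 0.
Proof.
move=> Dx ij; rewrite !alE// mulmx_block !mul0mx !mulmx0 !add0r !addr0 mulNmx mulmxN.
have -> : A x *m Emat R i *m (B x)^T *m J *m (B x *m Emat R j *m (A x)^T) = 0.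
  transitivity (A x *m Emat R i *m ((B x)^T *m J *m B x) *m Emat R j *m (A x)^T).
    by rewrite !mulmxA.
  rewrite BB// -(mulmxA (A x) (Emat R i) J) EJ (mulmxA (A x) J).
  by rewrite -(mulmxA (A x *m J) (Emat R i)) EE// mulmx0 mul0mx.
have -> : B x *m Emat R i *m (A x)^T *m (A x *m Emat R j *m (B x)^T *m J) = 0.
  transitivity (B x *m Emat R i *m ((A x)^T *m A x) *m Emat R j *m (B x)^T *m J).
    by rewrite !mulmxA.
  by rewrite AA// mulmx1 -(mulmxA (B x) (Emat R i)) EE// mulmx0 !mul0mx.
by rewrite oppr0 block_mx0.
Qed.

Lemma al_comm i j x : D x -> al i x *m al j x = al j x *m al i x.
Proof.
move=> Dx; have [->//|ij] := eqVneq i j.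
have ji : j != i by rewrite eq_sym.
exact: (etrans (al_al0 Dx ij) (esym (al_al0 Dx ji))).
Qed.

(** Conjugation by E_0 turns dK into the constant coefficient of lambda in theta; this is why the
    series solves the frame equation. *)
Lemma al_E0 i x : D x -> al i x *m E0 x = E0 x *m th1 i.
Proof.
move=> Dx; rewrite alE// /E0 /th1 !mulmx_block !mul0mx !mulmx0 !add0r !addr0.
congr block_mx.
  transitivity (- (A x *m Emat R i *m ((B x)^T *m J *m B x))).
    by rewrite mulNmx !mulmxA.
  by rewrite BB// mulmxN mulmxA.
by rewrite -mulmxA AA// mulmx1.
Qed.

Lemma dE0 i x : D x -> mxd x (ev R i) E0 (E0 x *m th0 i x).
Proof.
move=> Dx; have -> : E0 x *m th0 i x = block_mx (dmx i A x) 0 0 (dmx i B x).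
  by rewrite dA// dB// /E0 /th0 mulmx_block !mul0mx !mulmx0 !addr0 !add0r.
by apply: mxd_block; [exact: smx_mxd|exact: mxd_cst|exact: mxd_cst|exact: smx_mxd].
Qed.

(** The Lie algebra condition is taken as X G + G X^T = 0, because dE = E theta differentiates E G
    E^T to E (theta G + G theta^T) E^T. *)
Lemma th0_G i x : th0 i x *m Gre + Gre *m (th0 i x)^T = 0.
Proof.
rewrite /th0 /Gre tr_block_mx !trmx0 !mulmx_block !mul0mx !mulmx0 !mul1mx !mulmx1 !add0r !addr0.
rewrite add_block_mx !addr0.
have -> : omega_form k F i x + (omega_form k F i x)^T = 0.
  rewrite /omega_form linearD linearN/= !trmx_mul trmxK JT Emat_tr !mulmxA.
  by rewrite addrA addrK addNr.
have -> : tau_form k F i x *m J = - (Emat R i *m (F x)^T) + F x *m Emat R i.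
  by rewrite /tau_form mulmxDl mulNmx -!mulmxA JJ !mulmx1.
have -> : J *m (tau_form k F i x)^T = - (F x *m Emat R i) + Emat R i *m (F x)^T.
  by rewrite /tau_form linearD linearN/= !trmx_mul trmxK JT Emat_tr mulmxDr mulmxN !mulmxA JJ !mul1mx.
by rewrite addrA addrK addNr block_mx0.
Qed.

Lemma th1_G i : th1 i *m Gre + Gre *m (th1 i)^T = 0.
Proof.
rewrite /th1 /Gre tr_block_mx !trmx0 !mulmx_block !mul0mx !mulmx0 !mul1mx !mulmx1 !add0r !addr0.
rewrite add_block_mx !addr0 linearN/= trmx_mul JT Emat_tr mulNmx mulmxN -mulmxA JJ mulmx1.
by rewrite mulmxA JJ mul1mx addNr subrr block_mx0.
Qed.

Lemma E0_G x : D x -> E0 x *m Gre *m (E0 x)^T = Gre.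
Proof.
move=> Dx; rewrite /E0 /Gre tr_block_mx !trmx0 !mulmx_block.
rewrite !mul0mx !mulmx0 !mulmx1 !add0r !addr0 (mulmx1C (AA Dx)).
have -> : B x *m J *m (B x)^T = B x *m (J *m (B x)^T *m J) *m J.
  by rewrite -!mulmxA JJ mulmx1.
by rewrite !mul0mx (orth_inv (BB Dx)) mul1mx.
Qed.

Lemma G_G : Gre *m Gre = 1%:M.
Proof.
by rewrite /Gre mulmx_block !mul0mx !mulmx0 !mulmx1 JJ !add0r !addr0 -scalar_mx_block.
Qed.

Lemma s_s : sre *m sre = 1%:M.
Proof.
by rewrite /sre mulmx_block !mul0mx !mulmx0 !mulmx1 mulmxN mulmx1 opprK !add0r !addr0 -scalar_mx_block.
Qed.

Lemma s_al i x : D x -> sre *m al i x *m sre = - al i x.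
Proof.
move=> Dx; rewrite alE// /sre !mulmx_block !mul0mx !mulmx0 !mul1mx !mulmx1 !add0r !addr0.
by rewrite mul0mx !mulmxN !mulNmx !mulmx1 mul1mx opp_block_mx !oppr0.
Qed.

Lemma s_E0 x : sre *m E0 x *m sre = E0 x.
Proof.
rewrite /E0 /sre !mulmx_block !mul0mx !mulmx0 !mul1mx !mulmx1 !add0r !addr0.
by rewrite mul0mx mulmxN !mulNmx mulmx1 mul1mx opprK.
Qed.

Lemma GmatE : Gmat R n k = cmx Gre.
Proof. by rewrite /Gmat /Gre !cmxE map_block_mx !map_mx0 map_mx1. Qed.

Lemma InnE : Inn R n = cmx sre.
Proof. by rewrite /Inn /sre !cmxE map_block_mx !map_mx0 map_mxN !map_mx1. Qed.

Lemma thetaE l i x : theta k F l i x = cmx (th0 i x) + l *: cmx (th1 i).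
Proof.
rewrite /theta /th0 /th1 !cmxE !map_block_mx !map_mx0 map_mxN scale_block_mx add_block_mx.
by rewrite !scaler0 !addr0 !add0r scalerN.
Qed.

Lemma theta_G l i x : theta k F l i x *m Gmat R n k + Gmat R n k *m (theta k F l i x)^T = 0.
Proof.
rewrite GmatE thetaE !cmxE linearD linearZ/= mulmxDl mulmxDr -scalemxAl -scalemxAr.
rewrite !map_trmx -!map_mxM addrACA -scalerDr -!map_mxD th0_G th1_G.
by rewrite !map_mx0 scaler0 addr0.
Qed.

Section Series.
Context (G : nat -> 'rV[R]_n -> 'M[R]_(n + n)).
Hypothesis G0 : forall x, G 0%N x = 1%:M.
Hypothesis sG : forall m, smx D (G m).
Hypothesis Gb0 : forall m, G m.+1 0 = 0.
Hypothesis dG : forall m i x, D x -> mxd x (ev R i) (G m.+1) (G m x *m al i x).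

Definition Em m x := G m x *m E0 x.
Definition frame (x : 'rV[R]_n) (l : (R[i])^o) : 'M[R[i]]_(n + n) :=
  \matrix_(a, b) PC (fun m => Em m x a b) l.

Lemma frameE x l a b : frame x l a b = PC (fun m => Em m x a b) l.
Proof. by rewrite /frame mxE. Qed.

Lemma Em0 x : Em 0 x = E0 x. Proof. by rewrite /Em G0 mul1mx. Qed.

Lemma dEm0 i x : D x -> mxd x (ev R i) (Em 0) (Em 0 x *m th0 i x).
Proof.
move=> Dx; have := dE0 i Dx; have -> // : E0 = Em 0.
by apply/funext => y; rewrite Em0.
Qed.

Lemma dEmS m i x : D x -> mxd x (ev R i) (Em m.+1) (Em m.+1 x *m th0 i x + Em m x *m th1 i).
Proof.
move=> Dx; have := mxdM (dG m i Dx) (dE0 i Dx).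
by rewrite -(mulmxA (G m x)) al_E0// !mulmxA [X in mxd _ _ _ X]addrC.
Qed.

Lemma Em_entire a b : entire_family D (fun m x => Em m x a b).
Proof.
have sal i : smx D (al i) by exact: (smx_dmx oD i smx_K).
have H := entire_family_sum oD (index_enum _)
  (fun c => entire_familyM oD (tower_entire oD scD D0 sal G0 sG Gb0 dG a c) (smx_E0 c b)).
move: H; congr entire_family; apply/funext => m; apply/funext => x.
by rewrite [RHS]mxE.
Qed.

Lemma Em_seq x a b : D x -> entire_seq (fun m => Em m x a b).
Proof. by move=> Dx; exact: (entire_family_at (Em_entire a b) Dx). Qed.

(** The coefficient of lambda^m in dE is Em_m th0 + Em_(m-1) th1, and the index shift in the second
    term is multiplication by lambda. *)
Lemma dframe i x l : D x -> cmd i x (fun y => frame y l) (frame x l *m theta k F l i x).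
Proof.
move=> Dx a b.
have H : cpd i x (fun y => PC (fun m => Em m y a b) l)
    (PC (fun m => partial i (fun y => Em m y a b : R^o) x) l).
  split.
    by apply: (PL_partial (D := D) (L := @complex.Re R) (f := fun m y => Em m y a b));
      [exact: ler_Re_normc|exact: Em_entire|].
  by apply: (PL_partial (D := D) (L := @complex.Im R) (f := fun m y => Em m y a b));
    [exact: ler_Im_normc|exact: Em_entire|].
move: H; congr cpd; first by apply/funext => y; rewrite frameE.
have -> : (fun m => partial i (fun y => Em m y a b : R^o) x) =
  (fun m => \sum_(c <- index_enum _) Em m x a c * th0 i x c b +
     shift_seq (fun m => \sum_(c <- index_enum _) Em m x a c * th1 i c b) m).
  apply/funext => -[|m]; rewrite /partial.
    by rewrite (is_deriveP (dEm0 i Dx a b)) [LHS]mxE /= addr0.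
  rewrite (is_deriveP (dEmS m i Dx a b)) [LHS]mxE.
  by congr (_ + _); rewrite /= [LHS]mxE.
have es c : entire_seq (fun m => Em m x a c) by exact: Em_seq.
rewrite PCD; [|exact: entire_seq_sum|exact/entire_seq_shift/entire_seq_sum].
rewrite PC_shift; last exact: entire_seq_sum.
rewrite !PC_sum// thetaE mulmxDr -scalemxAr [RHS]mxE; congr (_ + _).
  by rewrite [RHS]mxE; apply: eq_bigr => c _; rewrite frameE [cmx _ c b]mxE.
rewrite [RHS]mxE; congr (_ * _).
by rewrite [RHS]mxE; apply: eq_bigr => c _; rewrite frameE [cmx _ c b]mxE.
Qed.

Lemma frame_base l : frame 0 l = cmx (E0 0).
Proof.
apply/matrixP => a b; rewrite frameE [RHS]mxE.
have H1 := Em_seq a b D0.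
have H2 m : Em m.+1 0 a b = 0 by rewrite /Em Gb0 mul0mx mxE.
by rewrite PC_cst// Em0.
Qed.

(** The product is constant in x by [theta_G], and at x = 0 the frame is E_0(0) for every lambda.
    Since G^2 = 1, the form E^T G E = G follows in [frame_orth]. *)
Lemma frame_G x l : D x -> frame x l *m Gmat R n k *m (frame x l)^T = Gmat R n k.
Proof.
move=> Dx.
have -> : frame x l *m Gmat R n k *m (frame x l)^T = frame 0 l *m Gmat R n k *m (frame 0 l)^T.
  apply: (cmd_const oD scD (M := fun y => frame y l *m Gmat R n k *m (frame y l)^T)) => // i y Dy.
  have := cmdM (cmdM (dframe i l Dy) (cmd_cst i y (Gmat R n k))) (cmd_tr (dframe i l Dy)).
  rewrite mulmx0 addr0 trmx_mul.
  have -> // : frame y l *m theta k F l i y *m Gmat R n k *m (frame y l)^T +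
     frame y l *m Gmat R n k *m ((theta k F l i y)^T *m (frame y l)^T) = 0.
  rewrite mulmxA -mulmxDl -!(mulmxA (frame y l)) -mulmxDr theta_G.
  by rewrite mulmx0 mul0mx.
by rewrite frame_base GmatE !cmxE map_trmx -!map_mxM E0_G.
Qed.

Lemma GG : Gmat R n k *m Gmat R n k = 1%:M.
Proof. by rewrite GmatE !cmxE -map_mxM G_G map_mx1. Qed.

Lemma frame_inv x l : D x -> frame x l *m (Gmat R n k *m (frame x l)^T *m Gmat R n k) = 1%:M.
Proof. by move=> Dx; rewrite !mulmxA frame_G// GG. Qed.

Lemma frame_unit x l : D x -> frame x l \in unitmx.
Proof. by move=> Dx; case: (mulmx1_unit (frame_inv l Dx)). Qed.

Lemma frame_orth x l : D x -> (frame x l)^T *m Gmat R n k *m frame x l = Gmat R n k.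
Proof.
move=> Dx; have := mulmx1C (frame_inv l Dx) => /(congr1 (mulmx (Gmat R n k))).
by rewrite mulmx1 !mulmxA GG mul1mx.
Qed.

(** Conjugation by [sre] reverses the sign of dK, so by induction both sides have the same
    differential; for positive index both vanish at 0. *)
Lemma G_parity m x : D x -> sre *m G m x *m sre = (-1) ^+ m *: G m x.
Proof.
elim: m x => [|m IH] x Dx; first by rewrite G0 mulmx1 s_s expr0 scale1r.
apply/eqP; rewrite -subr_eq0; apply/eqP.
have -> : sre *m G m.+1 x *m sre - (-1) ^+ m.+1 *: G m.+1 x =
   sre *m G m.+1 0 *m sre - (-1) ^+ m.+1 *: G m.+1 0.
  apply: (mxd_const oD scD (M := fun y => sre *m G m.+1 y *m sre - (-1) ^+ m.+1 *: G m.+1 y)) => // i y Dy.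
  have c1 (S : 'M[R]_(n + n)) := mxd_cst y (ev R i) S.
  have := mxdD (mxdM (mxdM (c1 sre) (dG m i Dy)) (c1 sre))
    (mxdN (mxdM (c1 ((-1) ^+ m.+1)%:M) (dG m i Dy))).
  rewrite !mul0mx !mulmx0 !add0r !addr0 mul_scalar_mx.
  have -> : sre *m (G m y *m al i y) *m sre = (sre *m G m y *m sre) *m (sre *m al i y *m sre).
    by rewrite -!mulmxA (mulmxA sre sre) s_s mul1mx.
  rewrite IH// s_al// -scalemxAl mulmxN exprS mulN1r scaleNr opprK scalerN addNr.
  by congr mxd; apply/funext => z; rewrite mul_scalar_mx.
by rewrite Gb0 mulmx0 mul0mx scaler0 subrr.
Qed.

Lemma Em_parity m x : D x -> sre *m Em m x *m sre = (-1) ^+ m *: Em m x.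
Proof.
move=> Dx; rewrite /Em.
have -> : sre *m (G m x *m E0 x) *m sre = (sre *m G m x *m sre) *m (sre *m E0 x *m sre).
  by rewrite -!mulmxA (mulmxA sre sre) s_s mul1mx.
by rewrite G_parity// s_E0 -scalemxAl.
Qed.

Lemma frame_opp x l : D x -> frame x (- l) = Inn R n *m frame x l *m Inn R n.
Proof.
move=> Dx; apply/matrixP => a b; rewrite frameE PC_opp InnE.
pose f c m := \sum_(d <- index_enum _) Em m x d c * sre a d.
have ef c : entire_seq (f c) by apply: entire_seq_sum => d; exact: Em_seq.
have -> : (fun m => (-1) ^+ m * Em m x a b) = (fun m => \sum_(c <- index_enum _) f c m * sre c b).
  apply/funext => m; have /matrixP/(_ a b) := Em_parity m Dx.
  rewrite [X in _ = X]mxE => <-; rewrite [LHS]mxE; apply: eq_bigr => c _.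
  by rewrite [X in X * _]mxE; congr (_ * _); apply: eq_bigr => d _; exact: mulrC.
rewrite PC_sum// [RHS]mxE; apply: eq_bigr => c _; rewrite [cmx sre c b]mxE; congr (_ * _).
rewrite /f PC_sum; last by move=> d; exact: Em_seq.
by rewrite [RHS]mxE; apply: eq_bigr => d _; rewrite frameE [cmx sre a d]mxE mulrC.
Qed.

(** Both sides have differential dK and vanish at 0; for K this rests on Y(0) = 0, that is, on
    phi_l(0) = 0. *)
Lemma G1E x : D x -> G 1 x = Kmx x.
Proof.
move=> Dx; apply/eqP; rewrite -subr_eq0; apply/eqP.
have -> : G 1 x - Kmx x = G 1 0 - Kmx 0.
  apply: (mxd_const oD scD (M := fun y => G 1 y - Kmx y)) => // i y Dy.
  have := mxdD (dG 0 i Dy) (mxdN (smx_mxd i smx_K Dy)).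
  by rewrite G0 mul1mx subrr.
by rewrite Gb0 /Kmx Y0 trmx0 mulmx0 oppr0 block_mx0 subrr.
Qed.

Lemma frame0 x : D x -> frame x 0 = cmx (E0 x).
Proof.
move=> Dx; apply/matrixP => a b; rewrite frameE PC_0; last exact: Em_seq.
by rewrite Em0 [RHS]mxE.
Qed.

Lemma frame_derivable x l : D x ->
  is_derive (l : (R[i])^o) (1 : (R[i])^o) (frame x)
    (\matrix_(a, b) PC (deriv_seq (fun m => Em m x a b)) l).
Proof.
by move=> Dx; apply: (PC_mx_derive (u := fun a b m => Em m x a b)) => a b; exact: Em_seq.
Qed.

Lemma frame_log_derivative x : D x -> 'D_1 (frame x) 0 *m invmx (frame x 0) =
  block_mx 0 (cmx (Y x)) (- (cmx J *m (cmx (Y x))^T)) 0.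
Proof.
move=> Dx; have [_ ->] := frame_derivable 0 Dx.
have -> : \matrix_(a, b) PC (deriv_seq (fun m => Em m x a b)) 0 = cmx (Kmx x) *m frame x 0.
  rewrite (frame0 Dx) !cmxE -map_mxM -G1E// -/(Em 1 x).
  apply/matrixP => a b; rewrite [LHS]mxE [RHS]mxE.
  have ed : entire_seq (deriv_seq (fun m => Em m x a b)).
    by apply: entire_seq_deriv; exact: Em_seq.
  rewrite PC_0; last exact: ed.
  have -> // : deriv_seq (fun m => Em m x a b) 0 = Em 1 x a b.
  by rewrite /deriv_seq mul1r.
rewrite mulmxK ?frame_unit//.
by rewrite /Kmx !cmxE map_block_mx !map_mx0 map_mxN map_mxM map_trmx.
Qed.

Lemma frame_extended : extended_frame k D F frame.
Proof.
have sm_part (P : R[i] -> R) : (forall a b, sm (DC D) (fun p => P (PC (fun m => Em m (xpart p) a b) (lpart p)) : R^o)) ->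
    smooth_on (DC D) (fun p => \matrix_(a, b) P (frame (xpart p) (lpart p) a b) : 'M[R]_(n + n)).
  move=> H; apply: (smx_smooth_on (open_DC oD)) => a b.
  by apply: (eq_sm (open_DC oD) _ (H a b)) => p _; rewrite [RHS]mxE frameE.
split; first by apply: sm_part => a b m; exact: (Ck_PC oD m (Em_entire a b)).1.
split; first by apply: sm_part => a b m; exact: (Ck_PC oD m (Em_entire a b)).2.
split; first by move=> x l Dx; case: (frame_derivable l Dx).
split; first by move=> x l Dx; exact: frame_orth.
split.
  by move=> x l i Dx; rewrite (cmd_cpartial (dframe i l Dx)) mulKmx ?frame_unit.
split.
  move=> x l Dx; apply/matrixP => a b; rewrite [LHS]mxE !frameE PC_conj ?conjCK//.
  exact: Em_seq.
move=> x l Dx; have II : Inn R n *m Inn R n = 1%:M.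
  by rewrite InnE !cmxE -map_mxM s_s map_mx1.
have [_ uI] := mulmx1_unit II.
by rewrite frame_opp// !mulmxA II mul1mx mulmxK.
Qed.

End Series.

Lemma extended_frame_exists : exists E : 'rV[R]_n -> (R[i])^o -> 'M[R[i]]_(n + n),
  extended_frame k D F E /\ forall x, D x -> 'D_1 (E x) 0 *m invmx (E x 0) =
    block_mx 0 (cmx (Y x)) (- (cmx J *m (cmx (Y x))^T)) 0.
Proof.
have sal i : smx D (al i) by exact: (smx_dmx oD i smx_K).
have cal i j x : D x -> dmx i (al j) x = dmx j (al i) x.
  by move=> Dx; exact: (dmx_sym oD i j smx_K Dx).
have [G [G0 sG Gb0 dG]] := tower_exists oD scD D0 sal cal al_comm.
exists (frame G); split; first exact: frame_extended.
by move=> x Dx; exact: frame_log_derivative.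
Qed.

End Frame.

(** * Assembly of the solution, the frame and the null basis *)

Lemma signed_square {R : realFieldType} (e u : R) : e * e = 1 ->
  - (e * u) * e * - (e * u) = e * (u * u).
Proof.
move=> ee; transitivity (e * e * (e * (u * u))); first by ring.
by rewrite ee mul1r.
Qed.

Theorem theorem3p3 (R : realType) (n k : nat)
  (hn : (2 <= n)%N) (hk : (1 <= k <= n.-1)%N)
  (D : set 'rV[R]_n) (phi : nat -> 'rV[R]_n -> 'cV[R]_n) :
  open D -> simply_connected D -> D 0 ->
  combescure_seq k D phi ->
  (forall i, (1 <= i <= n)%N -> phi i 0 = 0) ->
  exists (F : 'rV[R]_n -> 'M[R]_n)
         (E : 'rV[R]_n -> (R[i])^o -> 'M[R[i]]_(n + n))
         (c : nat -> 'cV[R]_n),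
    system_solution k D F /\ extended_frame k D F E /\ null_basis k c /\
    exists Y : 'rV[R]_n -> 'M[R[i]]_n,
      (forall x, D x ->
         'D_1 (E x) 0 *m invmx (E x 0) =
         block_mx 0 (Y x) (- (cmx (@Jmat R n k) *m (Y x)^T)) 0) /\
      (forall l x, (1 <= l <= n)%N -> D x -> cmx (phi l x) = Y x *m cmx (c l)).
Proof.
move=> oD scD D0 cs phi0.
pose Phi (x : 'rV[R]_n) : 'M[R]_n := \matrix_(a < n, l < n) phi l.+1 x a 0.
have [A [U [sPhi sA sU H]]] : exists A U : 'rV[R]_n -> 'M[R]_n,
  [/\ smx D Phi, smx D A, smx D U & forall x, D x ->
    [/\ (A x)^T *m A x = 1%:M, forall j, dmx j Phi x = A x *m Emat R j *m U x,
      U x \in unitmx, forall l, \sum_j eps k j * (U x j l * U x j l) = 0 &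
      forall j l, U x j l != 0]] := frame_exists hn oD cs.
have AA x : D x -> (A x)^T *m A x = 1%:M by move=> /H[].
have dPhi j x : D x -> dmx j Phi x = A x *m Emat R j *m U x by move=> /H[].
have uU x : D x -> U x \in unitmx by move=> /H[].
have gU x l : D x -> \sum_j eps k j * (U x j l * U x j l) = 0 by move=> /H[].
have U_neq0 x j l : D x -> U x j l != 0 by move=> /H[].
have Phi0 : Phi 0 = 0.
  by apply/matrixP => a l; rewrite [LHS]mxE phi0 ?ltn_ord// !mxE.
have dA i x : D x -> dmx i A x = A x *m omega_form k (Fsol k A) i x.
  move=> Dx; rewrite -(Gam_omega k oD sPhi sA sU AA dPhi uU i Dx) /Gam.
  by rewrite mulmxA (mulmx1C (AA _ Dx)) mul1mx.
have BB x (Dx : D x) := BJB oD sPhi sA sU AA dPhi uU gU U_neq0 scD D0 Dx.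
have dB' i x (Dx : D x) := dB oD sPhi sA sU AA dPhi uU gU U_neq0 scD D0 i Dx.
have dY' i x (Dx : D x) := dY oD sPhi sA sU AA dPhi uU gU U_neq0 scD D0 i Dx.
have sB := smx_B k oD sU 0.
have Y0 : Ymx k Phi U 0 0 = 0 by rewrite /Ymx Phi0 mul0mx.
have [E [HE DE]] := extended_frame_exists oD scD D0 sA sB (smx_Y k oD U sPhi 0) AA BB dA dB' dY' Y0.
have [C0 C0E] : exists M, M = C0mx k U 0 by eexists.
have C0jl j l : C0 j l = - (eps k j * U 0 j l).
  by rewrite C0E /C0mx /Vmx [LHS]mxE JmxE.
(* Vectors are numbered from 1 and columns from 0; outside 1..n the value 0 is a mere default. *)
pose c (l : nat) : 'cV[R]_n := if insub l.-1 is Some i then col i C0 else 0.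
have cE (l : 'I_n) : c l.+1 = col l C0 by rewrite /c /= (valK l).
exists (Fsol k A), E, c; split; [|split => //; split].
- split; first exact: (smx_smooth_on oD (smx_F k oD sA)).
  split; first by move=> x i Dx; exact: (F_diag k oD sA AA i Dx).
  split; first exact: (pure_gauge_flat oD sA (smx_tr oD sA) AA dA).
  (* For [B] the smooth inverse is J B^T J. *)
  apply: (pure_gauge_flat oD (A' := fun x => Jmat R n k *m (Bmx k U 0 x)^T *m Jmat R n k) sB _ _ dB').
    apply: (smxM oD); last exact: smx_cst.
    by apply: (smxM oD); [exact: smx_cst|exact: smx_tr].
  by move=> x Dx; apply: mulmx1C; exact: orth_inv (BB x Dx).
- split.
    (* The entries of this column are - eps_j U_jl(0), so its J-square is the Guichard sum at 0. *)
    case=> // l hl; rewrite (cE (Ordinal hl)) /kdot mxE -[RHS](gU 0 (Ordinal hl) D0).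
    apply: eq_bigr => j _; rewrite mxJE [(_^T) 0 j]mxE [col _ _ j 0]mxE C0jl.
    by apply: signed_square; exact: eps2.
  have -> : \matrix_(l < n) (c l.+1)^T = C0^T.
    by apply/matrixP => l j; rewrite [LHS]mxE cE !mxE.
  by rewrite row_free_unit unitmx_tr C0E; exact: (unit_V k uU D0).
- exists (fun x => cmx (Ymx k Phi U 0 x)); split=> [x Dx|]; first exact: DE.
  case=> // l x hl Dx; rewrite (cE (Ordinal hl)) !cmxE -map_mxM; congr map_mx.
  apply/colP => a; transitivity ((Ymx k Phi U 0 x *m C0) a (Ordinal hl)).
    by rewrite C0E (YC k Phi uU D0 x) [RHS]mxE.
  by rewrite [LHS]mxE [RHS]mxE; apply: eq_bigr => b _; rewrite [col _ C0 b 0]mxE.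
Qed.
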